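(* Let $d\in\mathbb Z$, let $(\mathcal A,s_{d+1}M_{\mathcal A})$ and $(\mathcal B,s_{d+1}M_{\mathcal B})$ be $d$-pre-Calabi-Yau categories and let $(\Phi_0,s_{d+1}\Phi):(\mathcal A,s_{d+1}M_{\mathcal A})\to(\mathcal B,s_{d+1}M_{\mathcal B})$ be a strict $d$-pre-Calabi-Yau morphism. Then the element $sm_{\mathcal A\oplus\mathcal B^*}$ defines an $A_\infty$-structure on $\mathcal A\oplus\mathcal B^*[d-1]$ that is almost cyclic with respect to the $\Phi$-mixed bilinear form $\Gamma^\Phi$.
   Context: **Conventions.** $\Bbbk$ is a field of characteristic different from $2,3$; $\otimes=\otimes_\Bbbk$. For a graded space $V$, $V[n]^i=V^{n+i}$ and $s_n:V\to V[n]$ (also $V[m]\to V[m+n]$) is the identity on underlying sets, of degree $-n$; $s=s_1$. The Koszul sign rule is used everywhere: $(f\otimes g)(v\otimes w)=(-1)^{|g||v|}f(v)\otimes g(w)$, and exchanging two adjacent homogeneous elements $v,w$ produces $(-1)^{|v||w|}$. $V^*$ is the graded dual. Products are products of graded spaces. A graded quiver $\mathcal A$ has a set of objects $\mathcal O_{\mathcal A}$ and graded spaces ${}_y\mathcal A_x$; $\mathcal A^*$ has the same objects and ${}_y\mathcal A^*_x=({}_x\mathcal A_y)^*$. For a tuple $\bar x=(x_1,\dots,x_n)$ of objects ($n\ge1$): $\lg(\bar x)=n$, $\mathrm{lt}(\bar x)=x_1$, $\mathrm{rt}(\bar x)=x_n$, $\mathcal A[1]^{\otimes\bar x}={}_{x_1}\mathcal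 A_{x_2}[1]\otimes\cdots\otimes{}_{x_{n-1}}\mathcal A_{x_n}[1]$ ($=\Bbbk$ if $n=1$); $\sqcup$ is concatenation. A *type* is a finite nonempty sequence $\bar{\bar x}=(\bar x^1,\dots,\bar x^n)$ of nonempty tuples, with $\lg(\bar x^1)\ge2$ if $n=1$. $\overline{sa}^i$ denotes a homogeneous pure tensor in $\mathcal A[1]^{\otimes\bar x^i}$, $|\overline{sa}^i|$ its total degree. $t=s_d$ denotes the shift $\mathcal A^*\to\mathcal A^*[d]$, $\mathcal B^*\to\mathcal B^*[d]$. **$A_\infty$-categories.** An $A_\infty$-structure on a graded quiver $\mathcal Q$ is a family $sm$ of degree $1$ maps $sm^{\bar x}:\mathcal Q[1]^{\otimes\bar x}\to{}_{\mathrm{lt}(\bar x)}\mathcal Q_{\mathrm{rt}(\bar x)}[1]$, $\lg(\bar x)\ge2$, with $\sum sm\circ(\mathrm{id}^{\otimes}\otimes sm\otimes\mathrm{id}^{\otimes})=0$ on every $\mathcal Q[1]^{\otimes\bar x}$ (sum over all insertions of $sm$ on a nonempty block of consecutive inputs). Given a family of homogeneous maps ${}_y\Gamma_x:{}_y\mathcal Q_x[1]\otimes{}_x\mathcal Q_y[1]\to\Bbbk$ of degree $d+2$ (a bilinear form of degree $d$), $sm$ is almost cyclic with respect to $\Gamma$ if for $q_i\in{}_{x_i}\mathcal Q_{x_{i+1}}$ ($1\le i<n$), $q_n\in{}_{x_n}\mathcal Q_{x_1}$, $${}_{x_1}\Gamma_{x_n}(sm(sq_1,\dots,sq_{n-1}),sq_n)=(-1)^{|sq_n|\sum_{i<n}|sq_i|}{}_{x_n}\Gamma_{x_{n-1}}(sm(sq_n,sq_1,\dots,sq_{n-2}),sq_{n-1}).$$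 **Pre-Calabi-Yau structures.** $\mathrm{Multi}_d(\mathcal A)$ is the product over all types of the graded spaces of (sums of homogeneous) linear maps $$F^{\bar{\bar x}}:\mathcal A[1]^{\otimes\bar x^1}\otimes\cdots\otimes\mathcal A[1]^{\otimes\bar x^n}\to{}_{\mathrm{lt}(\bar x^1)}\mathcal A_{\mathrm{rt}(\bar x^2)}[-d]\otimes\cdots\otimes{}_{\mathrm{lt}(\bar x^n)}\mathcal A_{\mathrm{rt}(\bar x^1)}[-d].$$ $\mathrm{Multi}_d(\mathcal A)^C$: cyclically invariant elements, $F^{(\bar x^1,\dots,\bar x^n)}=\tau_{out}\circ F^{(\bar x^2,\dots,\bar x^n,\bar x^1)}\circ\tau_{in}$, where $\tau_{in}$ moves the first input block to the end and $\tau_{out}$ moves the last output factor to the front, with Koszul signs. $s_{d+1}F$ is identified with the family $(\mathrm{id}^{\otimes(n-1)}\otimes s_{d+1})\circ F^{\bar{\bar x}}$. A disc of type $(\bar x^1,\dots,\bar x^n)$ is a circle with outgoing arrows labelled $1,\dots,n$ clockwise; the sector between outgoing arrows $i-1$ and $i$ (arrow $0$ is arrow $n$) contains $\lg(\bar x^i)-1$ incoming arrows, separated by the objects $x^i_1,x^i_2,\dots$ read counterclockwise; the incoming arrow between $x^i_j,x^i_{j+1}$ is the input ${}_{x^i_j}\mathcal A_{x^i_{j+1}}[1]$, outgoing arrow $i$ is the $i$-th output. Outgoing arrow $i$ of one disc may be connected to an incoming arrow between $u,u'$ of another if $\mathrm{lt}(\bar x^i)=u$, $\mathrm{rt}(\bar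 x^{i+1})=u'$ ($\bar x^{n+1}=\bar x^1$). A two-disc diagram consists of a disc filled with $G$ and one filled with $F$, one outgoing arrow of the $G$-disc being connected to one incoming arrow of the $F$-disc, with a chosen free outgoing arrow (root). Free outgoing arrows are labelled clockwise $1,\dots,N$, the root being $N$; the type lists the objects read counterclockwise between free outgoing arrows $i-1$ and $i$. The bold arrow of each disc is its arrow on the path to the root. A disc acts by $(\mathrm{id}^\otimes\otimes s_{d+1}\otimes\mathrm{id}^\otimes)\circ F$, $s_{d+1}$ at the bold output, if its bold arrow is outgoing, and by $(-1)^{(d+1)(|F|+d+1)}F\circ(\mathrm{id}^\otimes\otimes s_{d+1}\otimes\mathrm{id}^\otimes)$, $s_{d+1}:\mathcal A[-d]\to\mathcal A[1]$ at the bold input, if it is incoming (discs being relabelled cyclically if needed). The evaluation takes the inputs in the order of the type, permutes (Koszul signs) so that the inputs of the $G$-disc are leftmost in order, applies $G$, permutes so that the inputs of the $F$-disc are leftmost in order, applies $F$, and permutes the outputs into the order $1,\dots,N$. $(s_{d+1}F\circ_{nec}s_{d+1}G)^{\bar{\bar z}}$ is the sum of evaluations over all such diagrams of type $\bar{\bar z}$. A $d$-pre-Calabi-Yau structure on $\mathcal A$ is a degree $1$ element $s_{d+1}M_{\mathcal A}\in\mathrm{Multi}_d(\mathcal A)^C[d+1]$ with $s_{d+1}M_{\mathcal A}\circ_{nec}s_{d+1}M_{\mathcal A}=0$. **The structure $sm_{\mathcal A\oplus\mathcal A^*}$.** It equals $\mathsf j(s_{d+1}M_{\mathcal A})$, where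 for $s_{d+1}\phi\in\mathrm{Multi}_d(\mathcal A)[d+1]$, $\mathsf j(s_{d+1}\phi)=s\psi$ is defined on words $w=(\overline{sa}^n,tf^{n-1},\overline{sa}^{n-1},\dots,tf^1,\overline{sa}^1)$ in $\mathcal A[1]\oplus\mathcal A^*[d]$, $\overline{sa}^i\in\mathcal A[1]^{\otimes\bar x^i}$, $tf^i\in{}_{\mathrm{rt}(\bar x^{i+1})}\mathcal A^*_{\mathrm{lt}(\bar x^i)}[d]$: the $\mathcal A$-valued part of $\psi(w)$ is $(-1)^\epsilon\big(\bigotimes_{i=1}^{n-1}(f^i\circ s_d)\otimes s_d\big)\big(\phi^{(\bar x^1,\dots,\bar x^n)}(\overline{sa}^1,\dots,\overline{sa}^n)\big)$, $$\epsilon=\sum_{i=1}^{n-1}|tf^i|\sum_{j=i+1}^n|\overline{sa}^j|+|\phi|\sum_{i=1}^{n-1}|tf^i|+d(n-1)+\sum_{1\le i<j\le n}|\overline{sa}^i||\overline{sa}^j|+\sum_{1\le i<j\le n-1}|tf^i||tf^j|;$$ the $\mathcal A^*[d-1]$-valued part is zero for $n=1$ and for $n\ge2$ is $u$ with, for $sb\in{}_{\mathrm{rt}(\bar x^1)}\mathcal A_{\mathrm{lt}(\bar x^n)}[1]$, $$u(s_{1-d}b)=(-1)^\delta\big(\bigotimes_{i=1}^{n-1}(f^i\circ s_d)\big)\big(\phi^{(\bar x^1\sqcup\bar x^n,\bar x^2,\dots,\bar x^{n-1})}(\overline{sa}^1\otimes sb\otimes\overline{sa}^n,\overline{sa}^2,\dots,\overline{sa}^{n-1})\big),$$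 $$\delta=\epsilon+d\big(|\phi|+\sum_{i=1}^n|\overline{sa}^i|\big)+(|\overline{sa}^n|+|sb|)\sum_{i=2}^{n-1}|\overline{sa}^i|+|\overline{sa}^n||sb|,$$ where $u=s_{d-1}g$ is evaluated by $u(s_{1-d}b)=(-1)^{(d-1)|u|}g(b)$. Same for $\mathcal B$. **Strict morphisms.** A strict $d$-pre-Calabi-Yau morphism is a map $\Phi_0:\mathcal O_{\mathcal A}\to\mathcal O_{\mathcal B}$ and degree $0$ maps $\Phi^{x,y}:{}_x\mathcal A_y[1]\to{}_{\Phi_0(x)}\mathcal B_{\Phi_0(y)}[1]$ with $$(\Phi^{\mathrm{lt}(\bar x^1),\mathrm{rt}(\bar x^2)}\otimes\cdots\otimes\Phi^{\mathrm{lt}(\bar x^n),\mathrm{rt}(\bar x^1)})\circ s_{d+1}M_{\mathcal A}^{\bar{\bar x}}=s_{d+1}M_{\mathcal B}^{\Phi_0(\bar{\bar x})}\circ(\Phi^{\otimes(\lg(\bar x^1)-1)}\otimes\cdots\otimes\Phi^{\otimes(\lg(\bar x^n)-1)})$$ for all types (shifts of $\Phi$ understood on outputs). Denote by $\tilde\Phi:{}_x\mathcal A_y\to{}_{\Phi_0(x)}\mathcal B_{\Phi_0(y)}$ the corresponding unshifted degree $0$ map. **The quiver $\mathcal A\oplus\mathcal B^*[d-1]$, $sm_{\mathcal A\oplus\mathcal B^*}$ and $\Gamma^\Phi$.** $\mathcal A\oplus\mathcal B^*[d-1]$ has objects $\mathcal O_{\mathcal A}$ and ${}_x(\mathcal A\oplus\mathcal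 B^*[d-1])_y={}_x\mathcal A_y\oplus{}_{\Phi_0(x)}\mathcal B^*_{\Phi_0(y)}[d-1]$; its shift by $1$ is $\mathcal A[1]\oplus\mathcal B^*[d]$. For a word $w$ in elements $sa$ of $\mathcal A[1]$ and $tf$ of $\mathcal B^*[d]$: the $\mathcal A[1]$-valued part of $sm_{\mathcal A\oplus\mathcal B^*}(w)$ is the $\mathcal A[1]$-valued part of $sm_{\mathcal A\oplus\mathcal A^*}(w')$, $w'$ being obtained by replacing each $tf$ by $t(f\circ\tilde\Phi)$; the $\mathcal B^*[d]$-valued part is the $\mathcal B^*[d]$-valued part of $sm_{\mathcal B\oplus\mathcal B^*}(w'')$, $w''$ being obtained by replacing each $sa$ by $\Phi(sa)$. The $\Phi$-mixed bilinear form $\Gamma^\Phi$ is given by ${}_y\Gamma^\Phi_x(tf,sa)=-(-1)^{|sa||tf|}{}_x\Gamma^\Phi_y(sa,tf)=(-1)^{|tf|+1}f(\tilde\Phi(a))$ for $f\in{}_{\Phi_0(y)}\mathcal B^*_{\Phi_0(x)}$, $a\in{}_x\mathcal A_y$, and vanishes on pairs $(tf,tg)$ and $(sa,sb)$. *)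

(* Defs.v *)
From HB Require Import structures.
From mathcomp Require Import all_boot all_order all_algebra.
From mathcomp Require Import boolp zify ring.

Set Implicit Arguments.
Unset Strict Implicit.
Unset Printing Implicit Defensive.

Import GRing.Theory.
Local Open Scope ring_scope.
Local Open Scope quotient_scope.

Definition sgn (k : fieldType) (n : int) : k := (-1) ^ n.
Arguments sgn {k} n.

(** [koszul s] is the exponent of the Koszul sign for reordering consecutive
    blocks: [(p, n)] is a block of total degree [n], and the blocks are
    stably sorted by increasing [p]. *)
Fixpoint koszul (s : seq (nat * int)) : int :=
  if s is b :: s' then \sum_(c <- s' | (c.1 < b.1)%N) b.2 * c.2 + koszul s'
  else 0.

(** Exponent of the sign in [(g_1 ox ... ox g_n) (o_1 ox ... ox o_n)]; the
    arguments list the degrees of the [g_i] and of the [o_i]. *)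
Definition koszul_app (g o : seq int) : int :=
  \sum_(i < size g) \sum_(j < size g | (j < i)%N) g`_i * o`_j.

Section Dual.
Variables (k : fieldType) (V : lmodType k).

Definition dual := {linear V -> k^o}.

Definition dual_fun (f : dual) : V -> k^o := f.
Coercion dual_fun : dual >-> Funclass.

Lemma dual_ext (f g : dual) : f =1 g -> f = g.
Proof.
move=> fg; have: dual_fun f = dual_fun g by exact/funext.
case: f g {fg} => f cf [g cg]; rewrite /dual_fun /= => e.
case: _ / e cg => cg; congr GRing.Linear.Pack.
case: cf cg => [[[a0 a]] [b]] [[[a0' a']] [b']].
by rewrite (Prop_irrelevance a0 a0') (Prop_irrelevance a a')
  (Prop_irrelevance b b').
Qed.

Definition mk_dual (f : V -> k^o) (lin_f : linear f) : dual :=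
  HB.pack_for {linear V -> k^o} f (GRing.isLinear.Build k V k^o *:%R f lin_f).

Fact dual_add_lin (f g : dual) : linear (fun v : V => f v + g v : k^o).
Proof. by move=> a u v; rewrite /dual_fun !linearP scalerDr addrACA. Qed.
Fact dual_opp_lin (f : dual) : linear (fun v : V => - f v : k^o).
Proof. by move=> a u v; rewrite /dual_fun linearP opprD scalerN. Qed.
Fact dual_zero_lin : linear (fun v : V => 0 : k^o).
Proof. by move=> a u v; rewrite scaler0 addr0. Qed.
Fact dual_scale_lin (c : k) (f : dual) : linear (fun v : V => c *: f v : k^o).
Proof.
by move=> a u v; rewrite /dual_fun linearP scalerDr !scalerA (mulrC c).
Qed.

HB.instance Definition _ := gen_eqMixin dual.
HB.instance Definition _ := gen_choiceMixin dual.

Fact dual_addA : associative (fun f g : dual => mk_dual (dual_add_lin f g)).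
Proof. by move=> f g h; apply: dual_ext => v; exact: addrA. Qed.
Fact dual_addC : commutative (fun f g : dual => mk_dual (dual_add_lin f g)).
Proof. by move=> f g; apply: dual_ext => v; exact: addrC. Qed.
Fact dual_add0 : left_id (mk_dual dual_zero_lin)
  (fun f g : dual => mk_dual (dual_add_lin f g)).
Proof. by move=> f; apply: dual_ext => v; exact: add0r. Qed.
Fact dual_addN : left_inverse (mk_dual dual_zero_lin)
  (fun f : dual => mk_dual (dual_opp_lin f))
  (fun f g : dual => mk_dual (dual_add_lin f g)).
Proof. by move=> f; apply: dual_ext => v; exact: addNr. Qed.

HB.instance Definition _ :=
  GRing.isZmodule.Build dual dual_addA dual_addC dual_add0 dual_addN.

Definition dual_scale c (f : dual) : dual := mk_dual (dual_scale_lin c f).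

Fact dual_scaleA a b (f : dual) :
  dual_scale a (dual_scale b f) = dual_scale (a * b) f.
Proof. by apply: dual_ext => v; exact: scalerA. Qed.
Fact dual_scale1 : left_id 1 dual_scale.
Proof. by move=> f; apply: dual_ext => v; exact: scale1r. Qed.
Fact dual_scaleDr : right_distributive dual_scale +%R.
Proof. by move=> a f g; apply: dual_ext => v; exact: scalerDr. Qed.
Fact dual_scaleDl (f : dual) :
  {morph (fun a => dual_scale a f) : a b / a + b}.
Proof. by move=> a b; apply: dual_ext => v; exact: scalerDl. Qed.

HB.instance Definition _ := GRing.Zmodule_isLmodule.Build k dual
  dual_scaleA dual_scale1 dual_scaleDr dual_scaleDl.

End Dual.

(** [A x y i] is the component of degree [i] of the space written
    [{}_x A_y]. *)
Record quiver (k : fieldType) := Quiver {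
  obj : choiceType;
  hom :> obj -> obj -> int -> lmodType k }.

Section Words.
Variables (k : fieldType) (A : quiver k).

(** A homogeneous element of [{}_x A_y] together with its degree. *)
Definition letter (x y : obj A) := {i : int & A x y i}.

Definition hl x y i (a : A x y i) : letter x y := Tagged (fun i => A x y i) a.

(** [word x y] is the set of pure tensors of homogeneous elements in the
    union of the [A[1]^{ox (x_1, ..., x_n)}] with [x_1 = x], [x_n = y]; the
    word [wnil x] is the unit of [A[1]^{ox (x)} = k]. *)
Inductive word : obj A -> obj A -> Type :=
| wnil x : word x x
| wcons x y z (a : letter x y) (w : word y z) : word x z.

(** The degree of [sa] in [A[1]]. *)
Definition sdeg x y (a : letter x y) : int := tag a - 1.

Fixpoint wdeg x y (w : word x y) : int :=
  match w with wnil _ => 0 | wcons _ _ _ a w' => sdeg a + wdeg w' end.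

Definition wempty x y (w : word x y) : bool :=
  if w is wnil _ then true else false.

Fixpoint wcat x y z (w : word x y) : word y z -> word x z :=
  match w in word x y return word y z -> word x z with
  | wnil _ => fun w' => w'
  | wcons _ _ _ a w1 => fun w' => wcons a (wcat w1 w')
  end.

Fixpoint wsplits x z (w : word x z) : seq {y : obj A & word x y * word y z}%type :=
  match w in word x z return seq {y : obj A & word x y * word y z}%type with
  | wnil x => [:: existT _ x (wnil x, wnil x)]
  | wcons x _ _ a w' =>
      existT _ x (wnil x, wcons a w') ::
      [seq existT _ (projT1 s) (wcons a (projT2 s).1, (projT2 s).2)
         | s <- wsplits w']
  end.

Definition word_multilinear (V : lmodType k) x y (m : word x y -> V) : Prop :=
  forall u v i (l : word x u) (r : word v y),
    linear (fun a : A u v i => m (wcat l (wcons (hl a) r))).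

End Words.

Arguments wnil {k A} x.
Arguments wcons {k A x y z} a w.

Section Tensor.
Variables (k : fieldType) (A : quiver k).

(** A homogeneous element of some [{}_x A_y], with its source and target. *)
Definition arrow := {p : obj A * obj A & letter p.1 p.2}.

HB.instance Definition _ := Choice.on arrow.

Definition mk_arrow x y (a : letter x y) : arrow :=
  Tagged (fun p : obj A * obj A => letter p.1 p.2) (a : letter (x, y).1 (x, y).2).

(** [0] unless the arrow goes from [x] to [y] and has degree [e]. *)
Definition arrow_comp x y (e : int) (o : arrow) : A x y e :=
  untag 0 (i := (x, y))
    (fun a : letter (x, y).1 (x, y).2 =>
       untag 0 (T_ := fun i => A x y i) (i := e) (fun c => c) a) o.

Lemma arrow_comp_linear x y e u v i :
  linear (fun a : A u v i => arrow_comp x y e (mk_arrow (hl a))).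
Proof.
move=> c a b; have [uv|uv] := eqVneq (u, v) (x, y); last first.
  by rewrite /arrow_comp !untag_dflt // scaler0 addr0.
case: uv a b => -> -> a b; have [ie|ie] := eqVneq i e; last first.
  by rewrite /arrow_comp !(untagE _ _ (erefl : tag (mk_arrow _) = (x, y))) /=
    !untag_dflt // scaler0 addr0.
case: _ / ie; rewrite /arrow_comp.
by rewrite !(untagE _ _ (erefl : tag (mk_arrow _) = (x, y))) /=
  !(untagE _ _ (erefl : tag (hl _) = i)).
Qed.

Definition multilinear (W : lmodType k) (g : seq arrow -> W) : Prop :=
  forall l x y i r, linear (fun a : A x y i => g (l ++ mk_arrow (hl a) :: r)).

Definition formal := seq (k * seq arrow).

Definition feval (W : lmodType k) (g : seq arrow -> W) (s : formal) : W :=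
  \sum_(c <- s) c.1 *: g c.2.

(** Two formal sums of pure tensors represent the same tensor if and only if
    no multilinear map separates them. *)
Definition formal_eq (s t : formal) : bool :=
  `[< forall (W : lmodType k) (g : seq arrow -> W),
        multilinear g -> feval g s = feval g t >].

Fact formal_eq_refl : reflexive formal_eq.
Proof. by move=> s; apply/asboolP. Qed.
Fact formal_eq_sym : symmetric formal_eq.
Proof.
by move=> s t; apply/asboolP/asboolP => st W g gP; rewrite st.
Qed.
Fact formal_eq_trans : transitive formal_eq.
Proof.
by move=> t s u /asboolP st /asboolP tu; apply/asboolP => W g gP;
  rewrite st // tu.
Qed.

Canonical formal_eq_equiv :=
  EquivRel formal_eq formal_eq_refl formal_eq_sym formal_eq_trans.

(** The direct sum, over all finite sequences of pairs [(x_i, y_i)] of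
    objects, of the tensor products of the [{}_{x_i} A_{y_i}]. *)
Definition tensor := {eq_quot formal_eq}.

HB.instance Definition _ := Choice.on tensor.

Definition tpure (l : seq arrow) : tensor := \pi_tensor [:: (1, l)].

(** The linear extension to [tensor] of a multilinear map. *)
Definition tlift (W : lmodType k) (g : seq arrow -> W) (t : tensor) : W :=
  feval g (repr t).

Definition tadd (s t : tensor) : tensor := \pi_tensor (repr s ++ repr t).
Definition tscale (c : k) (t : tensor) : tensor :=
  \pi_tensor [seq (c * p.1, p.2) | p <- repr t].
Definition topp := tscale (- 1).
Definition tzero : tensor := \pi_tensor [::].

Lemma tlift_pi (W : lmodType k) (g : seq arrow -> W) s :
  multilinear g -> tlift g (\pi_tensor s) = feval g s.
Proof.
move=> gP; rewrite /tlift.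
have /eqmodP/asboolP -> // : repr (\pi_tensor s) = s %[mod tensor].
by rewrite reprK.
Qed.

Lemma tensor_ext (s t : tensor) :
  (forall (W : lmodType k) (g : seq arrow -> W),
     multilinear g -> tlift g s = tlift g t) -> s = t.
Proof.
by move=> st; rewrite -[s]reprK -[t]reprK; apply/eqmodP/asboolP.
Qed.

Lemma tlift_add (W : lmodType k) (g : seq arrow -> W) s t :
  multilinear g -> tlift g (tadd s t) = tlift g s + tlift g t.
Proof. by move=> gP; rewrite tlift_pi // /feval big_cat. Qed.

Lemma tlift_scale (W : lmodType k) (g : seq arrow -> W) c t :
  multilinear g -> tlift g (tscale c t) = c *: tlift g t.
Proof.
move=> gP; rewrite tlift_pi // /feval big_map scaler_sumr.
by apply: eq_bigr => p _; rewrite scalerA.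
Qed.

Lemma tlift_zero (W : lmodType k) (g : seq arrow -> W) :
  multilinear g -> tlift g tzero = 0.
Proof. by move=> gP; rewrite tlift_pi // /feval big_nil. Qed.

Fact taddA : associative tadd.
Proof. by move=> r s t; apply: tensor_ext => W g gP; rewrite !tlift_add // addrA. Qed.
Fact taddC : commutative tadd.
Proof. by move=> s t; apply: tensor_ext => W g gP; rewrite !tlift_add // addrC. Qed.
Fact tadd0 : left_id tzero tadd.
Proof.
by move=> t; apply: tensor_ext => W g gP; rewrite tlift_add // tlift_zero // add0r.
Qed.
Fact taddN : left_inverse tzero topp tadd.
Proof.
move=> t; apply: tensor_ext => W g gP.
by rewrite tlift_add // tlift_zero // tlift_scale // scaleN1r addNr.
Qed.

HB.instance Definition _ := GRing.isZmodule.Build tensor taddA taddC tadd0 taddN.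

Fact tscaleA a b t : tscale a (tscale b t) = tscale (a * b) t.
Proof. by apply: tensor_ext => W g gP; rewrite !tlift_scale // scalerA. Qed.
Fact tscale1 : left_id 1 tscale.
Proof. by move=> t; apply: tensor_ext => W g gP; rewrite tlift_scale // scale1r. Qed.
Fact tscaleDr : right_distributive tscale +%R.
Proof.
move=> c s t; apply: tensor_ext => W g gP.
by rewrite tlift_scale // !tlift_add // !tlift_scale // scalerDr.
Qed.
Fact tscaleDl t : {morph (fun a => tscale a t) : a b / a + b}.
Proof.
move=> a b; apply: tensor_ext => W g gP.
by rewrite tlift_scale // tlift_add // !tlift_scale // scalerDl.
Qed.

HB.instance Definition _ := GRing.Zmodule_isLmodule.Build k tensor
  tscaleA tscale1 tscaleDr tscaleDl.

Lemma tlift_linear (W : lmodType k) (g : seq arrow -> W) :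
  multilinear g -> linear (tlift g).
Proof. by move=> gP a s t; rewrite tlift_add // tlift_scale. Qed.

Lemma tlift_pure (W : lmodType k) (g : seq arrow -> W) l :
  multilinear g -> tlift g (tpure l) = g l.
Proof. by move=> gP; rewrite tlift_pi // /feval big_seq1 scale1r. Qed.

Lemma tpure_multilinear : multilinear tpure.
Proof.
move=> l x y i r c a b; apply: tensor_ext => W g gP.
by rewrite tlift_add // tlift_scale // !tlift_pure // gP.
Qed.

(** [t] is a linear combination of pure tensors satisfying [P]. *)
Definition tspan (P : seq arrow -> Prop) (t : tensor) : Prop :=
  exists s : formal, (forall c, c \in s -> P c.2) /\
                     t = \sum_(c <- s) c.1 *: tpure c.2.

End Tensor.

Section Multi.
Variables (k : fieldType) (A : quiver k) (d : int).

(** One block of inputs [overline{sa}^i], with [lt] and [rt] of its tuple of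
    objects. *)
Record sector := Sector { slt : obj A; srt : obj A; sword : word slt srt }.

Definition sector_deg (z : sector) : int := wdeg (sword z).
Definition sectors_deg (zs : seq sector) : int := \sum_(z <- zs) sector_deg z.

(** A sequence of blocks of inputs whose sequence of tuples of objects is a
    type. *)
Definition valid_type (zs : seq sector) : bool :=
  match zs with
  | [::] => false
  | [:: z] => ~~ wempty (sword z)
  | _ => true
  end.

(** The pairs [(lt x^i, rt x^(i+1))]. *)
Definition out_objs (zs : seq sector) : seq (obj A * obj A) :=
  zip (map slt zs) (rot 1 (map srt zs)).

(** The degree of an output in [A[-d]], and the total degree. *)
Definition out_deg (o : arrow A) : int := tag (tagged o) + d.
Definition outs_deg (l : seq (arrow A)) : int := \sum_(o <- l) out_deg o.

(** A homogeneous element of degree [e] of [Multi_d(A)]; the values on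
    sequences that are not valid types are irrelevant. *)
Record multi (e : int) := Multi {
  multi_fun :> seq sector -> tensor A;
  multi_linear : forall X Y x y u v i (l : word x u) (r : word v y),
    linear (fun a : A u v i =>
              multi_fun (X ++ Sector (wcat l (wcons (hl a) r)) :: Y));
  multi_deg : forall zs, valid_type zs ->
    tspan (fun o => map tag o = out_objs zs /\
                    outs_deg o = sectors_deg zs + e)
          (multi_fun zs) }.

Definition tau_out : tensor A -> tensor A :=
  tlift (fun o => let n := (size o).-1 in
    sgn (outs_deg (take n o) * outs_deg (drop n o)) *: tpure (rotr 1 o)).

Definition cyclic_invariant e (F : multi e) : Prop :=
  forall z zs, valid_type (z :: zs) ->
    F (z :: zs) =
    tau_out (sgn (sector_deg z * sectors_deg zs) *: F (rcons zs z)).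

(** [id^{ox (n-1)} ox s_{d+1}]. *)
Definition shift_last : tensor A -> tensor A :=
  tlift (fun o => sgn ((d + 1) * outs_deg (take (size o).-1 o)) *: tpure o).

(** The value of a disc on blocks of inputs [X], [x^p] and [Y], where the
    block [x^p] is obtained from [L] and [R] by inserting in between the
    output [b] of the other disc. *)
Definition plug e (F : multi e) X x y u v (L : word x u) (R : word v y) Y
    (b : arrow A) : tensor A :=
  untag 0 (i := (u, v))
    (fun a : letter (u, v).1 (u, v).2 =>
       F (X ++ Sector (wcat L (wcons (a : letter u v) R)) :: Y)) b.

Section Necklace.
Variables (e e' : int) (F : multi e) (G : multi e').

(** A two-disc diagram of a given type is determined by the chord separating
    the discs, that is by the two places of the boundary between which the
    disc of [G] lies. For a block written [L R], the chord ends at the object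
    shared by [L] and [R]. Reading the boundary clockwise, one meets the
    blocks in increasing order, each of them read backwards. The discs are
    labelled so that the bold outgoing arrow of a disc is its last one and the
    bold incoming arrow of a disc is in its first block; by cyclic invariance
    the labelling does not matter. Below, [o] is a pure tensor of outputs of
    [G] and [q] one of outputs of [F]; the outer [koszul] sign moves the
    inputs of [G] to the left, the next one moves the inputs of [F] to the
    left, and the innermost one orders the outputs. *)

(** The root is on the disc of [F] and the only outgoing arrow of the disc of
    [G] is the connected one: the type is [X, L Y R, X'], with [G] filling
    the disc of type [(Y)] and [F] the one of type [X, L b R, X']. *)
Definition nec_inner X x u v y (L : word x u) (Y : word u v) (R : word v y) X' :
    tensor A :=
  sgn (koszul [:: (1%N, sectors_deg X); (1%N, wdeg L); (0%N, wdeg Y);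
                  (1%N, wdeg R); (1%N, sectors_deg X')]) *:
  tlift (fun o => if o is [:: b] then
      sgn (koszul [:: (2%N, out_deg b - (d + 1)); (0%N, sectors_deg X);
                      (1%N, wdeg L); (3%N, wdeg R); (4%N, sectors_deg X')]) *:
      shift_last (plug F X L R X' b)
    else 0)
  (shift_last (G [:: Sector Y])).

(** The root is on the disc of [F] and the disc of [G] has free outgoing
    arrows: the type is [X, Y1 R, Y, L Ym, X'], with [G] of type [Y1, Y, Ym],
    whose last outgoing arrow is connected, and [F] of type [X, L b R, X']. *)
Definition nec_left X x1 v y1 (Y1 : word x1 v) (R : word v y1) Y
    x2 u y2 (L : word x2 u) (Ym : word u y2) X' : tensor A :=
  sgn (koszul [:: (1%N, sectors_deg X); (0%N, wdeg Y1); (1%N, wdeg R);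
                  (0%N, sectors_deg Y); (1%N, wdeg L); (0%N, wdeg Ym);
                  (1%N, sectors_deg X')]) *:
  tlift (fun o => let o' := take (size Y).+1 o in
    if drop (size Y).+1 o is [:: b] then
      sgn (koszul [:: (5%N, outs_deg o'); (2%N, out_deg b - (d + 1));
                      (0%N, sectors_deg X); (3%N, wdeg R); (1%N, wdeg L);
                      (4%N, sectors_deg X')]) *:
      tlift (fun q => let q1 := take (size X) q in let q2 := drop (size X) q in
          sgn (koszul [:: (0%N, outs_deg q1); (2%N, outs_deg q2 - (d + 1));
                          (1%N, outs_deg o')]) *:
          tpure (q1 ++ o' ++ q2))
        (shift_last (plug F X L R X' b))
    else 0)
  (shift_last (G (Sector Y1 :: Y ++ [:: Sector Ym]))).

(** The root is on the disc of [G]: the type is [Y, L Yi, X, Yj R, Y'], with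
    [G] of type [Y, Yi, Yj, Y'] and [F] of type [L b R, X]; the outgoing arrow
    of [G] between the blocks [Yi] and [Yj] is connected, and [s_{d+1}] is
    applied to it before [F], whence the factors involving [e] and [L]. *)
Definition nec_right Y x1 u y1 (L : word x1 u) (Yi : word u y1) X
    x2 v y2 (Yj : word x2 v) (R : word v y2) Y' : tensor A :=
  sgn (koszul [:: (0%N, sectors_deg Y); (1%N, wdeg L); (0%N, wdeg Yi);
                  (1%N, sectors_deg X); (0%N, wdeg Yj); (1%N, wdeg R);
                  (0%N, sectors_deg Y')]) *:
  tlift (fun o => let o1 := take (size Y) o in
    if drop (size Y) o is b :: o2 then
      sgn (koszul [:: (4%N, outs_deg o1); (1%N, out_deg b);
                      (5%N, outs_deg o2 - (d + 1)); (0%N, wdeg L);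
                      (3%N, sectors_deg X); (2%N, wdeg R)]) *:
      (sgn ((d + 1) * (e + d + 1)) *: (sgn ((d + 1) * wdeg L) *:
      tlift (fun q =>
          sgn (koszul [:: (1%N, outs_deg q); (0%N, outs_deg o1);
                          (2%N, outs_deg o2 - (d + 1))]) *:
          tpure (o1 ++ q ++ o2))
        (plug F [::] L R X b)))
    else 0)
  (shift_last (G (Y ++ Sector Yi :: Sector Yj :: Y'))).

Fixpoint picks T (s : seq T) : seq (seq T * T * seq T) :=
  if s is x :: s' then
    ([::], x, s') :: [seq (x :: p.1.1, p.1.2, p.2) | p <- picks s']
  else [::].

(** [s_{d+1} F o_nec s_{d+1} G]. *)
Definition nec (zs : seq sector) : tensor A :=
  \sum_(p <- picks zs)
   (\sum_(s <- wsplits (sword p.1.2))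
      \sum_(t <- wsplits (projT2 s).2 | ~~ wempty (projT2 t).1)
        nec_inner p.1.1 (projT2 s).1 (projT2 t).1 (projT2 t).2 p.2
  + \sum_(q <- picks p.2)
      \sum_(s <- wsplits (sword p.1.2)) \sum_(t <- wsplits (sword q.1.2))
        (nec_left p.1.1 (projT2 s).1 (projT2 s).2 q.1.1
                  (projT2 t).1 (projT2 t).2 q.2
       + nec_right p.1.1 (projT2 s).1 (projT2 s).2 q.1.1
                   (projT2 t).1 (projT2 t).2 q.2)).

End Necklace.

(** [|s_{d+1} M| = 1] amounts to [|M| = d + 2]. *)
Record precy := PreCY {
  precy_multi :> multi (d + 2);
  precy_cyclic : cyclic_invariant precy_multi;
  precy_nec : forall zs, valid_type zs -> nec precy_multi precy_multi zs = 0 }.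

End Multi.

Section StrictMorphism.
Variables (k : fieldType) (A B : quiver k) (f : obj A -> obj B).
Variable phi : forall x y i, A x y i -> B (f x) (f y) i.

Definition map_letter x y (a : letter x y) : letter (f x) (f y) :=
  hl (phi (tagged a)).

Fixpoint map_word x y (w : word x y) : word (f x) (f y) :=
  match w in word x y return word (f x) (f y) with
  | wnil x => wnil (f x)
  | wcons _ _ _ a w' => wcons (map_letter a) (map_word w')
  end.

Definition map_sector (z : sector A) : sector B := Sector (map_word (sword z)).

Definition map_arrow (o : arrow A) : arrow B :=
  mk_arrow (map_letter (tagged o : letter (tag o).1 (tag o).2)).

Definition map_tensor : tensor A -> tensor B :=
  tlift (fun o => tpure (map map_arrow o)).

End StrictMorphism.

Record strict_morphism (k : fieldType) (d : int) (A B : quiver k)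
    (MA : precy A d) (MB : precy B d) := StrictMorphism {
  smor_obj : obj A -> obj B;
  smor :> forall x y i, {linear A x y i -> B (smor_obj x) (smor_obj y) i};
  smor_compat : forall zs, valid_type zs ->
    map_tensor smor (shift_last d (MA zs)) =
    shift_last d (MB (map (map_sector smor) zs)) }.

Section Ainf.
Variables (k : fieldType) (Q : quiver k).

(** [m w e] is the component of degree [e] (in [Q], that is of degree
    [e - 1] in [Q[1]]) of [sm w]. *)
Definition operations :=
  forall x y : obj Q, word x y -> forall e : int, Q x y e.

Implicit Type m : operations.

(** The value of an operation of degree 1. *)
Definition op_letter m x y (w : word x y) : letter x y :=
  hl (m x y w (wdeg w + 2)).

Record Ainf_structure m : Prop := {
  Ainf_linear : forall x y e, word_multilinear (fun w : word x y => m x y w e);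
  Ainf_degree : forall x y (w : word x y) e,
    ~~ wempty w -> e - 1 <> wdeg w + 1 -> m x y w e = 0;
  Ainf_relation : forall x y (w : word x y) e,
    \sum_(s <- wsplits w)
      \sum_(t <- wsplits (projT2 s).2 | ~~ wempty (projT2 t).1)
        sgn (wdeg (projT2 s).1) *:
        m x y (wcat (projT2 s).1
                 (wcons (op_letter m (projT2 t).1) (projT2 t).2)) e = 0 }.

(** Bilinear forms of degree [D]: [bform_fun x y] is defined on
    [{}_x Q_y[1] ox {}_y Q_x[1]], and has degree [D + 2]. *)
Record bform (D : int) := Bform {
  bform_fun :> forall (x y : obj Q) i j, Q x y i -> Q y x j -> k^o;
  bform_linearl : forall x y i j (q : Q y x j),
    linear (fun p : Q x y i => bform_fun p q);
  bform_linearr : forall x y i j (p : Q x y i),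
    linear (fun q : Q y x j => bform_fun p q);
  bform_degree : forall x y i j (p : Q x y i) (q : Q y x j),
    (i - 1) + (j - 1) + (D + 2) <> 0 -> bform_fun p q = 0 }.

(** Here [w] is [(sq_1, ..., sq_(n-2))], [q] is [q_(n-1)] and [p] is [q_n]. *)
Definition almost_cyclic m D (Gamma : bform D) : Prop :=
  forall x y z (w : word x y) i (q : Q y z i) j (p : Q z x j),
    Gamma x z _ _ (tagged (op_letter m (wcat w (wcons (hl q) (wnil z))))) p =
    sgn (sdeg (hl p) * (wdeg w + sdeg (hl q))) *:
    Gamma z y _ _ (tagged (op_letter m (wcons (hl p) w))) q.

End Ainf.

Definition dual_quiver (k : fieldType) (A : quiver k) : quiver k :=
  @Quiver k (obj A) (fun x y i => dual (A y x (- i)) : lmodType k).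

(** [A + B^*[d-1]], where [f] is the map on objects. *)
Definition mixed_quiver (k : fieldType) (d : int) (A B : quiver k)
    (f : obj A -> obj B) : quiver k :=
  @Quiver k (obj A) (fun x y i =>
    (A x y i * dual_quiver B (f x) (f y) (d - 1 + i)%R)%type : lmodType k).

Section Pairing.
Variables (k : fieldType) (A : quiver k).

(** [f(a)], which vanishes unless [f] is a functional on the space containing
    [a]. *)
Definition dapp (f : arrow (dual_quiver A)) (a : arrow A) : k^o :=
  dual_fun (tagged (tagged f))
    (@arrow_comp k A (tag f).2 (tag f).1 (- tag (tagged f)) a).

Fixpoint dapps (fs : seq (arrow (dual_quiver A))) (os : seq (arrow A)) : k^o :=
  match fs, os with
  | [::], [::] => 1
  | f :: fs', o :: os' => dapp f o * dapps fs' os'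
  | _, _ => 0
  end.

Lemma dapp_linear (f : arrow (dual_quiver A)) x y i :
  linear (fun a : A x y i => dapp f (mk_arrow (hl a))).
Proof.
by move=> c a b; rewrite /dapp arrow_comp_linear /dual_fun linearP.
Qed.

Lemma dapps_linear fs l x y i r :
  linear (fun a : A x y i => dapps fs (l ++ mk_arrow (hl a) :: r)).
Proof.
elim: l fs => [|o l IH] [|f fs] c a b /=; rewrite ?scaler0 ?addr0 //.
  by rewrite dapp_linear mulrDl scalerAl.
by rewrite IH mulrDr scalerAr.
Qed.

End Pairing.

Section Jmap.
Variables (k : fieldType) (A : quiver k) (d : int).

(** The words [(sa^n, tf^(n-1), sa^(n-1), ..., tf^1, sa^1)] in [A[1]] and
    [A^*[d]]; the [f^i] are recorded with their degree in [A^*]. *)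
Inductive pword : obj A -> obj A -> Type :=
| pblock x y (w : word x y) : pword x y
| pcons (x u v y : obj A) (w : @word k A x u)
    (f : @letter k (dual_quiver A) u v)
    (p : pword v y) : pword x y.

Definition pcons_letter x y z (a : @letter k A x y) (p : pword y z) : pword x z :=
  match p in pword y z return @letter k A x y -> pword x z with
  | pblock _ _ w => fun a => pblock (wcons a w)
  | pcons _ _ _ _ w f p' => fun a => pcons (wcons a w) f p'
  end a.

(** The terms of the expansion, by multilinearity, of a word of elements of
    [A[1] + A^*[d]]. *)
Fixpoint expand x y (w : @word k (mixed_quiver d (A := A) (B := A) id) x y) :
    seq (pword x y) :=
  match w in word x y return seq (pword x y) with
  | wnil x => [:: @pblock x x (@wnil k A x)]
  | wcons x y _ q w' =>
      [seq pcons_letter (@hl k A x y (tag q) (tagged q).1) p | p <- expand w'] ++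
      [seq @pcons x x _ _ (@wnil k A x)
             (@hl k (dual_quiver A) x y (d - 1 + tag q) (tagged q).2) p
         | p <- expand w']
  end.

(** [sa^1], and the list [sa^2, ..., sa^n]. *)
Fixpoint pfirst x y (p : pword x y) : {v : obj A & word v y} :=
  match p in pword x y return {v : obj A & word v y} with
  | pblock x _ w => existT _ x w
  | pcons _ _ _ _ _ _ p' => pfirst p'
  end.

Fixpoint prest x y (p : pword x y) : seq (sector A) :=
  match p with
  | pblock _ _ _ => [::]
  | pcons _ _ _ _ w _ p' => rcons (prest p') (Sector w)
  end.

Definition psectors x y (p : pword x y) : seq (sector A) :=
  Sector (projT2 (pfirst p)) :: prest p.

(** The list [f^1, ..., f^(n-1)]. *)
Fixpoint pfuns x y (p : pword x y) : seq (arrow (dual_quiver A)) :=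
  match p with
  | pblock _ _ _ => [::]
  | pcons _ _ _ _ _ f p' => rcons (pfuns p') (mk_arrow f)
  end.

(** The degree of [tf] in [A^*[d]]. *)
Definition tdeg (f : arrow (dual_quiver A)) : int := tag (tagged f) - d.

Definition j_eps (dphi : int) (a t : seq int) : int :=
  let n := size a in
    \sum_(i < n.-1) \sum_(j < n | (i < j)%N) t`_i * a`_j
  + dphi * \sum_(i < n.-1) t`_i + d * n.-1%:Z
  + \sum_(i < n) \sum_(j < n | (i < j)%N) a`_i * a`_j
  + \sum_(i < n.-1) \sum_(j < n.-1 | (i < j)%N) t`_i * t`_j.

Definition j_delta (dphi : int) (a t : seq int) (sb : int) : int :=
  let n := size a in
    j_eps dphi a t + d * (dphi + \sum_(i < n) a`_i)
  + (a`_(n.-1) + sb) * \sum_(1 <= i < n.-1) a`_i + a`_(n.-1) * sb.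

Section WithMulti.
Variables (dphi : int) (phi : multi A d dphi).

(** The component of degree [e] of the [A]-valued part of [psi(w)]. *)
Definition j_val x y (p : pword x y) (e : int) : A x y e :=
  let a := map (@sector_deg k A) (psectors p) in
  let t := map tdeg (pfuns p) in
  sgn (j_eps dphi a t) *:
  tlift (fun o =>
      let o' := take (size t) o in
      if drop (size t) o is [:: b] then
        (sgn (koszul_app (rcons t (- d)) (map (out_deg d) o)) *
         dapps (pfuns p) o') *:
        arrow_comp x y e b
      else 0)
    (phi (psectors p)).

(** The value at [b] of the functional [g] such that [u = s_{d-1} g] is the
    component of degree [e] of the [A^*[d-1]]-valued part of [psi(w)], for
    [w = (san, f, p)]. *)
Definition j_dual_fun x u v y (san : @word k A x u)
    (f : @letter k (dual_quiver A) u v) (p : pword v y) (e : int)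
    (b : A y x (- (d - 1 + e))) : k^o :=
  let q := pcons san f p in
  let a := map (@sector_deg k A) (psectors q) in
  let t := map tdeg (pfuns q) in
  sgn ((d - 1) * e + j_delta dphi a t (sdeg (hl b))) *
  tlift (fun o => sgn (koszul_app t (map (out_deg d) o)) * dapps (pfuns q) o : k^o)
    (phi (Sector (wcat (projT2 (pfirst p)) (wcons (hl b) san)) :: prest p)).

Lemma j_dual_linear x u v y san f p e :
  linear (@j_dual_fun x u v y san f p e).
Proof.
move=> c b b'; rewrite /j_dual_fun /sdeg /=.
have /= -> := multi_linear phi [::] (prest p) (projT2 (pfirst p)) san c b b'.
set g := (fun o : seq (arrow A) => _).
have gP : multilinear (g : _ -> k^o).
  move=> l x' y' i r c' a a'; rewrite /g.
  have dE (a0 : A x' y' i) : map (out_deg d) (l ++ mk_arrow (hl a0) :: r) =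
      map (out_deg d) l ++ (i + d) :: map (out_deg d) r by rewrite map_cat.
  by rewrite !dE dapps_linear mulrDr scalerAr.
rewrite (tlift_linear gP) mulrDr.
by rewrite scalerAr.
Qed.

Definition j_dual x y (p : pword x y) (e : int) : dual_quiver A x y (d - 1 + e) :=
  match p in pword x y return dual_quiver A x y (d - 1 + e) with
  | pblock x y _ => (0 : dual (A y x (- (d - 1 + e))))
  | pcons _ _ _ _ san f p' => mk_dual (@j_dual_linear _ _ _ _ san f p' e)
  end.

(** [sm = j(s_{d+1} phi)]; [sm] and [psi] have the same underlying values. *)
Definition j_map : operations (mixed_quiver d (A := A) (B := A) id) :=
  fun x y w e =>
    (\sum_(p <- expand w) j_val p e, \sum_(p <- expand w) j_dual p e).

End WithMulti.
End Jmap.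

Section Mixed.
Variables (k : fieldType) (d : int) (A B : quiver k).
Variables (MA : precy A d) (MB : precy B d) (Phi : strict_morphism MA MB).

Local Notation f := (smor_obj Phi).
Local Notation AB := (mixed_quiver d f).
Local Notation AA := (mixed_quiver d (A := A) (B := A) id).
Local Notation BB := (mixed_quiver d (A := B) (B := B) id).

Definition dual_comp x y i (g : dual (B (f x) (f y) i)) : dual (A x y i) :=
  ((g : {linear B (f x) (f y) i -> k^o}) \o Phi x y i :
     {linear A x y i -> k^o}).

(** Replaces each [tf] by [t(f o Phi)]. *)
Definition to_AA x y i (q : AB x y i) : AA x y i :=
  (q.1, dual_comp q.2).

(** Replaces each [sa] by [Phi(sa)]. *)
Definition to_BB x y i (q : AB x y i) : BB (f x) (f y) i :=
  (Phi x y i q.1, q.2).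

Definition sm_mixed : operations AB := fun x y w e =>
  ((j_map MA (@map_word k AB AA id to_AA x y w) e).1,
   (j_map MB (@map_word k AB BB f to_BB x y w) e).2).

(** [g(Phi(a))], which vanishes unless [j = - i]. *)
Definition mixed_pairing x y i j (g : dual_quiver B (f x) (f y) i)
    (a : A y x j) : k^o :=
  dapp (mk_arrow (hl g)) (mk_arrow (hl (Phi y x j a))).

Definition mixed_form_fun (x y : obj AB) i j (p : AB x y i) (q : AB y x j) :
    k^o :=
  sgn ((i - 1) + 1) * mixed_pairing p.2 q.1
  - sgn ((i - 1) * (j - 1)) * (sgn ((j - 1) + 1) * mixed_pairing q.2 p.1).

Lemma mixed_pairing_linearl x y i j (a : A y x j) :
  linear (fun g : dual_quiver B (f x) (f y) i => mixed_pairing g a).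
Proof. by move=> c g g'. Qed.

Lemma mixed_pairing_linearr x y i j (g : dual_quiver B (f x) (f y) i) :
  linear (fun a : A y x j => mixed_pairing g a).
Proof. by move=> c a b; rewrite /mixed_pairing linearP dapp_linear. Qed.

Lemma mixed_pairing_deg x y i j (g : dual_quiver B (f x) (f y) i)
    (a : A y x j) : j <> - i -> mixed_pairing g a = 0.
Proof.
move=> ji; rewrite /mixed_pairing /dapp /arrow_comp /=.
rewrite (untagE _ _ (erefl : tag (mk_arrow _) = _)) /= untag_dflt ?linear0 //.
  by rewrite /dual_fun linear0.
exact/eqP.
Qed.

Fact mixed_form_aux (R : comPzRingType) (a b b' c u u' v v' : R) :
  a * (c * u + u') - b * (b' * (c * v + v')) =
  c * (a * u - b * (b' * v)) + (a * u' - b * (b' * v')).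
Proof. by ring. Qed.

Fact mixed_form_linearl x y i j (q : AB y x j) :
  linear (fun p : AB x y i => mixed_form_fun p q).
Proof.
move=> c p p'; rewrite /mixed_form_fun /= mixed_pairing_linearl.
by rewrite mixed_pairing_linearr; exact: mixed_form_aux.
Qed.

Fact mixed_form_linearr x y i j (p : AB x y i) :
  linear (fun q : AB y x j => mixed_form_fun p q).
Proof.
move=> c q q'; rewrite /mixed_form_fun /= mixed_pairing_linearl.
by rewrite mixed_pairing_linearr; exact: mixed_form_aux.
Qed.

Fact mixed_form_degree x y i j (p : AB x y i) (q : AB y x j) :
  (i - 1) + (j - 1) + (d - 1 + 2) <> 0 -> mixed_form_fun p q = 0.
Proof.
move=> ij; rewrite /mixed_form_fun !mixed_pairing_deg ?mulr0 ?subr0 //; lia.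
Qed.

(** [Gamma^Phi], a bilinear form of degree [d - 1]. *)
Definition mixed_form : bform AB (d - 1) :=
  Bform mixed_form_linearl mixed_form_linearr mixed_form_degree.

End Mixed.

Arguments sm_mixed {k d A B MA MB} Phi x y w e.

(* Main.v *)
Require Import Defs.
From HB Require Import structures.
From mathcomp Require Import all_boot all_order all_algebra.
From mathcomp Require Import boolp zify ring.
From Stdlib Require Import Btauto.

Import Defs.

Set Implicit Arguments.
Unset Strict Implicit.
Unset Printing Implicit Defensive.

Import GRing.Theory.
Local Open Scope ring_scope.

(** Everything is reduced to the identity morphism, that is to the structure
    [j_map M] on [A + A^*[d-1]]. The letterwise maps [to_AA] and [to_BB], from
    [A + B^*[d-1]] to [A + A^*[d-1]] and to [B + B^*[d-1]], commute with the
    operations ([to_AA_sm], [to_BB_sm]): a strict morphism carries the discs of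
    [A] to those of [B], so that pairing a disc of [A] with functionals pulled
    back from [B] is pairing its image with those functionals. The [A]-component of the relation can
    therefore be read in [A + A^*[d-1]], its [B^*]-component in [B + B^*[d-1]],
    and the form [Gamma^Phi] is the pull-back along [to_BB] of the natural form
    of [B + B^*[d-1]].

    For [j_map M], a word is expanded into words
    [p = (sa^n, tf^(n-1), ..., tf^1, sa^1)], and a value of the operation is,
    up to sign, a disc with its outputs paired with the [f^i]. Such a pairing
    vanishes unless the degrees of the outputs are opposite to those of the
    functionals, so all the Koszul signs become functions of the degrees of the
    [sa^i] and [tf^i]; only their parity matters, and each comparison of signs
    is an identity between Boolean polynomials.

    Cyclicity ([j_map_cyclic]). Pairing the value at [(w, q)] with [p], or the
    one at [(p, w)] with [q], gives twice the same disc with all its outputs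
    paired with the same functionals, up to a rotation of the disc, which is
    harmless by cyclic invariance ([full_pairing_rot]). There are four cases,
    according to whether [p] and [q] are elements or functionals
    ([exchange_aa], [exchange_af], [exchange_fa], [exchange_ff]).

    The [A]-valued part of the relation ([Ainf_sum_val]). The composites
    correspond to the decompositions [p = p1 p2 p3] with [p2] nonempty. The two
    cuts are the ends of a chord of the disc of type [(sa^1, ..., sa^n)], and
    [chord_picks] identifies the chords so obtained with the two-disc diagrams
    of this type. The composites at [p2] are the pairings of those diagrams
    with the [f^i] ([inner_term], [left_term], [right_term]), up to a sign
    [chord_exp] that depends on [p] only. Their sum is thus the pairing of
    [M o_nec M = 0].

    The [A^*]-valued part of the relation. Paired with one more letter, the
    relation inherits the cyclicity of the operation ([Ainf_sum_cyclic]). A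
    functional of the word can be rotated to the last place, where it meets the
    [A]-valued part of a relation, which vanishes; and on words without
    functionals the [A^*]-valued part is zero ([psiR_drop], [Ainf_sum_drop]).
    The same rotation shows that the [A^*]-valued part of the operation is
    multilinear. *)

(** * Parities and signs *)

Definition par (n : int) : bool := odd `|n|%N.

Lemma parD m n : par (m + n) = xorb (par m) (par n).
Proof. rewrite /par. case: (boolP (odd `|m|)) (boolP (odd `|n|)) => + [] /=; lia. Qed.

Lemma parN n : par (- n) = par n.
Proof. by rewrite /par abszN. Qed.

Lemma parM m n : par (m * n) = andb (par m) (par n).
Proof. by rewrite /par abszM oddM. Qed.

Lemma par0 : par 0 = false. Proof. by []. Qed.
Lemma par1 : par 1 = true. Proof. by []. Qed.
Lemma par2 : par 2 = false. Proof. by []. Qed.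

Definition parE := (parD, parN, parM, par0, par1, par2).

Lemma sgn_parE (k : fieldType) n : sgn n = (-1) ^+ par n :> k.
Proof.
rewrite /par signr_odd /sgn; case: n => n //.
by rewrite NegzE abszN /= -exprz_inv invrN invr1.
Qed.

Lemma sgn_par (k : fieldType) m n : par m = par n -> sgn m = sgn n :> k.
Proof. by rewrite !sgn_parE => ->. Qed.

Lemma sgnD (k : fieldType) m n : sgn (m + n) = sgn m * sgn n :> k.
Proof.
rewrite !sgn_parE parD.
by case: (par m); case: (par n); rewrite ?mulr1 ?mul1r // mulrNN mulr1.
Qed.

Lemma sgn0 (k : fieldType) : sgn 0 = 1 :> k. Proof. by []. Qed.

Lemma sgnK (k : fieldType) n : sgn n * sgn n = 1 :> k.
Proof. by rewrite !sgn_parE -signr_addb addbb. Qed.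

(** An identity between signs whose exponents are integral polynomials in the
    degrees is a tautology about the parities of those degrees. *)
Ltac signs :=
  rewrite -?sgnD; apply: sgn_par;
  rewrite /koszul ?big_cons ?big_nil /= ?parE; btauto.

(** * Linear maps, words and tensors *)

Section LinearMaps.
Variables (k : fieldType) (V W : lmodType k).

Lemma linear_comb (h : V -> W) (I : Type) (s : seq I) (c : I -> k) F :
  linear h -> h (\sum_(i <- s) c i *: F i) = \sum_(i <- s) c i *: h (F i).
Proof.
move=> hL; elim: s => [|i s IH]; last by rewrite !big_cons hL IH.
by rewrite !big_nil; have := hL (- 1) 0 0; rewrite scaler0 addr0 scaleN1r addNr.
Qed.

Lemma lin0 (h : V -> W) : linear h -> h 0 = 0.
Proof.
by move=> hL; have := @linear_comb h unit [::] (fun=> 0) (fun=> 0) hL; rewrite !big_nil.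
Qed.

Lemma linD (h : V -> W) u v : linear h -> h (u + v) = h u + h v.
Proof. by move=> hL; rewrite -{1}(scale1r u) hL scale1r. Qed.

Lemma linZ (h : V -> W) c v : linear h -> h (c *: v) = c *: h v.
Proof. by move=> hL; rewrite -{1}(addr0 (c *: v)) hL lin0 // addr0. Qed.

Lemma linS (h : V -> W) (I : Type) (s : seq I) (P : pred I) F :
  linear h -> h (\sum_(i <- s | P i) F i) = \sum_(i <- s | P i) h (F i).
Proof.
by move=> hL; apply: (big_morph h) => [u v|]; rewrite ?linD ?lin0.
Qed.

End LinearMaps.

Section WordLemmas.
Variables (k : fieldType) (A : quiver k).

Lemma wcatA x y z t (u : @word k A x y) (v : word y z) (w : word z t) :
  wcat u (wcat v w) = wcat (wcat u v) w.
Proof. by elim: u v => //= {}x {}y z' a u IH v; rewrite IH. Qed.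

Lemma wcat_nil x y (u : @word k A x y) : wcat u (wnil y) = u.
Proof. by elim: u => //= {}x {}y z' a u IH; rewrite IH. Qed.

Lemma wdeg_cat x y z (u : @word k A x y) (v : word y z) :
  wdeg (wcat u v) = wdeg u + wdeg v.
Proof. by elim: u v => //= [*|{}x {}y z' a u IH v]; rewrite ?add0r // IH addrA. Qed.

Lemma wempty_cat_cons x y z t (u : @word k A x y) (a : letter y z) (v : word z t) :
  wempty (wcat u (wcons a v)) = false.
Proof. by case: u a v. Qed.

End WordLemmas.

Section WordSplits.
Variables (k : fieldType) (Q : quiver k).

(** Lets a summand mention the word that is cut, although the sum runs over
    its pieces only; used to move degrees between a word and its pieces. *)
Lemma wsplits_sum (V : zmodType) x z (w : @word k Q x z) :
  forall h : word x z -> {y : obj Q & word x y * word y z}%type -> V,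
  \sum_(s <- wsplits w) h (wcat (projT2 s).1 (projT2 s).2) s =
  \sum_(s <- wsplits w) h w s.
Proof.
elim: w => {x z} [x|x u z a w IH] h; rewrite /= ?big_seq1 // !big_cons /=.
rewrite !big_map; congr (_ + _).
exact: (IH (fun w s => h (wcons a w) (existT _ (projT1 s)
    (wcons a (projT2 s).1, (projT2 s).2)))).
Qed.

Lemma wsplits_snoc (V : zmodType) x y z (w : @word k Q x y) (q : letter y z)
    (h : forall u, word x u -> word u z -> V) :
  \sum_(s <- wsplits (wcat w (wcons q (wnil z)))) h _ (projT2 s).1 (projT2 s).2 =
  \sum_(s <- wsplits w) h _ (projT2 s).1 (wcat (projT2 s).2 (wcons q (wnil z))) +
  h _ (wcat w (wcons q (wnil z))) (wnil z).
Proof.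
elim: w z q h => {x y} [x|x u y a w IH] z q h /=.
  by rewrite !big_cons !big_nil /= !addr0.
rewrite !big_cons !big_map /= -addrA; congr (_ + _).
exact: (IH _ q (fun v s1 s2 => h v (wcons a s1) s2)).
Qed.

End WordSplits.

Section MapWord.
Variables (k : fieldType) (Q R : quiver k) (f : obj Q -> obj R).
Variable phi : forall x y i, Q x y i -> R (f x) (f y) i.

Lemma map_word_cat x y z (u : @word k Q x y) (v : word y z) :
  map_word phi (wcat u v) = wcat (map_word phi u) (map_word phi v).
Proof. by elim: u v => //= {}x {}y z' a u IH v; rewrite IH. Qed.

Lemma wdeg_map x y (w : @word k Q x y) : wdeg (map_word phi w) = wdeg w.
Proof. by elim: w => //= {}x {}y z a w ->. Qed.

Lemma wempty_map x y (w : @word k Q x y) : wempty (map_word phi w) = wempty w.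
Proof. by case: w. Qed.

Lemma wsplits_map x z (w : @word k Q x z) :
  wsplits (map_word phi w) =
  [seq existT _ (f (projT1 s)) (map_word phi (projT2 s).1, map_word phi (projT2 s).2)
     | s <- wsplits w].
Proof.
elim: w => {x z} //= x u z a w ->; congr cons; rewrite -!map_comp.
by apply: eq_map => s.
Qed.

End MapWord.

Section TensorLemmas.
Variables (k : fieldType) (A : quiver k) (d : int).
Implicit Types (W : lmodType k) (o : seq (arrow A)).

Lemma tlift_map W W' (h : W -> W') (g : seq (arrow A) -> W) t :
  linear h -> h (tlift g t) = tlift (h \o g) t.
Proof. by move=> hL; rewrite /tlift /feval linear_comb. Qed.

Lemma eq_tlift W (g g' : seq (arrow A) -> W) t : g =1 g' -> tlift g t = tlift g' t.
Proof. by move=> gg'; apply: eq_bigr => c _; rewrite gg'. Qed.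

Lemma tliftZ W (g : seq (arrow A) -> W) c t :
  tlift (fun o => c *: g o) t = c *: tlift g t.
Proof.
by rewrite /tlift /feval scaler_sumr; apply: eq_bigr => b _; rewrite !scalerA mulrC.
Qed.

Lemma tlift0 W (t : tensor A) : tlift (fun=> 0 : W) t = 0.
Proof. by rewrite /tlift /feval big1 // => b _; rewrite scaler0. Qed.

Lemma tliftD W (g g' : seq (arrow A) -> W) t :
  tlift (fun o => g o + g' o) t = tlift g t + tlift g' t.
Proof. by rewrite /tlift /feval -big_split; apply: eq_bigr => b _; rewrite scalerDr. Qed.

(** Two multilinear maps can be compared on a tensor by evaluating them only on
    the pure tensors that may occur in it. *)
Lemma tlift_span W (P : seq (arrow A) -> Prop) (g g' : seq (arrow A) -> W) t :
  multilinear g -> multilinear g' -> tspan P t ->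
  (forall o, P o -> g o = g' o) -> tlift g t = tlift g' t.
Proof.
move=> gL g'L [s [sP ->]] gg'.
rewrite !linear_comb; try exact: tlift_linear.
rewrite big_seq [RHS]big_seq; apply: eq_bigr => c cs.
by rewrite !tlift_pure // gg' //; apply: sP.
Qed.

Definition degs o : seq int := map (out_deg d) o.

Lemma outs_degE o : outs_deg d o = \sum_(i <- degs o) i.
Proof. by rewrite /outs_deg /degs big_map. Qed.

Lemma degs_letter l x y i (a b : A x y i) r :
  degs (l ++ mk_arrow (hl a) :: r) = degs (l ++ mk_arrow (hl b) :: r).
Proof. by rewrite /degs !map_cat. Qed.

(** A sign depending on the degrees of the factors does not break
    multilinearity, since the degrees are fixed when one factor varies in its
    homogeneous component. *)
Lemma multilinear_sgn W (c : seq int -> int) (g : seq (arrow A) -> W) :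
  multilinear g -> multilinear (fun o => sgn (c (degs o)) *: g o).
Proof.
move=> gL l x y i r e a b; rewrite gL scalerDr !scalerA [sgn _ * e]mulrC.
by rewrite !(degs_letter l _ 0).
Qed.

Lemma multilinear_comp W W' (h : W -> W') (g : seq (arrow A) -> W) :
  linear h -> multilinear g -> multilinear (h \o g).
Proof. by move=> hL gL l x y i r c a b /=; rewrite gL hL. Qed.

Lemma outs_deg_cat o o' : outs_deg d (o ++ o') = outs_deg d o + outs_deg d o'.
Proof. by rewrite /outs_deg big_cat. Qed.

Lemma tlift_shift_last W (h : seq (arrow A) -> W) t : multilinear h ->
  tlift h (shift_last d t) =
  tlift (fun o => sgn ((d + 1) * outs_deg d (take (size o).-1 o)) *: h o) t.
Proof.
move=> hL; rewrite tlift_map; last exact: tlift_linear.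
apply: eq_tlift => o /=; rewrite linZ ?tlift_pure //; exact: tlift_linear.
Qed.

End TensorLemmas.

(** * Sums over pairs of degrees *)

Section ListSums.
Implicit Types s t : seq int.

Definition isum s : int := \sum_(x <- s) x.

(** The sum of the [t_i * s_j] over [i < j], as a recursive function, so that
    it can be computed on concatenations. *)
Fixpoint upper_sum t s : int :=
  match t, s with
  | x :: t', _ :: s' => x * isum s' + upper_sum t' s'
  | _, _ => 0
  end.

Lemma isum_cons x s : isum (x :: s) = x + isum s.
Proof. by rewrite /isum big_cons. Qed.
Lemma isum_nil : isum [::] = 0.
Proof. by rewrite /isum big_nil. Qed.
Lemma isum_cat s t : isum (s ++ t) = isum s + isum t.
Proof. by rewrite /isum big_cat. Qed.
Lemma isum_rcons s x : isum (rcons s x) = isum s + x.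
Proof. by rewrite -cats1 isum_cat isum_cons isum_nil addr0. Qed.
Lemma isum_opp s : isum (map -%R s) = - isum s.
Proof. by rewrite /isum big_map sumrN. Qed.

Lemma isum_nth s : \sum_(i < size s) s`_i = isum s.
Proof. by rewrite /isum (big_nth 0) big_mkord. Qed.

Lemma upper_sumE t s :
  \sum_(i < size t) \sum_(j < size s | (i < j)%N) t`_i * s`_j = upper_sum t s.
Proof.
elim: t s => [|x t IH] [|y s] /=; rewrite ?big_ord0 //.
  by rewrite big1 // => i _; rewrite big_ord0.
rewrite big_ord_recl; congr (_ + _).
  rewrite big_mkcond big_ord_recl /= add0r -mulr_sumr -isum_nth.
  by congr (_ * _); apply: eq_bigr => j _.
rewrite -IH; apply: eq_bigr => i _.
rewrite big_mkcond big_ord_recl /= add0r [RHS]big_mkcond.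
by apply: eq_bigr => j _.
Qed.

Lemma koszul_appE (g o : seq int) : size o = size g -> koszul_app g o = upper_sum o g.
Proof.
move=> so; rewrite /koszul_app -upper_sumE.
rewrite (eq_bigr (fun i : 'I_(size g) => \sum_(j < size g)
  if (j < i)%N then g`_i * o`_j else 0)); last by move=> i _; rewrite big_mkcond.
rewrite exchange_big so; apply: eq_bigr => i _.
by rewrite [RHS]big_mkcond; apply: eq_bigr => j _; rewrite mulrC.
Qed.

Lemma upper_sum_cat t t' s s' : size t = size s ->
  upper_sum (t ++ t') (s ++ s') = upper_sum t s + isum t * isum s' + upper_sum t' s'.
Proof.
elim: t s => [|x t IH] [|y s] //=; first by rewrite isum_nil mul0r !add0r.
by case=> /IH ->; rewrite isum_cat isum_cons; ring.
Qed.

Lemma upper_sum_head t x s : upper_sum t (x :: s) = upper_sum t (0 :: s).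
Proof. by case: t. Qed.

Lemma upper_sum_oppl t s : upper_sum (map -%R t) s = - upper_sum t s.
Proof. by elim: t s => [|x t IH] [|y s] //=; rewrite ?oppr0 // IH mulNr opprD. Qed.
End ListSums.

(** * Pairing outputs with functionals *)

Section Pairing.
Variables (k : fieldType) (A : quiver k) (d : int).
Implicit Types (fs : seq (arrow (dual_quiver A))) (o : seq (arrow A)).

Lemma arrow_compK x y i (a : A x y i) : arrow_comp x y i (mk_arrow (hl a)) = a.
Proof.
by rewrite /arrow_comp !(untagE _ _ (erefl : tag (mk_arrow _) = (x, y))) /=
  !(untagE _ _ (erefl : tag (hl _) = i)).
Qed.

Lemma arrow_comp_obj x y e (b : arrow A) : tag b <> (x, y) -> arrow_comp x y e b = 0.
Proof. by move=> /eqP ne; rewrite /arrow_comp untag_dflt. Qed.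

Lemma arrow_comp_deg x y e u v i (a : A u v i) : i <> e ->
  arrow_comp x y e (mk_arrow (hl a)) = 0.
Proof.
move=> /eqP ie; have [uv|/eqP uv] := eqVneq (u, v) (x, y); last exact: arrow_comp_obj.
case: uv a => -> -> a; rewrite /arrow_comp.
by rewrite !(untagE _ _ (erefl : tag (mk_arrow _) = (x, y))) /= untag_dflt.
Qed.

Lemma arrow_of_obj x y (b : arrow A) :
  tag b = (x, y) -> exists i (a : A x y i), b = mk_arrow (hl a).
Proof.
case: b => [[u v] [i a]] /= uv; case: uv a => -> -> a; by exists i, a.
Qed.

Lemma arrow_comp_supp x y e (b : arrow A) :
  arrow_comp x y e b <> 0 -> tag b = (x, y) /\ tag (tagged b) = e.
Proof.
move=> nz; split.
  by apply/eqP/negPn/negP => /eqP ne; apply: nz; exact: arrow_comp_obj.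
case: b nz => [[u v] [i a]] nz /=.
by apply/eqP/negPn/negP => /eqP ne; apply: nz; exact: arrow_comp_deg.
Qed.

Lemma dapp_deg f (b : arrow A) : dapp f b <> 0 -> out_deg d b = - tdeg d f.
Proof.
move=> nz; have /arrow_comp_supp [_ e] :
    @arrow_comp k A (tag f).2 (tag f).1 (- tag (tagged f)) b <> 0.
  by move=> z; apply: nz; rewrite /dapp z /dual_fun linear0.
by rewrite /out_deg e /tdeg opprB addrC.
Qed.

Lemma dapps_size fs o : size o <> size fs -> dapps fs o = 0.
Proof.
elim: fs o => [|f fs IH] [|b o] //= ne; rewrite IH ?mulr0 // => e.
by apply: ne; rewrite e.
Qed.

(** What turns Koszul signs into constants: a nonzero pairing determines the
    degrees of the outputs. *)
Lemma dapps_degs fs o : dapps fs o <> 0 -> degs d o = map (fun f => - tdeg d f) fs.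
Proof.
elim: fs o => [|f fs IH] [|b o] //= nz.
by rewrite (@dapp_deg f b) ?(IH o) // => z; apply: nz; rewrite z ?mulr0 ?mul0r.
Qed.

Lemma dapps_outs fs o : dapps fs o <> 0 -> outs_deg d o = - isum (map (tdeg d) fs).
Proof.
by move=> /dapps_degs; rewrite outs_degE => ->; rewrite -isum_opp /isum !big_map.
Qed.

Lemma dapps_cat fs fs' o o' : size o = size fs ->
  dapps (fs ++ fs') (o ++ o') = dapps fs o * dapps fs' o'.
Proof.
elim: fs o => [|f fs IH] [|b o] //=; first by rewrite mul1r.
by case=> /IH ->; rewrite mulrA.
Qed.

Lemma dapps_rcons fs f o b : dapps (rcons fs f) (rcons o b) = dapps fs o * dapp f b.
Proof.
have [so|/eqP so] := eqVneq (size o) (size fs).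
  by rewrite -!cats1 dapps_cat //= mulr1.
by rewrite !dapps_size ?mul0r ?size_rcons // => -[].
Qed.

Lemma dapps_multilinear fs : multilinear (dapps fs : seq (arrow A) -> k^o).
Proof. by move=> l x y i r; exact: dapps_linear. Qed.

(** With [P] a projection this is a value of the operation; with [P] the
    effect of feeding the last output to another disc, it is a composite. *)
Fixpoint pair_with (W : lmodType k) fs (P : arrow A -> W) o : W :=
  match fs, o with
  | [::], [:: b] => P b
  | f :: fs', b :: o' => (dapp f b : k) *: pair_with fs' P o'
  | _, _ => 0
  end.

Definition pair_last fs x y e : seq (arrow A) -> A x y e :=
  pair_with fs (arrow_comp x y e).

Section Generic.
Variables (W : lmodType k) (P : arrow A -> W).

Lemma pair_with_size fs o : size o <> (size fs).+1 -> pair_with fs P o = 0.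
Proof.
elim: fs o => [|f fs IH] [|b o] //=; first by case: o.
by move=> ne; rewrite IH ?scaler0 // => e; apply: ne; rewrite e.
Qed.

Lemma pair_with_cat fs fs' o o' : size o = size fs ->
  pair_with (fs ++ fs') P (o ++ o') = (dapps fs o : k) *: pair_with fs' P o'.
Proof.
elim: fs o => [|f fs IH] [|b o] //=; first by rewrite scale1r.
by case=> /IH ->; rewrite scalerA.
Qed.

Lemma pair_with_last fs o b : pair_with fs P (rcons o b) = (dapps fs o : k) *: P b.
Proof.
have [so|/eqP so] := eqVneq (size o) (size fs).
  by rewrite -cats1 -[fs]cats0 pair_with_cat ?cats0.
by rewrite dapps_size // scale0r pair_with_size // size_rcons => -[].
Qed.

Lemma pair_with_multilinear fs :
  (forall x y i, linear (fun a : A x y i => P (mk_arrow (hl a)))) ->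
  multilinear (pair_with fs P).
Proof.
move=> PL; elim: fs => [|f fs IH] [|b l] x y i r c a a' /=;
  rewrite ?scaler0 ?addr0 //.
- by case: r => [|? ?]; rewrite ?PL ?scaler0 ?addr0.
- by case: l => [|? ?]; rewrite ?scaler0 ?addr0.
- by rewrite dapp_linear scalerDl scalerA.
by rewrite IH scalerDr !scalerA mulrC.
Qed.

Lemma pair_with_supp fs o : pair_with fs P o <> 0 ->
  exists o' b, [/\ o = rcons o' b, size o' = size fs, dapps fs o' <> 0 & P b <> 0].
Proof.
move=> nz; case/lastP: o nz => [|o b] nz; first by case: fs nz.
exists o, b; move: nz; rewrite pair_with_last => nz; split=> //.
- by apply/eqP/negPn/negP => /eqP /dapps_size z; apply: nz; rewrite z scale0r.
- by move=> z; apply: nz; rewrite z scale0r.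
by move=> z; apply: nz; rewrite z scaler0.
Qed.

End Generic.

Lemma pair_last_multilinear fs x y e : multilinear (pair_last fs x y e).
Proof. by apply: pair_with_multilinear => u v i; exact: arrow_comp_linear. Qed.

(** When the last output of a disc is fed to another one, its remaining
    outputs [o] are inserted among the outputs [q] of the latter. *)
Lemma pair_last_insert f3 f2 f1 x y e q o : size o = size f2 ->
  pair_last (f3 ++ f2 ++ f1) x y e (take (size f3) q ++ o ++ drop (size f3) q) =
  (dapps f2 o : k) *: pair_last (f3 ++ f1) x y e q.
Proof.
move=> so; have [sq|sq] := leqP (size f3) (size q).
  rewrite /pair_last -{3}(cat_take_drop (size f3) q).
  by rewrite !pair_with_cat ?size_takel // !scalerA mulrC.
rewrite take_oversize ?drop_oversize 1?ltnW // /pair_last.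
rewrite [X in _ = _ *: X]pair_with_size ?size_cat; last by lia.
by rewrite scaler0 pair_with_size // !size_cat /=; lia.
Qed.

End Pairing.

(** * Words cut into blocks by functionals *)

Section BlockWords.
Variables (k : fieldType) (A : quiver k).
Local Notation pword := (@pword k A).
Local Notation word := (@word k A).
Local Notation flip := (fun f : arrow (dual_quiver A) => ((tag f).2, (tag f).1)).

Definition pcons_word x y z (w : word x y) (p : pword y z) : pword x z :=
  match p in Defs.pword y z return word x y -> pword x z with
  | pblock _ _ w' => fun w => pblock (wcat w w')
  | pcons _ _ _ _ w' f p' => fun w => pcons (wcat w w') f p'
  end w.

Fixpoint pcat x y z (p : pword x y) : pword y z -> pword x z :=
  match p in Defs.pword x y return pword y z -> pword x z with
  | pblock _ _ w => fun q => pcons_word w q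
  | pcons _ _ _ _ w f p' => fun q => pcons w f (pcat p' q)
  end.

(** [sa^n], and the list [sa^1, ..., sa^(n-1)]. *)
Definition plast x y (p : pword x y) : {v : obj A & word x v} :=
  match p in Defs.pword x y return {v : obj A & word x v} with
  | pblock _ y w => existT _ y w
  | pcons _ u _ _ w _ _ => existT _ u w
  end.

Definition pinit x y (p : pword x y) : seq (sector A) :=
  if p is pcons _ _ _ _ _ _ p' then psectors p' else [::].

Definition pempty x y (p : pword x y) : bool :=
  if p is pblock _ _ w then wempty w else false.

Fixpoint psplits x z (p : pword x z) : seq {y : obj A & pword x y * pword y z}%type :=
  match p in Defs.pword x z return seq {y : obj A & pword x y * pword y z}%type with
  | pblock _ _ w =>
      [seq existT _ (projT1 s) (pblock (projT2 s).1, pblock (projT2 s).2)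
         | s <- wsplits w]
  | pcons _ _ _ _ w f p' =>
      [seq existT _ (projT1 s) (pblock (projT2 s).1, pcons (projT2 s).2 f p')
         | s <- wsplits w] ++
      [seq existT _ (projT1 s) (pcons w f (projT2 s).1, (projT2 s).2)
         | s <- psplits p']
  end.

Lemma psectors_pcons x u v y (w : word x u) (f : @letter k (dual_quiver A) u v) (p : pword v y) :
  psectors (pcons w f p) = rcons (psectors p) (Sector w).
Proof. by []. Qed.

Lemma psectors_last x y (p : pword x y) :
  psectors p = rcons (pinit p) (Sector (projT2 (plast p))).
Proof. by case: p. Qed.

Lemma size_prest x y (p : pword x y) : size (prest p) = size (pfuns p).
Proof. by elim: p => //= *; rewrite !size_rcons; congr _.+1. Qed.

Lemma size_pinit x y (p : pword x y) : size (pinit p) = size (pfuns p).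
Proof. by case: p => //= *; rewrite !size_rcons size_prest. Qed.

Lemma psectors_cat x y z (p : pword x y) (q : pword y z) :
  psectors (pcat p q) = pinit q ++
    Sector (wcat (projT2 (pfirst p)) (projT2 (plast q))) :: prest p.
Proof.
elim: p z q => {x y} [x y w|x u v y w f p IH] z q /=.
  by case: q w => //= a b c e w f q w'; rewrite /psectors /= -rcons_cons cats1.
by rewrite psectors_pcons IH rcons_cat rcons_cons.
Qed.

Lemma pfuns_cat x y z (p : pword x y) (q : pword y z) :
  pfuns (pcat p q) = pfuns q ++ pfuns p.
Proof.
elim: p z q => {x y} [x y w|x u v y w f p IH] z q /=.
  by case: q w => //= *; rewrite cats0.
by rewrite IH rcons_cat.
Qed.

Lemma plast_letter x y z (a : letter x y) (p : pword y z) :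
  plast (pcons_letter a p) = existT _ (projT1 (plast p)) (wcons a (projT2 (plast p))).
Proof. by case: p a. Qed.

Lemma pinit_letter x y z (a : letter x y) (p : pword y z) :
  pinit (pcons_letter a p) = pinit p.
Proof. by case: p a. Qed.

Lemma plast_word x y z (w : word x y) (p : pword y z) :
  plast (pcons_word w p) = existT _ (projT1 (plast p)) (wcat w (projT2 (plast p))).
Proof. by case: p w. Qed.

Lemma pinit_word x y z (w : word x y) (p : pword y z) :
  pinit (pcons_word w p) = pinit p.
Proof. by case: p w. Qed.

Lemma pfuns_letter x y z (a : letter x y) (p : pword y z) :
  pfuns (pcons_letter a p) = pfuns p.
Proof. by case: p a. Qed.

Lemma psectors_plug x u v y (p1 : pword x u) (a : letter u v) (p3 : pword v y) :
  psectors (pcat p1 (pcons_letter a p3)) = pinit p3 ++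
    Sector (wcat (projT2 (pfirst p1)) (wcons a (projT2 (plast p3)))) :: prest p1.
Proof. by rewrite psectors_cat pinit_letter plast_letter. Qed.

Lemma objs_psectors x y (p : pword x y) :
  map (@slt k A) (psectors p) =
    rcons (map (fun f : arrow (dual_quiver A) => (tag f).2) (pfuns p)) x /\
  map (@srt k A) (prest p) =
    map (fun f : arrow (dual_quiver A) => (tag f).1) (pfuns p).
Proof.
elim: p => {x y} [x y w|x u v y w f p [Hl Hr]] //.
by rewrite psectors_pcons [prest _]/= [pfuns _]/= !map_rcons Hl Hr.
Qed.

(** The functional [f^i] can be paired with the [i]-th output, and the last
    output lies where the value of the operation should be. *)
Lemma out_objs_psectors x y (p : pword x y) :
  out_objs (psectors p) = rcons (map flip (pfuns p)) (x, y).
Proof.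
have [Hl Hr] := objs_psectors p.
rewrite /out_objs Hl /= Hr rot1_cons.
by elim: (pfuns p) => //= f fs ->.
Qed.

(** In the disc of type [(sa^1 b sa^n, sa^2, ..., sa^(n-1))] that defines the
    dual-valued part, all the outputs can be paired with the functionals. *)
Lemma out_objs_closed x u v y (san : word x u) (f : @letter k (dual_quiver A) u v) (p : pword v y)
    (b : letter y x) :
  out_objs (Sector (wcat (projT2 (pfirst p)) (wcons b san)) :: prest p) =
  map flip (rcons (pfuns p) (mk_arrow f)).
Proof.
have [] := objs_psectors p; rewrite /psectors /= => Hl Hr.
rewrite /out_objs /= rot1_cons Hl Hr map_rcons.
by elim: (pfuns p) => //= g fs ->.
Qed.

End BlockWords.

(** * Cuts of words and chords of discs *)

Section Splits.
Variables (k : fieldType) (A : quiver k) (d : int) (V : zmodType).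
Local Notation pword := (@pword k A).
Local Notation word := (@word k A).
Local Notation AA := (mixed_quiver d (A := A) (B := A) id).

Definition pdeg x y (p : pword x y) : int :=
  sectors_deg (psectors p) + isum (map (tdeg d) (pfuns p)).

Lemma sectors_degE (zs : seq (sector A)) :
  sectors_deg zs = isum (map (@sector_deg k A) zs).
Proof. by rewrite /isum big_map. Qed.

Lemma sectors_deg_cat (zs zs' : seq (sector A)) :
  sectors_deg (zs ++ zs') = sectors_deg zs + sectors_deg zs'.
Proof. by rewrite /sectors_deg big_cat. Qed.

Lemma sectors_deg_cons (z : sector A) zs :
  sectors_deg (z :: zs) = sector_deg z + sectors_deg zs.
Proof. by rewrite /sectors_deg big_cons. Qed.

Lemma sectors_deg_rcons (z : sector A) zs :
  sectors_deg (rcons zs z) = sectors_deg zs + sector_deg z.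
Proof. by rewrite -cats1 sectors_deg_cat sectors_deg_cons /sectors_deg big_nil addr0. Qed.

Lemma pdeg_letter x y z (a : @letter k A x y) (p : pword y z) :
  pdeg (pcons_letter a p) = sdeg a + pdeg p.
Proof.
rewrite /pdeg pfuns_letter !psectors_last pinit_letter plast_letter.
by rewrite !sectors_deg_rcons /sector_deg /=; ring.
Qed.

Lemma pempty_letter x y z (a : @letter k A x y) (p : pword y z) :
  pempty (pcons_letter a p) = false.
Proof. by case: p a. Qed.

Lemma pdeg_pcons x u v y (w : word x u) (f : @letter k (dual_quiver A) u v)
    (p : pword v y) :
  pdeg (pcons w f p) = wdeg w + tdeg d (mk_arrow f) + pdeg p.
Proof.
rewrite /pdeg psectors_pcons sectors_deg_rcons /= map_rcons isum_rcons.
by rewrite /sector_deg /=; ring.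
Qed.

Lemma psplits_sum x z (p : pword x z) (h : pword x z ->
    {y : obj A & pword x y * pword y z}%type -> V) :
  \sum_(s <- psplits p) h (pcat (projT2 s).1 (projT2 s).2) s =
  \sum_(s <- psplits p) h p s.
Proof.
elim: p h => {x z} [x y w|x u v y w f p IH] h /=.
  rewrite !big_map /=; exact: (wsplits_sum w (fun w s => h (pblock w)
    (existT _ (projT1 s) (pblock (projT2 s).1, pblock (projT2 s).2)))).
rewrite !big_cat !big_map /=; congr (_ + _).
  exact: (wsplits_sum w (fun w s => h (pcons w f p)
    (existT _ (projT1 s) (pblock (projT2 s).1, pcons (projT2 s).2 f p)))).
exact: (IH (fun p s => h (pcons w f p)
    (existT _ (projT1 s) (pcons w f (projT2 s).1, (projT2 s).2)))).
Qed.

Lemma psplits_letter x y z (a : @letter k A x y) (p : pword y z) :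
  psplits (pcons_letter a p) =
  existT _ x (pblock (wnil x), pcons_letter a p) ::
  [seq existT _ (projT1 s) (pcons_letter a (projT2 s).1, (projT2 s).2)
     | s <- psplits p].
Proof.
case: p a => [{}y {}z w|{}y u v {}z w f p] a /=; rewrite -?map_comp //.
by rewrite map_cat -!map_comp.
Qed.

Lemma expand_cons x y z (q : @letter k AA x y) (w : @Defs.word k AA y z)
    (h : pword x z -> V) :
  \sum_(p <- expand (wcons q w)) h p =
  \sum_(p <- expand w)
    (h (pcons_letter (@hl k A x y (tag q) (tagged q).1) p) +
     h (@pcons k A x x y z (@wnil k A x)
         (@hl k (dual_quiver A) x y (d - 1 + tag q) (tagged q).2) p)).
Proof. by rewrite /= big_cat !big_map big_split. Qed.

Lemma pcat_letter x y z t (a : @letter k A x y) (p : pword y z) (q : pword z t) :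
  pcat (pcons_letter a p) q = pcons_letter a (pcat p q).
Proof. by case: p a q => [{}y {}z w|{}y u v {}z w f p] a q //=; case: q a w. Qed.

Lemma expand_cat x y z (w1 : @Defs.word k AA x y) (w2 : @Defs.word k AA y z)
    (h : pword x z -> V) :
  \sum_(p <- expand (wcat w1 w2)) h p =
  \sum_(p1 <- expand w1) \sum_(p2 <- expand w2) h (pcat p1 p2).
Proof.
elim: w1 z w2 h => {x y} [x|x y z' q w1 IH] z w2 h.
  by rewrite /= big_seq1; apply: eq_bigr => p _; case: p h.
rewrite [wcat _ _]/= !expand_cons IH; apply: eq_bigr => p1 _.
by rewrite -big_split; apply: eq_bigr => p2 _; rewrite pcat_letter.
Qed.

(** The degree and emptiness of a word are those of each term of its expansion,
    so that signs and side conditions can be moved under the sum. *)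
Lemma expand_inv x y (w : @Defs.word k AA x y) (h : int -> bool -> pword x y -> V) :
  \sum_(p <- expand w) h (wdeg w) (wempty w) p =
  \sum_(p <- expand w) h (pdeg p) (pempty p) p.
Proof.
elim: w h => {x y} [x|x y z q w IH] h.
  rewrite /= !big_seq1 /= /pdeg /psectors /= isum_nil addr0.
  by rewrite sectors_deg_cons /sectors_deg big_nil.
rewrite !expand_cons !big_split; congr (_ + _).
  rewrite (IH (fun n b p => h (sdeg q + n) false (pcons_letter _ p))).
  by apply: eq_bigr => p _; rewrite pdeg_letter pempty_letter.
rewrite (IH (fun n b p => h (sdeg q + n) false (pcons _ _ p))).
apply: eq_bigr => p _; rewrite pdeg_pcons /= add0r.
by congr (h _ _ _); congr (_ + _); rewrite /sdeg /tdeg /=; ring.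
Qed.

(** Cutting a word and expanding the pieces, or expanding it and cutting each
    term. *)
Lemma expand_splits x z (w : @Defs.word k AA x z)
    (h : {y : obj A & pword x y * pword y z}%type -> V) :
  \sum_(s <- wsplits w) \sum_(p1 <- expand (projT2 s).1)
    \sum_(p2 <- expand (projT2 s).2) h (existT _ (projT1 s) (p1, p2)) =
  \sum_(p <- expand w) \sum_(s <- psplits p) h s.
Proof.
elim: w h => {x z} [x|x y z q w IH] h.
  by rewrite /= !big_seq1.
transitivity (\sum_(p2 <- expand (wcons q w)) h (existT _ x (pblock (@wnil k A x), p2)) +
  \sum_(s <- wsplits w) \sum_(p1 <- expand (wcons q (projT2 s).1))
    \sum_(p2 <- expand (projT2 s).2) h (existT _ (projT1 s) (p1, p2))).
  rewrite [wsplits _]/= big_cons big_map; congr (_ + _).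
  by rewrite [expand (wnil x)]/= big_seq1.
rewrite !expand_cons.
under [in RHS]eq_bigr => p _.
  rewrite !psplits_letter /= !big_cons !big_map /=.
  over.
under [in RHS]eq_bigr => p _ do rewrite addrACA.
rewrite [RHS]big_split; congr (_ + _).
rewrite [RHS]big_split -!IH -big_split; apply: eq_bigr => s _ /=.
by rewrite big_cat !big_map.
Qed.

Lemma expand_splits3 x z (w : @Defs.word k AA x z)
    (h : forall u v, pword x u -> pword u v -> pword v z -> V) :
  \sum_(s <- wsplits w) \sum_(t <- wsplits (projT2 s).2 | ~~ wempty (projT2 t).1)
    \sum_(p1 <- expand (projT2 s).1) \sum_(p2 <- expand (projT2 t).1)
    \sum_(p3 <- expand (projT2 t).2) h _ _ p1 p2 p3 =
  \sum_(p <- expand w) \sum_(s <- psplits p)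
    \sum_(t <- psplits (projT2 s).2 | ~~ pempty (projT2 t).1)
    h _ _ (projT2 s).1 (projT2 t).1 (projT2 t).2.
Proof.
rewrite -(expand_splits w (fun s => \sum_(t <- psplits (projT2 s).2 | ~~ pempty (projT2 t).1)
    h _ _ (projT2 s).1 (projT2 t).1 (projT2 t).2)).
apply: eq_bigr => s _ /=.
rewrite exchange_big /=; apply: eq_bigr => p1 _.
under [in RHS]eq_bigr => p _ do rewrite big_mkcond.
rewrite -(expand_splits _ (fun t => if ~~ pempty (projT2 t).1 then
    h _ _ p1 (projT2 t).1 (projT2 t).2 else 0)).
rewrite big_mkcond; apply: eq_bigr => t _ /=.
rewrite -(expand_inv (projT2 t).1 (fun n b p => \sum_(p2 <- expand (projT2 t).2)
    if ~~ b then h _ _ p1 p p2 else 0)).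
by case: ifP => // _; rewrite big1 // => p _; rewrite big1.
Qed.

Lemma picks_rcons T (s : seq T) a (h : seq T -> T -> seq T -> V) :
  \sum_(p <- picks (rcons s a)) h p.1.1 p.1.2 p.2 =
  \sum_(p <- picks s) h p.1.1 p.1.2 (rcons p.2 a) + h s a [::].
Proof.
elim: s h => [|b s IH] h /=; first by rewrite big_cons !big_nil addr0 add0r.
rewrite !big_cons !big_map /= -addrA; congr (_ + _).
exact: (IH (fun X b X' => h (_ :: X) b X')).
Qed.

(** A cut of [p] lies in one of its blocks: the blocks on its left have
    greater indices, since a word lists its blocks in decreasing order. *)
Lemma cut_picks x z (p : pword x z)
    (h : seq (sector A) -> forall x u y, word x u -> word u y -> seq (sector A) -> V) :
  \sum_(s <- psplits p) h (pinit (projT2 s).2) _ _ _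
    (projT2 (pfirst (projT2 s).1)) (projT2 (plast (projT2 s).2)) (prest (projT2 s).1) =
  \sum_(q <- picks (psectors p)) \sum_(s <- wsplits (sword q.1.2))
    h q.1.1 _ _ _ (projT2 s).1 (projT2 s).2 q.2.
Proof.
elim: p h => {x z} [x y w|x u v y w f p IH] h; first by rewrite /= !big_map big_seq1.
rewrite psectors_pcons (picks_rcons _ _ (fun X b X' =>
  \sum_(s <- wsplits (sword b)) h X _ _ _ (projT2 s).1 (projT2 s).2 X')) /=.
rewrite big_cat !big_map addrC /=; congr (_ + _).
exact: (IH (fun X a b c L R X' => h X a b c L R (rcons X' (Sector w)))).
Qed.

(** A decomposition [p1 p2 p3] is a chord with its two ends at the cuts: [h1]
    is the term of a chord with both ends in one block, when [p2] contains no
    functional, and [h2] that of a chord between two blocks. *)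
Section ChordTerm.
Variables
  (h1 : seq (sector A) -> forall x u v y, word x u -> word u v -> word v y ->
     seq (sector A) -> V)
  (h2 : seq (sector A) -> forall x1 v y1, word x1 v -> word v y1 ->
     seq (sector A) -> forall x2 u y2, word x2 u -> word u y2 ->
     seq (sector A) -> V).

Definition chord_term x u v y (p1 : pword x u) (p2 : pword u v) (p3 : pword v y) : V :=
  match p2 in Defs.pword u v return pword x u -> pword v y -> V with
  | pblock _ _ w => fun p1 p3 =>
      h1 (pinit p3) (projT2 (pfirst p1)) w (projT2 (plast p3)) (prest p1)
  | pcons _ _ _ _ w _ p2' => fun p1 p3 =>
      h2 (pinit p3) (projT2 (pfirst p2')) (projT2 (plast p3))
         (prest p2') (projT2 (pfirst p1)) w (prest p1)
  end p1 p3.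
End ChordTerm.

Lemma chord_term_pcons h1 h2 x u v y' a b (w : word x u)
    (f : @letter k (dual_quiver A) u v) (p1 : pword v a) (p2 : pword a b)
    (p3 : pword b y') :
  chord_term h1 h2 (pcons w f p1) p2 p3 =
  chord_term (fun X a b c e L Y R X' => h1 X a b c e L Y R (rcons X' (Sector w)))
    (fun X a b c Y1 R Y a' b' c' L Ym X' =>
       h2 X a b c Y1 R Y a' b' c' L Ym (rcons X' (Sector w))) p1 p2 p3.
Proof. by case: p2 p1 p3. Qed.

(** The right-hand side is the shape of [nec]. The induction adds the first
    block of the word, of greatest index, which contains both ends, or one, the
    other one being located by [cut_picks], or none. *)
Lemma chord_picks x z (p : pword x z) h1 h2 :
  \sum_(s <- psplits p) \sum_(t <- psplits (projT2 s).2 | ~~ pempty (projT2 t).1)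
    chord_term h1 h2 (projT2 s).1 (projT2 t).1 (projT2 t).2 =
  \sum_(q <- picks (psectors p))
   (\sum_(s <- wsplits (sword q.1.2))
      \sum_(t <- wsplits (projT2 s).2 | ~~ wempty (projT2 t).1)
        h1 q.1.1 _ _ _ _ (projT2 s).1 (projT2 t).1 (projT2 t).2 q.2
  + \sum_(r <- picks q.2)
      \sum_(s <- wsplits (sword q.1.2)) \sum_(t <- wsplits (sword r.1.2))
        h2 q.1.1 _ _ _ (projT2 s).1 (projT2 s).2 r.1.1 _ _ _
           (projT2 t).1 (projT2 t).2 r.2).
Proof.
elim: p h1 h2 => {x z} [x y w|x u v y w f p IH] h1 h2.
  rewrite /= big_map big_seq1 /= big_nil addr0; apply: eq_bigr => s _ /=.
  by rewrite big_map.
rewrite psectors_pcons (picks_rcons _ _ (fun X b X' =>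
  \sum_(s <- wsplits (sword b))
      \sum_(t <- wsplits (projT2 s).2 | ~~ wempty (projT2 t).1)
        h1 X _ _ _ _ (projT2 s).1 (projT2 t).1 (projT2 t).2 X'
  + \sum_(r <- picks X')
      \sum_(s <- wsplits (sword b)) \sum_(t <- wsplits (sword r.1.2))
        h2 X _ _ _ (projT2 s).1 (projT2 s).2 r.1.1 _ _ _
           (projT2 t).1 (projT2 t).2 r.2)) /=.
rewrite big_nil addr0 big_cat !big_map /=.
under eq_bigr => s _ do rewrite big_cat !big_map /=.
rewrite big_split /= -addrA addrC; congr (_ + _).
have := IH (fun X a b c e L Y R X' => h1 X a b c e L Y R (rcons X' (Sector w)))
  (fun X a b c Y1 R Y a' b' c' L Ym X' =>
     h2 X a b c Y1 R Y a' b' c' L Ym (rcons X' (Sector w))).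
move=> IH'.
under [in RHS]eq_bigr => q _.
  rewrite (picks_rcons _ _ (fun X' b X'' =>
     \sum_(s <- wsplits (sword q.1.2)) \sum_(t <- wsplits (sword b))
        h2 q.1.1 _ _ _ (projT2 s).1 (projT2 s).2 X' _ _ _
           (projT2 t).1 (projT2 t).2 X'')) addrA /=.
  over.
rewrite big_split -IH' /= [RHS]addrC; congr (_ + _).
  transitivity (\sum_(q <- picks (psectors p)) \sum_(t <- wsplits w)
      \sum_(s <- wsplits (sword q.1.2))
        h2 q.1.1 _ _ _ (projT2 s).1 (projT2 s).2 q.2 _ _ _
           (projT2 t).1 (projT2 t).2 [::]); last first.
    by apply: eq_bigr => q _; rewrite exchange_big.
  rewrite [RHS]exchange_big /=; apply: eq_bigr => s _.
  exact: (cut_picks p (fun X a b c L R X' =>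
    h2 X a b c L R X' _ _ _ (projT2 s).1 (projT2 s).2 [::])).
by apply: eq_bigr => s _; apply: eq_bigr => t _; rewrite chord_term_pcons.
Qed.

End Splits.

(** * Values of the operation as pairings of a disc *)

Section Values.
Variables (k : fieldType) (A : quiver k) (d : int).
Implicit Types (fs : seq (arrow (dual_quiver A))) (o : seq (arrow A)).
Local Notation pword := (@pword k A).
Local Notation word := (@word k A).
Local Notation outs := (outs_deg d).
Local Notation sdegs p := (map (@sector_deg k A) (psectors p)).
Local Notation tdegs p := (map (tdeg d) (pfuns p)).

Lemma multilinear0 (W : lmodType k) : multilinear (fun _ : seq (arrow A) => 0 : W).
Proof. by move=> l x y i r c a b; rewrite scaler0 addr0. Qed.

Lemma multilinearZ (W : lmodType k) c (g : seq (arrow A) -> W) :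
  multilinear g -> multilinear (fun o => c *: g o).
Proof. by move=> gL l x y i r e a b; rewrite gL scalerDr !scalerA mulrC. Qed.

(** To compare pairings of a disc, it suffices to consider outputs with the
    objects and the total degree that its type prescribes. *)
Lemma multi_tlift e (M : multi A d e) zs (W : lmodType k) (g g' : seq (arrow A) -> W) :
  valid_type zs -> multilinear g -> multilinear g' ->
  (forall o, map tag o = out_objs zs -> outs o = sectors_deg zs + e -> g o = g' o) ->
  tlift g (M zs) = tlift g' (M zs).
Proof.
move=> vz gL g'L gg'; apply: (tlift_span gL g'L (multi_deg M vz)) => o [o1 o2].
exact: gg'.
Qed.

Lemma size_out_objs (zs : seq (sector A)) : size (out_objs zs) = size zs.
Proof. by rewrite /out_objs size_zip size_rot !size_map minnn. Qed.

Lemma j_epsE dphi (a t : seq int) : size a = (size t).+1 ->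
  j_eps d dphi a t =
  upper_sum t a + dphi * isum t + d * (size t)%:Z + upper_sum a a + upper_sum t t.
Proof.
move=> sa; have E1 := upper_sumE t a; have E2 := upper_sumE a a; rewrite sa in E1 E2.
by rewrite /j_eps sa /= E1 E2 upper_sumE isum_nth.
Qed.

Lemma j_deltaE dphi c l z (t : seq int) sb :
  j_delta d dphi (c :: rcons l z) t sb =
  j_eps d dphi (c :: rcons l z) t + d * (dphi + isum (c :: rcons l z)) +
  (z + sb) * isum l + z * sb.
Proof.
rewrite /j_delta isum_nth /= size_rcons /= nth_rcons ltnn eqxx.
congr (_ + _ * _ + _); rewrite big_add1 /= -isum_nth big_mkord.
by apply: eq_bigr => i _; rewrite nth_rcons ltn_ord.
Qed.

(** What remains of the sign in [j_val] when the [i]-th output has degree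
    [- t_i]: the sign of the evaluation of the functionals cancels the terms
    quadratic in [t], and moving [s_d] past them cancels the term in [|phi|]. *)
Definition val_exp (a t : seq int) : int :=
  upper_sum t a + d * (size t)%:Z + upper_sum a a.

Lemma size_psectors x y (p : pword x y) : size (psectors p) = (size (pfuns p)).+1.
Proof. by rewrite /= size_prest. Qed.

(** The analogous exponent for [j_dual], where [an] is the degree of [sa^n] and
    [am] that of [sa^2, ..., sa^(n-1)]. A nonzero value forces the total degree
    of the disc to balance that of the functionals, whence [D] has the parity of
    the degree of [sb]. *)
Definition dual_exp (a t : seq int) (an am : int) : int :=
  let D := isum a + isum t + d in val_exp a t + D + D * (am + an) + an * am.

Section DegreeOne.
Variable M : multi A d (d + 2).

Lemma j_valE x y (p : pword x y) i :
  j_val M p i = sgn (val_exp (sdegs p) (tdegs p)) *: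
                tlift (pair_last (pfuns p) x y i) (M (psectors p)).
Proof.
rewrite /j_val -!tliftZ; apply: eq_tlift => o.
have so : size (tdegs p) = size (pfuns p) by rewrite size_map.
have [nz|/pair_with_supp [o' [b [-> so' nz _]]]] :=
    pselect (pair_last (pfuns p) x y i o = 0); last first.
  rewrite so -cats1 drop_size_cat // take_size_cat // cats1 [pair_last _ _ _ _ _]pair_with_last.
  rewrite !scalerA mulrA; congr (_ * _ *: _).
  rewrite koszul_appE ?size_map ?size_rcons ?size_map ?so' //.
  have := dapps_degs d nz; rewrite /degs map_rcons => ->.
  rewrite (map_comp -%R) -!cats1 upper_sum_cat ?size_map // upper_sum_oppl isum_opp.
  rewrite isum_cons isum_nil j_epsE ?size_map ?size_psectors // /val_exp.
  rewrite -sgnD size_map; apply: sgn_par; rewrite /= isum_nil !parE; btauto.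
rewrite nz scaler0; case E: (drop _ o) => [|b [|]]; rewrite ?scaler0 //.
have := cat_take_drop (size (tdegs p)) o; rewrite E cats1 => eo.
move: nz; rewrite -{1}eo [pair_last _ _ _ _ _]pair_with_last => nz.
by rewrite -scalerA nz !scaler0.
Qed.

Lemma closed_supp fs zs : valid_type zs ->
  sectors_deg zs + (d + 2) <> - isum (map (tdeg d) fs) ->
  tlift (dapps fs : _ -> k^o) (M zs) = 0.
Proof.
move=> vz ne; rewrite -[RHS](tlift0 k^o (M zs)).
apply: (multi_tlift M vz (dapps_multilinear fs) (@multilinear0 _)) => o _ od.
have [//|/(@dapps_outs _ _ d) oE] := pselect (dapps fs o = 0).
by case: ne; rewrite -od.
Qed.

Lemma valid_closed x u v y (l : word x u) (b : letter u v) (r : word v y) zs :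
  valid_type (Sector (wcat l (wcons b r)) :: zs).
Proof. by case: zs => //=; rewrite wempty_cat_cons. Qed.

Section Closed.
Variables (x u v y : obj A) (w : word x u).
Variables (f : @letter k (dual_quiver A) u v) (p : pword v y).
Let q := pcons w f p.

Lemma sector_deg_closed (b : letter y x) :
  sectors_deg (Sector (wcat (projT2 (pfirst p)) (wcons b w)) :: prest p) =
  sectors_deg (psectors q) + sdeg b.
Proof.
rewrite psectors_pcons sectors_deg_rcons /psectors !sectors_deg_cons /sector_deg /=.
by rewrite wdeg_cat /=; ring.
Qed.

Lemma j_dualE b :
  dual_fun (j_dual M q (pdeg d q + 2)) b =
  sgn (dual_exp (sdegs q) (tdegs q) (wdeg w) (sectors_deg (prest p))) *
  tlift (dapps (pfuns q) : _ -> k^o)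
    (M (Sector (wcat (projT2 (pfirst p)) (wcons (hl b) w)) :: prest p)).
Proof.
transitivity (j_dual_fun M w f p b); first by [].
rewrite /j_dual_fun -/q.
set zs := _ :: prest p; set n := sectors_deg (prest p).
transitivity (sgn ((d - 1) * (pdeg d q + 2) +
    j_delta d (d + 2) (sdegs q) (tdegs q) (sdeg (hl b)) - upper_sum (tdegs q) (tdegs q)) *
    tlift (dapps (pfuns q) : _ -> k^o) (M zs)).
  rewrite [in RHS]sgnD -[RHS]mulrA; congr (_ * _).
  transitivity (sgn (- upper_sum (tdegs q) (tdegs q)) *:
    (tlift (dapps (pfuns q)) (M zs) : k^o)); last by [].
  rewrite -tliftZ.
  apply: eq_tlift => o.
  have [->|nz] := pselect (dapps (pfuns q) o = 0); first by rewrite mulr0 scaler0.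
  congr (_ * _).
  rewrite koszul_appE ?size_map; last first.
    by apply/eqP/negPn/negP => /eqP /dapps_size; exact: nz.
  have := dapps_degs d nz; rewrite /degs => ->.
  by rewrite (map_comp -%R) upper_sum_oppl.
congr (_ * _); apply: sgn_par.
have aE : sdegs q = sector_deg (Sector (projT2 (pfirst p))) ::
    rcons (map (@sector_deg k A) (prest p)) (wdeg w).
  by rewrite psectors_pcons map_rcons.
have -> : sdeg (hl b) = - (d + 2) - pdeg d q by rewrite /sdeg /=; ring.
rewrite aE j_deltaE -aE j_epsE; last first.
  by rewrite !size_map size_psectors.
have -> : isum (map (@sector_deg k A) (prest p)) = n by rewrite -sectors_degE.
rewrite /dual_exp /val_exp /pdeg sectors_degE -/n.
by rewrite !parE; btauto.
Qed.

(** The functional is determined by its values on elements [sb], and each of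
    these is a complete pairing, zero for degree reasons. *)
Lemma j_dual_deg i : i <> pdeg d q + 2 -> j_dual M q i = 0.
Proof.
move=> ne; apply: dual_ext => b.
transitivity (j_dual_fun M w f p b); first by [].
rewrite /j_dual_fun.
set g := fun o : seq (arrow A) => _.
have gE o : g o = sgn (koszul_app (tdegs q) (degs d o)) *: (dapps (pfuns q) o : k^o) by [].
rewrite (eq_tlift _ gE) -[RHS](mulr0 (sgn ((d - 1) * i +
  j_delta d (d + 2) (sdegs q) (tdegs q) (sdeg (hl b))))).
congr (_ * _).
set zs := _ :: prest p.
rewrite -[RHS](tlift0 k^o (M zs)).
apply: (multi_tlift M (valid_closed _ _ _ _)) => [||o _ oE].
- exact/multilinear_sgn/dapps_multilinear.
- exact: multilinear0.
have [->|/(@dapps_outs _ _ d) oE'] := pselect (dapps (pfuns q) o = 0).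
  by rewrite scaler0.
case: ne; move: oE; rewrite oE' sector_deg_closed /pdeg /sdeg /=.
rewrite psectors_pcons -/(psectors p); lia.
Qed.
End Closed.
End DegreeOne.
End Values.

Section ValuePairings.
Variables (k : fieldType) (A : quiver k) (d : int) (M : multi A d (d + 2)).
Local Notation pword := (@pword k A).
Local Notation word := (@word k A).
Local Notation outs := (outs_deg d).
Local Notation sdegs p := (map (@sector_deg k A) (psectors p)).
Local Notation tdegs p := (map (tdeg d) (pfuns p)).

Definition dual_arrow x y (p : pword x y) (e : int) : arrow (dual_quiver A) :=
  @mk_arrow k (dual_quiver A) x y (@hl k (dual_quiver A) x y _ (j_dual M p e)).

Definition val_arrow x y (p : pword x y) (e : int) : arrow A :=
  mk_arrow (hl (j_val M p e)).

Lemma plugE X x y u v (L : word x u) (R : word v y) Y i (a : A u v i) :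
  plug M X L R Y (mk_arrow (hl a)) = M (X ++ Sector (wcat L (wcons (hl a) R)) :: Y).
Proof. by rewrite /plug (untagE _ _ (erefl : tag (mk_arrow _) = (u, v))). Qed.

Lemma plug_obj X x y u v (L : word x u) (R : word v y) Y (b : arrow A) :
  tag b <> (u, v) -> plug M X L R Y b = 0.
Proof. by move=> /eqP ne; rewrite /plug untag_dflt. Qed.

Lemma plug_linear X x y u v (L : word x u) (R : word v y) Y a b i :
  linear (fun c : A a b i => plug M X L R Y (mk_arrow (hl c))).
Proof.
have [uv|/eqP uv] := eqVneq (a, b) (u, v); last first.
  by move=> c s t; rewrite !plug_obj // scaler0 addr0.
by case: uv => -> -> c s t; rewrite !plugE multi_linear.
Qed.

(** Evaluating the functional at an output [b] of another disc amounts to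
    plugging [b] into the disc that defines the functional. *)
Lemma dapp_dual_arrow x u v y (w : word x u) (f : @letter k (dual_quiver A) u v)
    (p : pword v y) (b : arrow A) :
  let q := pcons w f p in
  dapp (dual_arrow q (pdeg d q + 2)) b =
  sgn (dual_exp d (sdegs q) (tdegs q) (wdeg w) (sectors_deg (prest p))) *
  tlift (dapps (pfuns q) : _ -> k^o) (plug M [::] (projT2 (pfirst p)) w (prest p) b).
Proof.
move=> q.
have [bo|/eqP bo] := eqVneq (tag b) (y, x); last first.
  rewrite /dapp arrow_comp_obj // plug_obj // /dual_fun linear0.
  by rewrite lin0 ?mulr0 //; exact/tlift_linear/dapps_multilinear.
have [i [a ->]] := arrow_of_obj bo; rewrite plugE /= {b bo}.
have [ie|ie] := pselect (i = - (d - 1 + (pdeg d q + 2))).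
  by subst i; rewrite /dapp arrow_compK j_dualE.
rewrite /dapp arrow_comp_deg // /dual_fun linear0 closed_supp ?mulr0 //.
  exact: valid_closed.
rewrite (@sector_deg_closed _ _ x u v y w f) /sdeg /= => e.
by apply: ie; move: e; rewrite /pdeg psectors_pcons /=; lia.
Qed.

Lemma pvalid x y (p : pword x y) : ~~ pempty p -> valid_type (psectors p).
Proof. by case: p => //= *; case: (prest _). Qed.

Lemma j_val_deg x y (p : pword x y) i : ~~ pempty p -> i <> pdeg d p + 2 ->
  j_val M p i = 0.
Proof.
move=> vp ne; rewrite j_valE.
rewrite (_ : tlift _ _ = 0) ?scaler0 //.
rewrite -[RHS](tlift0 _ (M (psectors p))).
apply: (multi_tlift M (pvalid vp)) => [||o _].
- exact: pair_last_multilinear.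
- exact: multilinear0.
have [//|/pair_with_supp [o' [b [-> _ nz /arrow_comp_supp [_ bd]]]]] :=
  pselect (pair_last (pfuns p) x y i o = 0).
rewrite -cats1 outs_deg_cat (dapps_outs d nz) => e; case: ne; move: e.
by rewrite /pdeg /outs_deg big_seq1 /out_deg bd; lia.
Qed.

(** The value is linear in the letter at a given place, be it an element or,
    below, a functional. *)
Lemma j_val_letter_linear x u v y (p1 : pword x u) (p3 : pword v y) e i :
  linear (fun a : A u v i => j_val M (pcat p1 (pcons_letter (hl a) p3)) e).
Proof.
move=> c a b; rewrite !j_valE.
rewrite !pfuns_cat !pfuns_letter !psectors_plug multi_linear.
rewrite (tlift_linear (@pair_last_multilinear _ _ _ _ _ _)) scalerDr.
by rewrite !map_cat /= /sector_deg /= !wdeg_cat !scalerA mulrC.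
Qed.

Lemma j_val_fun_linear x u v y (p1 : pword x u) (p3 : pword v y) e i :
  linear (fun g : dual_quiver A u v i =>
    j_val M (pcat p1 (pcons (wnil u) (@hl k (dual_quiver A) u v i g) p3)) e).
Proof.
move=> c a b; rewrite !j_valE.
rewrite !pfuns_cat !psectors_cat /= !cat_rcons !map_cat /=.
rewrite !scalerA [c * _]mulrC -scalerA -scalerDr.
set X := M _; rewrite -tliftZ -tliftD; congr (_ *: _).
apply: eq_tlift => o; rewrite /pair_last.
elim: (pfuns p3) o => [|f fs IH] [|b' o] /=; rewrite ?scaler0 ?addr0 //.
  by rewrite scalerA -scalerDl.
by rewrite IH scalerDr !scalerA mulrC.
Qed.

End ValuePairings.

(** * Composites of the operation as two-disc diagrams *)

Section Terms.
Variables (k : fieldType) (A : quiver k) (d : int) (M : multi A d (d + 2)).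
Local Notation pword := (@pword k A).
Local Notation word := (@word k A).
Local Notation outs := (outs_deg d).
Local Notation degs := (degs d).
Local Notation sdegs p := (map (@sector_deg k A) (psectors p)).
Local Notation tdegs p := (map (tdeg d) (pfuns p)).

Lemma arrow_linear_comp (W : lmodType k) (P : arrow A -> W) x y i
  (g : seq (arrow A) -> A x y i) : linear (fun a : A x y i => P (mk_arrow (hl a))) ->
  multilinear g -> multilinear (fun o => P (mk_arrow (hl (g o)))).
Proof. by move=> PL gL; exact: (multilinear_comp PL gL). Qed.

(** Feeding the last output of a disc to [P], its other outputs being paired
    with functionals, is feeding to [P] the value of the operation. The sign
    [c], a function of the degrees of all the outputs, becomes constant: these
    are forced by the functionals and by the total degree. *)
Lemma apply_value (W : lmodType k) (P : arrow A -> W) (c : seq int -> int)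
    u v (p : pword u v) :
  ~~ pempty p -> (forall x y i, linear (fun a : A x y i => P (mk_arrow (hl a)))) ->
  tlift (fun o => sgn (c (degs o)) *: pair_with (pfuns p) P o) (M (psectors p)) =
  sgn (c (rcons (map -%R (tdegs p)) (pdeg d p + 2 + d))) *:
  P (mk_arrow (hl (tlift (pair_last (pfuns p) u v (pdeg d p + 2)) (M (psectors p))))).
Proof.
move=> vp PL; set e := pdeg d p + 2.
have := tlift_map (pair_last (pfuns p) u v e) (M (psectors p)) (PL u v e) => ->.
rewrite -tliftZ; apply: (multi_tlift M (pvalid vp)) => [||o oO oD].
- exact/multilinear_sgn/pair_with_multilinear.
- apply/multilinearZ/arrow_linear_comp => //; exact: pair_last_multilinear.
case/lastP: o oO oD => [|o b] oO oD.
  by move/(congr1 size): oO; rewrite size_out_objs size_psectors.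
rewrite /= [pair_last _ _ _ _ _]pair_with_last pair_with_last.
have := linZ (dapps (pfuns p) o) (arrow_comp u v e b) (PL u v e) => ->.
have [->|nz] := pselect (dapps (pfuns p) o = 0); first by rewrite !scale0r !scaler0.
move: oO; rewrite out_objs_psectors map_rcons => /rcons_inj [_ /arrow_of_obj [i [a bE]]].
subst b.
have ie : i = e.
  move: oD; rewrite -cats1 outs_deg_cat (dapps_outs d nz) /outs_deg big_seq1.
  by rewrite /out_deg /= /e /pdeg; lia.
rewrite {}ie {i} in a oD *; rewrite arrow_compK.
have dE := dapps_degs d nz; rewrite /degs in dE.
by rewrite /degs map_rcons dE -!map_comp.
Qed.

Lemma dapp_val_arrow x y (p : pword x y) g : ~~ pempty p ->
  dapp g (val_arrow M p (pdeg d p + 2)) =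
  sgn (val_exp d (sdegs p) (tdegs p)) *
  tlift (dapps (rcons (pfuns p) g) : _ -> k^o) (M (psectors p)).
Proof.
move=> vp; rewrite /val_arrow j_valE.
have gL u v i : linear (fun a : A u v i => dapp g (mk_arrow (hl a))) by exact: dapp_linear.
rewrite [LHS](linZ _ _ (gL _ _ _)); congr (_ * _).
have := apply_value (fun=> 0) vp gL; rewrite sgn0 scale1r => <-.
apply: (@eq_tlift k A k^o) => o; rewrite scale1r.
case/lastP: o => [|o b]; last by rewrite pair_with_last dapps_rcons.
by rewrite dapps_size ?size_rcons // pair_with_size.
Qed.

Lemma tlift_shift_sgn (W : lmodType k) (c : seq int -> int)
    (g : seq (arrow A) -> W) (t : tensor A) : multilinear g ->
  tlift (fun o => sgn (c (degs o)) *: g o) (shift_last d t) =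
  tlift (fun o => sgn ((d + 1) * isum (take (size (degs o)).-1 (degs o)) + c (degs o)) *:
                  g o) t.
Proof.
move=> gL; rewrite tlift_shift_last; last exact: multilinear_sgn.
by apply: eq_tlift => o; rewrite scalerA -sgnD outs_degE /isum /degs map_take size_map.
Qed.

Lemma apply_value_shift (W : lmodType k) (P : arrow A -> W) (c : seq int -> int)
    u v (p : pword u v) :
  ~~ pempty p -> (forall x y i, linear (fun a : A x y i => P (mk_arrow (hl a)))) ->
  tlift (fun o => sgn (c (degs o)) *: pair_with (pfuns p) P o)
    (shift_last d (M (psectors p))) =
  sgn ((d + 1) * isum (tdegs p) +
       c (rcons (map -%R (tdegs p)) (pdeg d p + 2 + d))) *:
  P (mk_arrow (hl (tlift (pair_last (pfuns p) u v (pdeg d p + 2)) (M (psectors p))))).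
Proof.
move=> vp PL; rewrite tlift_shift_sgn; last exact: pair_with_multilinear.
rewrite (apply_value (fun s => (d + 1) * isum (take (size s).-1 s) + c s)) //.
rewrite size_rcons /= -cats1 take_size_cat ?size_map // isum_opp.
by congr (_ *: _); signs.
Qed.

Lemma pair_last_shift (fs : seq (arrow (dual_quiver A))) x y e (t : tensor A) :
  tlift (pair_last fs x y e) (shift_last d t) =
  sgn ((d + 1) * isum (map (tdeg d) fs)) *: tlift (pair_last fs x y e) t.
Proof.
rewrite tlift_shift_last; last exact: pair_last_multilinear.
rewrite -tliftZ; apply: eq_tlift => o.
have [->|/pair_with_supp [o' [b [-> so nz _]]]] := pselect (pair_last fs x y e o = 0).
  by rewrite !scaler0.
rewrite size_rcons /= -cats1 take_size_cat // (dapps_outs d nz).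
by congr (_ *: _); signs.
Qed.

(** The exponent of the common sign between the composites of the operation at
    [p1 p2 p3 = p] and the two-disc diagrams of type [psectors p]. It must not
    depend on the decomposition for the diagrams to add up to [nec]. *)
Definition chord_exp x y (p : pword x y) : int :=
  val_exp d (sdegs p) (tdegs p) + d * isum (tdegs p).

Section OneTerm.
Variables (x u v y : obj A) (p1 : pword x u) (p2 : pword u v) (p3 : pword v y).
Variable e : int.
Let L := projT2 (pfirst p1).
Let R := projT2 (plast p3).
Let e2 := pdeg d p2 + 2.

(** The disc of the outer operation, with the output [b] of the inner one
    plugged between [L] and [R]. *)
Definition outer_value (b : arrow A) : A x y e :=
  tlift (pair_last (pfuns p3 ++ pfuns p1) x y e)
    (plug M (pinit p3) L R (prest p1) b).

Lemma outer_value_linear a b i :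
  linear (fun c : A a b i => outer_value (mk_arrow (hl c))).
Proof.
move=> c s t; rewrite /outer_value plug_linear.
by rewrite (tlift_linear (@pair_last_multilinear _ _ _ _ _ _)).
Qed.

Lemma j_val_outer :
  j_val M (pcat p1 (pcons_letter (hl (j_val M p2 e2)) p3)) e =
  sgn (val_exp d (map (@sector_deg k A) (pinit p3) ++
         (wdeg L + (pdeg d p2 + 1) + wdeg R) ::
          map (@sector_deg k A) (prest p1)) (tdegs p3 ++ tdegs p1) +
       val_exp d (sdegs p2) (tdegs p2)) *:
  outer_value (mk_arrow (hl (tlift (pair_last (pfuns p2) u v e2) (M (psectors p2))))).
Proof.
rewrite [j_val M p2 _]j_valE.
have := linZ (sgn (val_exp d (sdegs p2) (tdegs p2)))
  (tlift (pair_last (pfuns p2) u v e2) (M (psectors p2)))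
  (@j_val_letter_linear _ _ _ M _ _ _ _ p1 p3 e e2) => /= ->.
rewrite j_valE.
rewrite /outer_value plugE psectors_plug pfuns_cat pfuns_letter scalerA -sgnD addrC.
congr (sgn (val_exp _ _ _ + _) *: _); last by rewrite map_cat.
rewrite map_cat /= /sector_deg /= wdeg_cat /= /sdeg /= /e2.
by congr (_ ++ _ :: _); ring.
Qed.

End OneTerm.
End Terms.

Section TermSigns.
Variable d : int.
Implicit Types a t : seq int.

Lemma val_exp_cat t3 t1 a3 b a1 : size t3 = size a3 ->
  val_exp d (a3 ++ b :: a1) (t3 ++ t1) =
  upper_sum t3 a3 + isum t3 * (b + isum a1) + upper_sum t1 (0 :: a1)
  + d * ((size t3)%:Z + (size t1)%:Z)
  + (upper_sum a3 a3 + isum a3 * (b + isum a1) + (b * isum a1 + upper_sum a1 a1)).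
Proof.
move=> s3; rewrite /val_exp !upper_sum_cat // size_cat PoszD (upper_sum_head t1) /=.
by rewrite isum_cons.
Qed.

Lemma upper_sum_cats1 t a b : size t = size a ->
  upper_sum t (a ++ [:: b]) = upper_sum t a + isum t * b.
Proof.
move=> s; rewrite -{1}[t]cats0 upper_sum_cat // isum_cons isum_nil /=.
by rewrite !addr0.
Qed.

Lemma val_exp_outer t3 t2 t1 a3 b a2 c a1 :
  size t3 = size a3 -> size t2 = (size a2).+1 ->
  val_exp d (a3 ++ b :: a2 ++ c :: a1) (t3 ++ t2 ++ t1) =
  upper_sum t3 a3 + isum t3 * (b + isum a2 + c + isum a1) +
  (upper_sum t2 (0 :: a2) + isum t2 * (c + isum a1) + upper_sum t1 (0 :: a1))
  + d * ((size t3)%:Z + (size t2)%:Z + (size t1)%:Z)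
  + (upper_sum a3 a3 + isum a3 * (b + isum a2 + c + isum a1) +
     (b * (isum a2 + c + isum a1) +
      (upper_sum a2 a2 + isum a2 * (c + isum a1) + (c * isum a1 + upper_sum a1 a1)))).
Proof.
move=> s3 s2; rewrite val_exp_cat // -cat_cons !upper_sum_cat // !isum_cat !isum_cons.
by rewrite size_cat PoszD (upper_sum_head t1) /=; ring.
Qed.

Lemma val_exp_inner t2 b a2 c : size t2 = (size a2).+1 ->
  val_exp d (b :: a2 ++ [:: c]) t2 =
  upper_sum t2 (0 :: a2) + isum t2 * c + d * (size t2)%:Z +
  (b * (isum a2 + c) + (upper_sum a2 a2 + isum a2 * c)).
Proof.
move=> s2; rewrite /val_exp (upper_sum_head t2) -(cat_cons 0) (@upper_sum_cats1 _ (0 :: a2)) //=.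
by rewrite isum_cat isum_cons isum_nil upper_sum_cat //= isum_cons isum_nil; ring.
Qed.

(** The exponent on the left is that of the composite; those on the right come
    from [chord_exp], from the Koszul signs of [nec_left] and from the shifts of
    the last outputs. *)
Lemma left_signs t3 t2 t1 a3 y1 r a2 l w a1 (D1 D2 : int) :
  size t3 = size a3 -> size t2 = (size a2).+1 ->
  D1 = l + isum a1 + isum t1 -> D2 = y1 + isum a2 + w + isum t2 ->
  par (D1 + (val_exp d (a3 ++ (l + (D2 + 1) + r) :: a1) (t3 ++ t1) +
       val_exp d (y1 :: a2 ++ [:: w]) t2)) =
  par (val_exp d (a3 ++ (y1 + r) :: a2 ++ (l + w) :: a1) (t3 ++ t2 ++ t1) +
       d * isum (t3 ++ t2 ++ t1) +
    koszul [:: (1%N, isum a3); (0%N, y1); (1%N, r); (0%N, isum a2); (1%N, l);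
               (0%N, w); (1%N, isum a1)] +
    ((d + 1) * isum t2 +
     (koszul [:: (5%N, - isum t2); (2%N, D2 + 2 + d - (d + 1)); (0%N, isum a3);
                 (3%N, r); (1%N, l); (4%N, isum a1)] +
      (koszul [:: (0%N, - isum t3);
           (2%N, isum a3 + (l + (D2 + 2 + d - d - 1) + r) + isum a1 + (d + 2) +
                 isum t3 - (d + 1)); (1%N, - isum t2)] +
       (d + 1) * (isum t3 + isum t1))))).
Proof.
move=> s3 s2 -> ->; rewrite val_exp_outer // val_exp_inner // val_exp_cat //.
rewrite s2 s3 /koszul !big_cons !big_nil /= !isum_cat.
move: (isum a3) (isum a2) (isum a1) (isum t3) (isum t2) (isum t1).
move: (upper_sum a3 a3) (upper_sum a2 a2) (upper_sum a1 a1).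
move: (upper_sum t3 a3) (upper_sum t2 _) (upper_sum t1 _).
move: (size a3) (size a2) (size t1) => *.
rewrite !parE.
btauto.
Qed.
End TermSigns.

Section NecTerms.
Variables (k : fieldType) (A : quiver k) (d : int) (M : multi A d (d + 2)).
Local Notation pword := (@pword k A).
Local Notation word := (@word k A).
Local Notation outs := (outs_deg d).
Local Notation degs := (degs d).
Local Notation sdegs p := (map (@sector_deg k A) (psectors p)).
Local Notation tdegs p := (map (tdeg d) (pfuns p)).
Local Notation isdeg X := (sectors_deg X).

Variables (x u v y : obj A) (p1 : pword x u) (p3 : pword v y) (e : int).

Let pair_linear fs := tlift_linear (@pair_last_multilinear k A fs x y e).

(** When [p2] contains no functional, the inner disc has a single output, so
    both ends of the chord lie in the same block. *)
Lemma inner_term (w : word u v) : ~~ wempty w ->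
  let p2 := pblock w in
  sgn (pdeg d p1) *:
    j_val M (pcat p1 (pcons_letter (hl (j_val M p2 (pdeg d p2 + 2))) p3)) e =
  sgn (chord_exp d (pcat p1 (pcat p2 p3))) *:
  tlift (pair_last (pfuns (pcat p1 (pcat p2 p3))) x y e)
    (nec_inner M M (pinit p3) (projT2 (pfirst p1)) w (projT2 (plast p3)) (prest p1)).
Proof.
move=> w0 p2; have fE : pfuns (pcat p1 (pcat p2 p3)) = pfuns p3 ++ pfuns p1.
  by rewrite !pfuns_cat cats0.
rewrite j_val_outer fE /nec_inner (linZ _ _ (pair_linear _)) (tlift_map _ _ (pair_linear _)).
pose c (s : seq int) : int := koszul [:: (2%N, s`_0 - (d + 1)); (0%N, isdeg (pinit p3));
   (1%N, wdeg (projT2 (pfirst p1))); (3%N, wdeg (projT2 (plast p3)));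
   (4%N, isdeg (prest p1))] + (d + 1) * isum (map (tdeg d) (pfuns p3 ++ pfuns p1)).
rewrite (eq_tlift (g' := fun o => sgn (c (degs o)) *:
    pair_with (pfuns p2) (outer_value M p1 p3 e) o)); last first.
  case=> [|b [|b' o]] /=; rewrite ?scaler0 ?(lin0 (pair_linear _)) //.
  by rewrite (linZ _ _ (pair_linear _)) pair_last_shift scalerA -sgnD.
rewrite (apply_value_shift M c (p := p2) w0 (outer_value_linear _ _ _ _)).
rewrite !scalerA; congr (_ *: _).
have -> : sdegs p2 = [:: wdeg w] by [].
rewrite /chord_exp fE psectors_cat.
rewrite [pcat p2 p3]/= pinit_word plast_word.
rewrite !map_cat /= !val_exp_cat ?size_map ?size_pinit // /sector_deg /= !wdeg_cat.
rewrite /c /pdeg !sectors_degE /= !isum_cons !map_cat !isum_cat /sector_deg /val_exp /=.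
by rewrite !isum_nil; signs.
Qed.

Lemma valid_plug X a b c b' (l : word a b) (z : letter b b') (r : word b' c) X' :
  valid_type (X ++ Sector (wcat l (wcons z r)) :: X').
Proof. by case: X => [|? []] //; exact: valid_closed. Qed.

(** The innermost sum in [nec_left]: the sign that orders the outputs is
    constant, because those of the outer disc that precede the inserted ones are
    paired with the functionals of [p3], those that follow have the remaining
    degree. *)
Lemma left_outputs (f2 : seq (arrow (dual_quiver A))) o (b : arrow A) :
  size o = size f2 ->
  let X := pinit p3 in let X' := prest p1 in
  let L := projT2 (pfirst p1) in let R := projT2 (plast p3) in
  let D := isdeg X + (wdeg L + (out_deg d b - d - 1) + wdeg R) + isdeg X' + (d + 2) in
  tlift (pair_last (pfuns p3 ++ f2 ++ pfuns p1) x y e)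
    (tlift (fun q =>
       sgn (koszul [:: (0%N, outs (take (size X) q));
                       (2%N, outs (drop (size X) q) - (d + 1)); (1%N, outs o)]) *:
       tpure (take (size X) q ++ o ++ drop (size X) q))
     (shift_last d (plug M X L R X' b))) =
  sgn (koszul [:: (0%N, - isum (tdegs p3)); (2%N, D + isum (tdegs p3) - (d + 1));
                  (1%N, - isum (map (tdeg d) f2))] +
       (d + 1) * (isum (tdegs p3) + isum (tdegs p1))) *:
  ((dapps f2 o : k) *: outer_value M p1 p3 e b).
Proof.
move=> so X X' L R D; rewrite (tlift_map _ _ (pair_linear _)).
have sX : size X = size (pfuns p3) by exact: size_pinit.
pose G q := (dapps f2 o : k) *: pair_last (pfuns p3 ++ pfuns p1) x y e q.
pose c s := koszul [:: (0%N, isum (take (size X) s));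
  (2%N, isum (drop (size X) s) - (d + 1)); (1%N, outs o)].
have GL : multilinear G by exact/multilinearZ/pair_last_multilinear.
rewrite (eq_tlift (g' := fun q => sgn (c (degs q)) *: G q)); last first.
  move=> q /=; rewrite (linZ _ _ (pair_linear _)) tlift_pure; last exact: pair_last_multilinear.
  by rewrite sX pair_last_insert // /c /isum -map_take -map_drop -!outs_degE -sX.
rewrite tlift_shift_sgn //; pose c' s := (d + 1) * isum (take (size s).-1 s) + c s.
have c'L : multilinear (fun q => sgn (c' (degs q)) *: G q) by exact: multilinear_sgn.
have [bo|/eqP bo] := eqVneq (tag b) (u, v); last first.
  rewrite /outer_value plug_obj // (lin0 (pair_linear _)) !scaler0.
  exact: (lin0 (tlift_linear c'L)).
have [i [a bE]] := arrow_of_obj bo; subst b.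
rewrite /outer_value plugE.
have GE t : tlift G t = (dapps f2 o : k) *: tlift (pair_last (pfuns p3 ++ pfuns p1) x y e) t.
  exact: tliftZ.
rewrite -GE -tliftZ.
apply: (multi_tlift M (valid_plug _ _ _ _ _) c'L) => [|q _ qD].
  exact: multilinearZ.
have [Gq|Gq] := pselect (G q = 0); first by rewrite -/(G q) Gq !scaler0.
congr (_ *: _).
have [zo|zo] := pselect (dapps f2 o = 0); first by case: Gq; rewrite /G zo scale0r.
have [zq|/pair_with_supp [q' [b' [qE sq zq' _]]]] :=
  pselect (pair_last (pfuns p3 ++ pfuns p1) x y e q = 0).
  by case: Gq; rewrite /G zq scaler0.
have q1E : isum (take (size (degs q)).-1 (degs q)) = - (isum (tdegs p3) + isum (tdegs p1)).
  rewrite qE /degs map_rcons size_rcons -cats1 take_size_cat //.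
  by have := dapps_outs d zq'; rewrite outs_degE /isum /degs => ->; rewrite map_cat big_cat.
have q2E : isum (take (size X) (degs q)) = - isum (tdegs p3).
  rewrite qE /degs map_rcons; have := dapps_degs d zq'; rewrite /degs => ->.
  rewrite map_cat rcons_cat sX take_size_cat ?size_map //.
  by rewrite (map_comp -%R) isum_opp.
have q3E : isum (drop (size X) (degs q)) = D + isum (tdegs p3).
  have : isum (degs q) = D.
    rewrite /isum -outs_degE qD /D sectors_deg_cat sectors_deg_cons /sector_deg /=.
    by rewrite wdeg_cat /= /sdeg /out_deg /=; ring.
  by rewrite -{1}(cat_take_drop (size X) (degs q)) isum_cat q2E => <-; ring.
rewrite /c' /c q1E q2E q3E (dapps_outs d zo).
by signs.
Qed.

Section Pairs.
Variables (u' v' : obj A) (w : word u u') (f : @letter k (dual_quiver A) u' v').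
Variable p' : pword v' v.
Let p2 := pcons w f p'.
Let p := pcat p1 (pcat p2 p3).
Let X := pinit p3.
Let X' := prest p1.
Let Y := prest p'.
Let L := projT2 (pfirst p1).
Let R := projT2 (plast p3).
Let Y1 := projT2 (pfirst p').

Lemma pfuns_pair : pfuns p = pfuns p3 ++ pfuns p2 ++ pfuns p1.
Proof. by rewrite /p !pfuns_cat catA. Qed.

Lemma sdegs_pair : sdegs p =
  map (@sector_deg k A) X ++ (wdeg Y1 + wdeg R) ::
  map (@sector_deg k A) Y ++ (wdeg L + wdeg w) :: map (@sector_deg k A) X'.
Proof.
rewrite /p psectors_cat [pinit _]/= -/(psectors _) psectors_cat !map_cat /=.
by rewrite /sector_deg /= !wdeg_cat -catA.
Qed.

Lemma sdegs_inner : sdegs p2 =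
  wdeg Y1 :: map (@sector_deg k A) Y ++ [:: wdeg w].
Proof. by rewrite psectors_pcons map_rcons -cats1. Qed.

(** When the inner operation is [A]-valued, the root is on the disc of the
    outer operation, and the last output of the inner one is plugged in it. *)
Lemma left_term :
  sgn (pdeg d p1) *:
    j_val M (pcat p1 (pcons_letter (hl (j_val M p2 (pdeg d p2 + 2))) p3)) e =
  sgn (chord_exp d (pcat p1 (pcat p2 p3))) *:
  tlift (pair_last (pfuns p) x y e) (nec_left M M X Y1 R Y L w X').
Proof.
have s2 : size (pfuns p2) = (size Y).+1 by rewrite /= size_rcons -size_prest.
rewrite j_val_outer pfuns_pair /nec_left.
rewrite (linZ _ _ (pair_linear _)) (tlift_map _ _ (pair_linear _)).
pose b' (s : seq int) : int := last 0 s.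
pose c (s : seq int) : int :=
  koszul [:: (5%N, - isum (tdegs p2)); (2%N, b' s - (d + 1)); (0%N, isdeg X);
             (3%N, wdeg R); (1%N, wdeg L); (4%N, isdeg X')] +
  (koszul [:: (0%N, - isum (tdegs p3));
             (2%N, isdeg X + (wdeg L + (b' s - d - 1) + wdeg R) + isdeg X' + (d + 2)
                    + isum (tdegs p3) - (d + 1)); (1%N, - isum (tdegs p2))] +
   (d + 1) * (isum (tdegs p3) + isum (tdegs p1))).
rewrite cats1 -[Sector Y1 :: _]/(psectors p2).
rewrite (eq_tlift (g' := fun o => sgn (c (degs o)) *:
    pair_with (pfuns p2) (outer_value M p1 p3 e) o)); last first.
  move=> o; rewrite /= -s2.
  have [so|/eqP so] := eqVneq (size o) (size (pfuns p2)).+1; last first.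
    rewrite pair_with_size // scaler0; case E: (drop _ o) => [|b [|]];
      rewrite ?(lin0 (pair_linear _)) //.
    case: so; rewrite -(cat_take_drop (size (pfuns p2)) o) E size_cat addn1.
    rewrite size_takel //; move: (size_drop (size (pfuns p2)) o); rewrite E /=; lia.
  case/lastP: o so => [//|o b]; rewrite (size_rcons o b) => /succn_inj so.
  rewrite -(cats1 o b) drop_size_cat // take_size_cat // cats1 pair_with_last.
  rewrite (linZ _ _ (pair_linear _)) (left_outputs _ so).
  have [->|nz] := pselect (dapps (pfuns p2) o = 0); first by rewrite !scale0r !scaler0.
  rewrite [LHS]scalerA -sgnD (dapps_outs d nz) /c /b' /degs map_rcons last_rcons.
  by [].
rewrite (apply_value_shift M c (p := p2) isT (outer_value_linear _ _ _ _)).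
rewrite !scalerA; congr (_ *: _).
rewrite /c /b' last_rcons /chord_exp pfuns_pair sdegs_pair sdegs_inner.
rewrite !map_cat -!sgnD !sectors_degE; apply: sgn_par.
apply: left_signs; rewrite ?size_map ?size_pinit ?s2 //.
  by rewrite /pdeg sectors_degE isum_cons.
by rewrite /pdeg sectors_degE sdegs_inner isum_cons isum_cat isum_cons isum_nil addr0 !addrA.
Qed.
End Pairs.
End NecTerms.

Section RightSigns.
Variable d : int.

(** As in [left_signs], for [nec_right]; the functional produced by the inner
    operation has degree [D2 + 1]. *)
Lemma right_signs (t3 t2 t1 a3 a2 a1 : seq int) (y1 r l w D1 D2 : int) :
  size t3 = size a3 -> size t2 = (size a2).+1 ->
  D1 = l + isum a1 + isum t1 -> D2 = y1 + isum a2 + w + isum t2 ->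
  par (D1 + val_exp d (a3 ++ r :: l :: a1) (t3 ++ (D2 + 1) :: t1)) =
  par (val_exp d (a3 ++ (y1 + r) :: a2 ++ (l + w) :: a1) (t3 ++ t2 ++ t1) +
       d * isum (t3 ++ t2 ++ t1) +
    koszul [:: (0%N, isum a3); (1%N, y1); (0%N, r); (1%N, isum a2); (0%N, l);
               (1%N, w); (0%N, isum a1)] +
    (- (d + 1) * isum (t3 ++ (D2 + 1) :: t1) +
     (koszul [:: (4%N, - isum t3); (1%N, - (D2 + 1));
         (5%N, isum a3 + r + l + isum a1 + (d + 2) + isum t3 + (D2 + 1) - (d + 1));
         (0%N, y1); (3%N, isum a2); (2%N, w)] +
      (d + 1) * (d + 2 + d + 1) + (d + 1) * y1 +
      (koszul [:: (1%N, - isum t2); (0%N, - isum t3);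
         (2%N, isum a3 + r + l + isum a1 + (d + 2) + isum t3 + (D2 + 1) - (d + 1))] +
       dual_exp d (y1 :: a2 ++ [:: w]) t2 w (isum a2))))).
Proof.
move=> s3 s2 -> ->; rewrite val_exp_outer // val_exp_cat // /dual_exp val_exp_inner //.
rewrite s2 s3 /koszul !big_cons !big_nil /= !isum_cat !isum_cons !isum_cat !isum_cons isum_nil.
rewrite (upper_sum_head t1).
move: (isum a3) (isum a2) (isum a1) (isum t3) (isum t2) (isum t1).
move: (upper_sum a3 a3) (upper_sum a2 a2) (upper_sum a1 a1).
move: (upper_sum t3 a3) (upper_sum t2 _) (upper_sum t1 _).
rewrite -[(size t1).+1]addn1 PoszD.
move: (size a3) (size a2) (size t1) => *.
rewrite !parE.
btauto.
Qed.
End RightSigns.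


Section RightTerm.
Variables (k : fieldType) (A : quiver k) (d : int) (M : multi A d (d + 2)).
Local Notation pword := (@pword k A).
Local Notation word := (@word k A).
Local Notation outs := (outs_deg d).
Local Notation degs := (degs d).
Local Notation sdegs p := (map (@sector_deg k A) (psectors p)).
Local Notation tdegs p := (map (tdeg d) (pfuns p)).
Local Notation isdeg X := (sectors_deg X).

Variables (x u v y : obj A) (p1 : pword x u) (p3 : pword v y) (e : int).
Variables (u' v' : obj A) (w : word u u') (f : @letter k (dual_quiver A) u' v').
Variable p' : pword v' v.
Let p2 := pcons w f p'.
Let p := pcat p1 (pcat p2 p3).
Let X := pinit p3.
Let X' := prest p1.
Let Y := prest p'.
Let L := projT2 (pfirst p1).
Let R := projT2 (plast p3).
Let Y1 := projT2 (pfirst p').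
Let f3 := pfuns p3.
Let f2 := pfuns p2.
Let f1 := pfuns p1.
Let g := dual_arrow M p2 (pdeg d p2 + 2).
Let dual_sign := dual_exp d (sdegs p2) (tdegs p2) (wdeg w) (isdeg Y).

Let pair_linear fs := tlift_linear (@pair_last_multilinear k A fs x y e).

Lemma multilinear_ctx (W : lmodType k) (h : seq (arrow A) -> W) o1 o2 :
  multilinear h -> multilinear (fun q => h (o1 ++ q ++ o2)).
Proof.
move=> hL l a b i r c s t; have := hL (o1 ++ l) a b i (r ++ o2) c s t.
by rewrite -!catA.
Qed.

(** The disc with outputs [q] has received the output [b] of the other disc;
    pairing [q] with the functionals of [p2] evaluates at [b] the functional
    that [p2] defines. *)
Lemma right_outputs o1 (b : arrow A) o2 : size o1 = size f3 ->
  tlift (pair_last (f3 ++ f2 ++ f1) x y e)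
    (tlift (fun q =>
       sgn (koszul [:: (1%N, outs q); (0%N, outs o1); (2%N, outs o2 - (d + 1))]) *:
       tpure (o1 ++ q ++ o2))
     (plug M [::] Y1 w Y b)) =
  sgn (koszul [:: (1%N, - isum (map (tdeg d) f2)); (0%N, outs o1);
                  (2%N, outs o2 - (d + 1))] + dual_sign) *:
  pair_last (f3 ++ g :: f1) x y e (o1 ++ b :: o2).
Proof.
move=> so; rewrite (tlift_map _ _ (pair_linear _)).
pose c s := koszul [:: (1%N, isum s); (0%N, outs o1); (2%N, outs o2 - (d + 1))].
pose G q := pair_last (f3 ++ f2 ++ f1) x y e (o1 ++ q ++ o2).
have GL : multilinear G by exact/multilinear_ctx/pair_last_multilinear.
have cL : multilinear (fun q => sgn (c (degs q)) *: G q) by exact: multilinear_sgn.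
rewrite (eq_tlift (g' := fun q => sgn (c (degs q)) *: G q)); last first.
  move=> q /=; rewrite (linZ _ _ (pair_linear _)) tlift_pure; last exact: pair_last_multilinear.
  by rewrite /c /isum -outs_degE.
rewrite sgnD -scalerA [X in _ = _ *: (_ *: X)]pair_with_cat // [pair_with (g :: _) _ _]/=.
rewrite dapp_dual_arrow -/f2 -/dual_sign.
have scL v0 : linear (fun a : k^o => a *: v0 : A x y e).
  by move=> a s t; rewrite scalerDl scalerA.
set Z := pair_with f1 _ o2; set T := plug _ _ _ _ _ _.
transitivity (sgn (c (map -%R (map (tdeg d) f2))) *: ((dapps f3 o1 : k) *:
    ((tlift (dapps f2 : _ -> k^o) T : k) *: Z))); last first.
  rewrite /c isum_opp; congr (_ *: _).
  rewrite [RHS]scalerA [X in _ = X *: _]mulrC -[RHS]scalerA; congr (_ *: _).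
  by rewrite [RHS]scalerA mulrA sgnK mul1r.
rewrite (tlift_map _ _ (scL Z)) -tliftZ -tliftZ {}/T.
set G' := (X in _ = tlift X _).
have G'L : multilinear G'.
  apply/multilinearZ/multilinearZ/multilinear_comp => //.
  exact: dapps_multilinear.
have [bo|/eqP bo] := eqVneq (tag b) (v, u); last first.
  rewrite plug_obj //.
  by rewrite (lin0 (tlift_linear cL)) (lin0 (tlift_linear G'L)).
have [i [a bE]] := arrow_of_obj bo; subst b; rewrite plugE.
apply: (multi_tlift M (valid_plug [::] _ _ _ _) cL G'L) => q qO _.
have sq : size q = size f2.
  move/(congr1 size): qO; rewrite size_map size_out_objs => -> /=.
  by rewrite size_rcons -size_prest.
rewrite /G /G' /pair_last pair_with_cat // pair_with_cat //= -/Z.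
have [->|nz] := pselect (dapps f2 q = 0); first by rewrite !scale0r !scaler0.
by have := dapps_degs d nz => ->; rewrite -map_comp.
Qed.

Lemma sdegs_outer :
  X ++ Sector R :: Sector L :: X' = psectors (pcat p1 (pcons (wnil u)
    (@hl k (dual_quiver A) u v _ (j_dual M p2 (pdeg d p2 + 2))) p3)).
Proof. by rewrite psectors_cat [pinit _]/= psectors_last cat_rcons /= wcat_nil. Qed.

(** When the inner operation is dual-valued, its value is a functional paired
    with an output of the outer disc, so this output is plugged into the inner
    disc: the root is on the disc from which the connecting arrow leaves. *)
Lemma right_term :
  sgn (pdeg d p1) *:
    j_val M (pcat p1 (pcons (wnil u)
      (@hl k (dual_quiver A) u v _ (j_dual M p2 (pdeg d p2 + 2))) p3)) e =
  sgn (chord_exp d (pcat p1 (pcat p2 p3))) *: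
  tlift (pair_last (pfuns p) x y e) (nec_right M M X Y1 R Y L w X').
Proof.
rewrite j_valE.
rewrite -sdegs_outer [pfuns (pcat p1 _)]pfuns_cat [pfuns _]/= cat_rcons.
rewrite -/(dual_arrow M p2 (pdeg d p2 + 2)) -/g -/f3 -/f1.
rewrite /nec_right pfuns_pair -/f3 -/f2 -/f1.
rewrite (linZ _ _ (pair_linear _)) (tlift_map _ _ (pair_linear _)).
pose n := size f3.
pose o1' (s : seq int) := isum (take n s).
pose o2' (s : seq int) := isum (drop n.+1 s).
pose c (s : seq int) : int :=
  koszul [:: (4%N, o1' s); (1%N, s`_n); (5%N, o2' s - (d + 1)); (0%N, wdeg Y1);
             (3%N, isdeg Y); (2%N, wdeg w)] + (d + 1) * (d + 2 + d + 1) +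
  (d + 1) * wdeg Y1 +
  (koszul [:: (1%N, - isum (tdegs p2)); (0%N, o1' s); (2%N, o2' s - (d + 1))] +
   dual_sign).
rewrite [in RHS](eq_tlift (g' := fun o => sgn (c (degs o)) *:
    pair_last (f3 ++ g :: f1) x y e o)); last first.
  have sX : size X = n by exact: size_pinit.
  move=> o; rewrite /= sX.
  have := cat_take_drop n o; case E: (drop n o) => [|b o2].
    rewrite cats0 => oE; rewrite (lin0 (pair_linear _)).
    rewrite [pair_last _ _ _ _ _]pair_with_size ?scaler0 //.
    by rewrite -oE size_take size_cat /= -/n; case: ltnP; lia.
  move=> oE; have so : size (take n o) = n.
    by rewrite size_takel //; move: (size_drop n o); rewrite E /=; lia.
  rewrite !(linZ _ _ (pair_linear _)) right_outputs // oE !scalerA -!sgnD /c.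
  congr (sgn _ *: _).
  have dE : degs o = degs (take n o) ++ out_deg d b :: degs o2.
    by rewrite -{1}oE /degs map_cat.
  have s1 : size (degs (take n o)) = n by rewrite size_map.
  rewrite /o1' /o2' dE nth_cat s1 ltnn subnn /= take_size_cat //.
  rewrite drop_cat s1 ltnNge leqnSn /= subSnn /= drop0 /isum -!outs_degE.
  by rewrite !addrA.
set zs := _ ++ _; pose P := pair_last (f3 ++ g :: f1) x y e.
have PL : multilinear P := @pair_last_multilinear _ _ _ _ _ _.
pose D2 := pdeg d p2.
have gd : tdeg d g = D2 + 1 by rewrite /tdeg /= -/D2; ring.
pose S3 := isum (tdegs p3).
pose Q := isdeg X + wdeg R + wdeg L + isdeg X' + (d + 2) + S3 + (D2 + 1) - (d + 1).
pose kappa := - (d + 1) * isum (tdegs p3 ++ (D2 + 1) :: tdegs p1) +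
  (koszul [:: (4%N, - S3); (1%N, - (D2 + 1)); (5%N, Q); (0%N, wdeg Y1);
             (3%N, isdeg Y); (2%N, wdeg w)] + (d + 1) * (d + 2 + d + 1) +
   (d + 1) * wdeg Y1 +
   (koszul [:: (1%N, - isum (tdegs p2)); (0%N, - S3); (2%N, Q)] + dual_sign)).
rewrite tlift_shift_sgn //.
transitivity (sgn (chord_exp d (pcat p1 (pcat p2 p3))) *: (sgn (koszul
  [:: (0%N, isdeg X); (1%N, wdeg Y1); (0%N, wdeg R); (1%N, isdeg Y);
      (0%N, wdeg L); (1%N, wdeg w); (0%N, isdeg X')]) *:
  (sgn kappa *: tlift P (M zs)))); last first.
  congr (_ *: (_ *: _)); rewrite -tliftZ.
  pose c' (s : seq int) := (d + 1) * isum (take (size s).-1 s) + c s.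
  have vz : valid_type zs by rewrite /zs; case: (X) => [|? []].
  apply: (multi_tlift M (g' := fun o => sgn (c' (degs o)) *: P o) vz) => [||o _ oD].
  - exact: multilinearZ.
  - exact: multilinear_sgn.
  have [Po|/pair_with_supp [o' [b [oE so nz _]]]] := pselect (P o = 0).
    by rewrite Po !scaler0.
  congr (sgn _ *: _); rewrite /c'.
  have dE : degs o = map -%R (tdegs p3) ++ - (D2 + 1) :: rcons (map -%R (tdegs p1)) (out_deg d b).
    rewrite oE /degs map_rcons; have := dapps_degs d nz; rewrite /degs => ->.
    by rewrite map_cat /= gd rcons_cat -!map_comp.
  have sn : size (map -%R (tdegs p3)) = n by rewrite !size_map.
  have dQ : o2' (degs o) - (d + 1) = Q.
    have : isum (degs o) = isdeg zs + (d + 2) by rewrite -oD outs_degE.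
    rewrite /o2' dE drop_cat sn ltnNge leqnSn /= subSnn /= drop0.
    rewrite isum_cat isum_cons isum_opp /zs sectors_deg_cat !sectors_deg_cons /Q -/S3.
    by rewrite /sector_deg /= => e0; rewrite -[isum (rcons _ _)](addKr (- (D2 + 1)))
      -[- (D2 + 1) + _](addKr (- S3)) e0; ring.
  have tE : take (size (degs o)).-1 (degs o) =
      map -%R (tdegs p3) ++ - (D2 + 1) :: map -%R (tdegs p1).
    by rewrite dE -rcons_cons -rcons_cat size_rcons -cats1 take_size_cat.
  rewrite tE /c dQ /kappa.
  rewrite /o1' dE nth_cat sn ltnn subnn (take_size_cat _ sn) isum_opp -/S3 [nth _ _ _]/=.
  by rewrite !isum_cat !isum_cons !isum_opp; congr (_ + _); ring.
rewrite /P !scalerA -!sgnD; congr (_ *: _); apply: sgn_par.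
rewrite !map_cat [map (tdeg d) (g :: f1)]/= gd /chord_exp pfuns_pair sdegs_pair.
rewrite !map_cat /kappa /dual_sign sdegs_inner /Q /S3 !sectors_degE.
apply: right_signs; rewrite ?size_map ?size_pinit //.
- by rewrite /= size_rcons -size_prest.
- by rewrite /pdeg sectors_degE isum_cons.
by rewrite /D2 /pdeg sectors_degE sdegs_inner isum_cons isum_cat isum_cons isum_nil addr0 !addrA.
Qed.

End RightTerm.

(** * The A-valued part of the relation *)

Definition Ainf_sum (k : fieldType) (Q : quiver k) (m : operations Q)
    (x y : obj Q) (w : word x y) (e : int) : Q x y e :=
  \sum_(s <- wsplits w) \sum_(t <- wsplits (projT2 s).2 | ~~ wempty (projT2 t).1)
    sgn (wdeg (projT2 s).1) *:
    m x y (wcat (projT2 s).1 (wcons (op_letter m (projT2 t).1) (projT2 t).2)) e.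

Lemma pempty_splits (k : fieldType) (A : quiver k) (V : zmodType) x z
    (p : @pword k A x z) : pempty p -> forall h : forall u v,
    @pword k A x u -> @pword k A u v -> @pword k A v z -> V,
  \sum_(s <- psplits p) \sum_(t <- psplits (projT2 s).2 | ~~ pempty (projT2 t).1)
    h _ _ (projT2 s).1 (projT2 t).1 (projT2 t).2 = 0.
Proof.
case: p => //= a b w; case: w => //= c _ h.
by rewrite big_seq1 /= big_mkcond big_seq1.
Qed.

Section RelationValue.
Variables (k : fieldType) (A : quiver k) (d : int) (M : precy A d).
Local Notation pword := (@pword k A).
Local Notation word := (@word k A).
Local Notation AA := (mixed_quiver d (A := A) (B := A) id).
Local Notation sdegs p := (map (@sector_deg k A) (psectors p)).
Local Notation tdegs p := (map (tdeg d) (pfuns p)).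

Section Value.
Variables (x y : obj A) (e : int).

(** The contribution to the relation of a decomposition [p1 p2 p3], the inner
    operation being applied to [p2], with its two components. *)
Definition nested u v (p1 : pword x u) (p2 : pword u v) (p3 : pword v y) : A x y e :=
  sgn (pdeg d p1) *:
  (j_val M (pcat p1 (pcons_letter (hl (j_val M p2 (pdeg d p2 + 2))) p3)) e +
   j_val M (pcat p1 (pcons (wnil u)
      (@hl k (dual_quiver A) u v _ (j_dual M p2 (pdeg d p2 + 2))) p3)) e).

(** The diagrams cut out by the chord of a decomposition: one if both ends are
    in the same block, otherwise two, with the root on either side. *)
Definition nec_chord := chord_term
  (fun X a b c f L Y R X' => nec_inner M M (x := a) (u := b) (v := c) (y := f) X L Y R X')
  (fun X a b c Y1 R Y a' b' c' L Ym X' =>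
     nec_left M M (x1 := a) (v := b) (y1 := c) X Y1 R Y (x2 := a') (u := b') (y2 := c') L Ym X' +
     nec_right M M X (x1 := a) (u := b) (y1 := c) Y1 R Y (x2 := a') (v := b') (y2 := c') L Ym X').

Lemma nestedE u v (p1 : pword x u) (p2 : pword u v) (p3 : pword v y) :
  ~~ pempty p2 -> let p := pcat p1 (pcat p2 p3) in
  nested p1 p2 p3 = sgn (chord_exp d p) *:
    tlift (pair_last (pfuns p) x y e) (nec_chord p1 p2 p3).
Proof.
move=> + p; rewrite {}/p; case: p2 p1 p3 => {u v} [u v w|u u' v' v w f p'] p1 p3 vp;
  rewrite /nested scalerDr.
  rewrite [j_dual _ _ _]/= (lin0 (@j_val_fun_linear _ _ _ _ _ _ _ _ p1 p3 e _)).
  by rewrite scaler0 addr0 inner_term.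
rewrite left_term right_term -scalerDr; congr (_ *: _).
by rewrite -(linD _ _ (tlift_linear (@pair_last_multilinear _ _ _ _ _ _))).
Qed.

(** As [chord_exp] and the functionals depend on [p] only, the sum is a linear
    image of the sum of all diagrams, that is of [nec]. *)
Lemma nested_sum (p : pword x y) :
  \sum_(s <- psplits p) \sum_(t <- psplits (projT2 s).2 | ~~ pempty (projT2 t).1)
    nested (projT2 s).1 (projT2 t).1 (projT2 t).2 = 0.
Proof.
have [pe|vp] := boolP (pempty p).
  exact: (pempty_splits pe (fun u v p1 p2 p3 => nested p1 p2 p3)).
pose J (p : pword x y) v0 := sgn (chord_exp d p) *: tlift (pair_last (pfuns p) x y e) v0.
transitivity (\sum_(s <- psplits p)
    \sum_(t <- psplits (projT2 s).2 | ~~ pempty (projT2 t).1)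
    J (pcat (projT2 s).1 (projT2 s).2)
      (nec_chord (projT2 s).1 (projT2 t).1 (projT2 t).2)).
  apply: eq_bigr => s _.
  rewrite big_mkcond [RHS]big_mkcond.
  rewrite -(psplits_sum (projT2 s).2 (fun q t => if ~~ pempty (projT2 t).1 then
    J (pcat (projT2 s).1 q) (nec_chord (projT2 s).1 (projT2 t).1 (projT2 t).2) else 0)).
  by apply: eq_bigr => t _; case: ifP => // vt; rewrite nestedE.
rewrite (psplits_sum p (fun q s =>
  \sum_(t <- psplits (projT2 s).2 | ~~ pempty (projT2 t).1)
    J q (nec_chord (projT2 s).1 (projT2 t).1 (projT2 t).2))) /J.
have JL := tlift_linear (@pair_last_multilinear k A (pfuns p) x y e).
transitivity (sgn (chord_exp d p) *: tlift (pair_last (pfuns p) x y e)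
    (nec M M (psectors p))); last first.
  by rewrite precy_nec ?(lin0 JL) ?scaler0 //; exact: pvalid.
have <- : \sum_(s <- psplits p) \sum_(t <- psplits (projT2 s).2 | ~~ pempty (projT2 t).1)
    nec_chord (projT2 s).1 (projT2 t).1 (projT2 t).2 = nec M M (psectors p).
  exact: chord_picks.
rewrite (linS _ _ _ JL) scaler_sumr; apply: eq_bigr => s _.
by rewrite (linS _ _ _ JL) scaler_sumr.
Qed.

End Value.

Lemma Ainf_sum_val x y (w : @Defs.word k AA x y) e : (Ainf_sum (j_map M) w e).1 = 0.
Proof.
have fstL : linear (fst : AA x y e -> A x y e) by [].
transitivity (\sum_(p <- expand w) \sum_(s <- psplits p)
  \sum_(t <- psplits (projT2 s).2 | ~~ pempty (projT2 t).1)
    nested e (projT2 s).1 (projT2 t).1 (projT2 t).2); last first.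
  by rewrite big1 // => p _; rewrite nested_sum.
rewrite -(expand_splits3 w (fun u v p1 p2 p3 => nested e p1 p2 p3)).
rewrite /Ainf_sum (linS _ _ _ fstL); apply: eq_bigr => s _.
rewrite (linS _ _ _ fstL); apply: eq_bigr => t _.
rewrite [LHS]/= expand_cat scaler_sumr.
rewrite -(expand_inv (projT2 s).1 (fun n _ p1 => \sum_(p2 <- expand (projT2 t).1)
    \sum_(p3 <- expand (projT2 t).2) sgn n *: (
   j_val M (pcat p1 (pcons_letter (hl (j_val M p2 (pdeg d p2 + 2))) p3)) e +
   j_val M (pcat p1 (pcons (@wnil k A (projT1 s))
      (@hl k (dual_quiver A) _ _ _ (j_dual M p2 (pdeg d p2 + 2))) p3)) e))).
apply: eq_bigr => p1 _.
rewrite expand_cons exchange_big /= scaler_sumr; apply: eq_bigr => p3 _.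
rewrite (linS _ _ _ (@j_val_letter_linear _ _ _ M _ _ _ _ p1 p3 e _)).
rewrite (linS _ _ _ (@j_val_fun_linear _ _ _ M _ _ _ _ p1 p3 e _)).
rewrite -big_split scaler_sumr.
exact: (expand_inv (projT2 t).1 (fun n _ p2 => sgn _ *: (
   j_val M (pcat p1 (pcons_letter (hl (j_val M p2 (n + 2))) p3)) e +
   j_val M (pcat p1 (pcons (@wnil k A (projT1 s))
      (@hl k (dual_quiver A) _ _ _ (j_dual M p2 (n + 2))) p3)) e))).
Qed.

End RelationValue.

(** * Cyclicity of a disc *)

Section CyclicSigns.
Variable d : int.
Implicit Types a t : seq int.

Lemma val_exp_cats1 t a b : size t = size a ->
  val_exp d (a ++ [:: b]) t =
  upper_sum t a + isum t * b + d * (size t)%:Z + (upper_sum a a + isum a * b).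
Proof.
move=> s; rewrite /val_exp upper_sum_cats1 // upper_sum_cat // isum_cons isum_nil /=.
by rewrite isum_nil; ring.
Qed.

Lemma upper_sum_last t c b a : size t = size a ->
  upper_sum (t ++ [:: c]) (b :: a) = upper_sum t (b :: a).
Proof.
elim: t a b => [|x t IH] [|y a] b //=; first by rewrite isum_nil mulr0.
by case=> /IH <-.
Qed.

Lemma val_exp_cons t b a : size t = size a ->
  val_exp d (b :: a) t =
  upper_sum t (0 :: a) + d * (size a)%:Z + (b * isum a + upper_sum a a).
Proof. by rewrite /val_exp upper_sum_head => ->. Qed.

(** [D] is the degree of the word, and [P], [q] those of the two letters that
    exchange their roles; the hypothesis [D + q + (d + 2) + P = 0] is the
    condition for the complete pairing to be nonzero. *)
Section Parities.
Variables (t a : seq int) (b w P q D : int).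

Lemma cyclic_parity_aa : size t = (size a).+1 ->
  D = b + isum a + w + isum t -> D + q + (d + 2) + P = 0 ->
  par (D + q + 2 + dual_exp d ((b + q) :: a ++ [:: w]) t w (isum a)) =
  par (P * (D + q) + (D + P + 2 + dual_exp d (b :: a ++ [:: P + w]) t (P + w) (isum a))).
Proof.
move=> s eD e; have {e} -> : P = - (D + q + (d + 2)) by lia.
rewrite {}eD /dual_exp !val_exp_inner // !isum_cons !isum_cat !isum_cons isum_nil.
rewrite s; move: (isum a) (isum t) (upper_sum a a) (upper_sum t _) => *.
rewrite !parE; btauto.
Qed.

Hypothesis st : size t = size a.

Lemma cyclic_parity_af : D = b + isum a + isum t -> D + q + (d + 2) + P = 0 ->
  par (1 + (D + q + 1) * P + (P + 1) + val_exp d ((b + q) :: a) t) =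
  par (P * (D + q) + (D + P + 2 + dual_exp d (b :: a ++ [:: 0]) (t ++ [:: P]) 0 (isum a))).
Proof.
move=> eD e; rewrite /dual_exp val_exp_inner ?size_cat ?st ?addn1 // upper_sum_last //.
rewrite val_exp_cons // !isum_cons !isum_cat !isum_cons isum_nil.
have {e} -> : P = - (D + q + (d + 2)) by lia.
rewrite {}eD -[(size a).+1]addn1 !PoszD.
move: (isum a) (isum t) (upper_sum a a) (upper_sum t _) => *.
rewrite !parE; btauto.
Qed.

Lemma cyclic_parity_fa : D = isum a + w + isum t -> D + q + (d + 2) + P = 0 ->
  par (D + q + 2 + (dual_exp d (0 :: a ++ [:: w]) (q :: t) w (isum a) +
       ((w + P) * isum a + q * isum t))) =
  par (P * (D + q) + (1 + (D + P + 1) * q + (q + 1) + val_exp d (a ++ [:: w + P]) t)).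
Proof.
move=> eD e; rewrite /dual_exp val_exp_inner /= ?st // val_exp_cats1 //.
rewrite !isum_cons !isum_cat !isum_cons isum_nil.
have {e} -> : P = - (D + q + (d + 2)) by lia.
rewrite {}eD -[(size a).+1]addn1 !PoszD ?st.
move: (isum a) (isum t) (upper_sum a a) (upper_sum t _) => *.
rewrite !parE; btauto.
Qed.

Lemma cyclic_parity_ff : D = isum a + w + isum t -> D + q + (d + 2) + P = 0 ->
  par (1 + (D + q + 1) * P + (P + 1) + (val_exp d (0 :: a ++ [:: w]) (q :: t) +
       q * isum (t ++ [:: P]))) =
  par (P * (D + q) + (1 + (D + P + 1) * q + (q + 1) +
       val_exp d ((a ++ [:: w]) ++ [:: 0]) (t ++ [:: P]))).
Proof.
move=> eD e; rewrite val_exp_inner /= ?st // val_exp_cats1 ?size_cat ?st //.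
rewrite !upper_sum_cat //= !isum_cat !isum_cons isum_nil.
have {e} -> : P = - (D + q + (d + 2)) by lia.
rewrite {}eD -[(size a).+1]addn1 !PoszD.
move: (isum a) (isum t) (upper_sum a a) (upper_sum t _) => *.
rewrite !parE; btauto.
Qed.
End Parities.
End CyclicSigns.

Section Cyclic.
Variables (k : fieldType) (A : quiver k) (d : int) (M : precy A d).
Local Notation pword := (@pword k A).
Local Notation word := (@word k A).
Local Notation AA := (mixed_quiver d (A := A) (B := A) id).
Local Notation outs := (outs_deg d).
Local Notation sdegs p := (map (@sector_deg k A) (psectors p)).
Local Notation tdegs p := (map (tdeg d) (pfuns p)).
Local Notation dletter := (@letter k (dual_quiver A)).

Definition full_pairing (fs : seq (arrow (dual_quiver A))) (zs : seq (sector A)) : k :=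
  tlift (dapps fs : _ -> k^o) (M zs).

(** Cyclic invariance moves the first block to the end and the last output to
    the front; the degrees in the sign of [tau_out] are known wherever the
    pairing is nonzero. *)
Lemma full_pairing_rot f fs z zs : valid_type (z :: zs) ->
  full_pairing (f :: fs) (z :: zs) =
  sgn (sector_deg z * sectors_deg zs + tdeg d f * isum (map (tdeg d) fs)) *
  full_pairing (rcons fs f) (rcons zs z).
Proof.
move=> vz; rewrite /full_pairing (precy_cyclic M vz) /tau_out.
have dL fs' := tlift_linear (@dapps_multilinear k A fs').
rewrite (tlift_map _ _ (dL _)).
set n := _ * sectors_deg zs; set T := M _.
rewrite sgnD -mulrA.
pose G o : k^o := sgn (tdeg d f * isum (map (tdeg d) fs)) *: (dapps (rcons fs f) o : k^o).
have GL : multilinear G by exact/multilinearZ/dapps_multilinear.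
have -> : sgn (tdeg d f * isum (map (tdeg d) fs)) * tlift (dapps (rcons fs f)) T =
  tlift G T by rewrite tliftZ.
transitivity (sgn n *: tlift G T); last by [].
rewrite -(linZ (sgn n) T (tlift_linear GL)) /G {GL G}.
apply: (@eq_tlift k A k^o) => o.
rewrite [LHS](linZ _ _ (dL (f :: fs))) tlift_pure; last exact: dapps_multilinear.
case/lastP: o => [|o b]; first by rewrite /= dapps_size ?size_rcons // !scaler0.
rewrite rotr1_rcons.
rewrite dapps_rcons [_ * dapp f b]mulrC /=.
have [->|bz] := pselect (dapp f b = 0); first by rewrite !mul0r !scaler0.
have [->|oz] := pselect (dapps fs o = 0); first by rewrite !mulr0 !scaler0.
congr (sgn _ *: _); rewrite size_rcons /= -cats1 take_size_cat // drop_size_cat //.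
rewrite (dapps_outs d oz) /outs_deg big_seq1 (dapp_deg d bz); ring.
Qed.

Lemma valid_rcons (z : sector A) zs : valid_type (rcons zs z) = valid_type (z :: zs).
Proof. by case: zs => [|? [|? ?]]. Qed.

Lemma full_pairing_supp fs zs : valid_type zs -> full_pairing fs zs <> 0 ->
  sectors_deg zs + (d + 2) = - isum (map (tdeg d) fs).
Proof.
move=> vz nz; apply/eqP/negPn/negP => /eqP ne.
by apply: nz; rewrite /full_pairing closed_supp.
Qed.

Section Pieces.
Variables (x z : obj A) (P : pword x z).
Let w := projT2 (plast P).
Let X := pinit P.

Definition psnoc_letter y (a : letter z y) : pword x y := pcat P (pblock (wcons a (wnil y))).
Definition psnoc_fun (y : obj A) (f : dletter z y) : pword x y :=
  pcat P (pcons (wnil z) f (pblock (@wnil k A y))).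

Lemma psectors_snoc_letter y (a : letter z y) : psectors (psnoc_letter a) =
  Sector (wcat (projT2 (pfirst P)) (wcons a (wnil y))) :: prest P.
Proof. by rewrite psectors_cat. Qed.

Lemma pfuns_snoc_letter y (a : letter z y) : pfuns (psnoc_letter a) = pfuns P.
Proof. by rewrite pfuns_cat. Qed.

Lemma psectors_snoc_fun (y : obj A) (f : dletter z y) :
  psectors (psnoc_fun f) = Sector (wnil y) :: psectors P.
Proof. by rewrite psectors_cat /= wcat_nil. Qed.

Lemma pfuns_snoc_fun (y : obj A) (f : dletter z y) : pfuns (psnoc_fun f) = mk_arrow f :: pfuns P.
Proof. by rewrite pfuns_cat. Qed.

Lemma psectors_pcons_letter y (a : letter y x) :
  psectors (pcons_letter a P) = rcons X (Sector (wcons a w)).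
Proof. by rewrite psectors_last pinit_letter plast_letter. Qed.

End Pieces.

Lemma prest_snoc_fun x z (P : pword x z) (y : obj A) (f : dletter z y) :
  prest (psnoc_fun P f) = psectors P /\ pfirst (psnoc_fun P f) = existT _ y (@wnil k A y).
Proof.
elim: P y f => {x z} [a c w|a u v c w f0 p' IH] y f.
  by split=> //; rewrite /psnoc_fun /= wcat_nil.
have [E1 E2] := IH y f; split; last exact: E2.
by rewrite /psnoc_fun /= -/(psnoc_fun p' f) E1 psectors_pcons.
Qed.

Lemma pfirst_snoc_letter x z y (P : pword x z) (a : letter z y) :
  pfirst (psnoc_letter P a) = existT _ (projT1 (pfirst P))
    (wcat (projT2 (pfirst P)) (wcons a (@wnil k A y))).
Proof. by elim: P y a. Qed.

Lemma prest_snoc_letter x z y (P : pword x z) (a : letter z y) :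
  prest (psnoc_letter P a) = prest P.
Proof.
elim: P y a => {x z} // a1 a2 a3 a4 w1 f1 p1 IH y a.
by rewrite /psnoc_letter /= -/(psnoc_letter p1 a) IH.
Qed.

Lemma dapp_dual_snoc x z (P : pword x z) (y : obj A) (f : dletter z y) i (b : A y x i) :
  let Q := psnoc_fun P f in let w := projT2 (plast P) in
  dapp (dual_arrow M Q (pdeg d Q + 2)) (mk_arrow (hl b)) =
  sgn (dual_exp d (sdegs Q) (tdegs Q) (wdeg w) (sectors_deg (pinit P))) *
  full_pairing (mk_arrow f :: pfuns P) (Sector (wcons (hl b) w) :: pinit P).
Proof.
move=> Q w; rewrite -pfuns_snoc_fun {}/w {}/Q.
case: P f b => [a c w|a u v c w f0 p'] f b.
  by rewrite /psnoc_fun /= wcat_nil dapp_dual_arrow plugE.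
rewrite /psnoc_fun [pcat _ _]/= -/(psnoc_fun p' f) dapp_dual_arrow plugE.
have [-> ->] := prest_snoc_fun p' f.
by [].
Qed.

(** The contributions of the dual-valued and of the [A]-valued part of the
    operation at [P] to the pairing of its value with the letter [b + g], with
    the signs of the natural form. *)
Definition dual_part x z (P : pword x z) (b : arrow A) : k :=
  sgn (pdeg d P + 2) * dapp (dual_arrow M P (pdeg d P + 2)) b.

Definition val_part x z (P : pword x z) (g : arrow (dual_quiver A)) : k :=
  - (sgn ((pdeg d P + 1) * tdeg d g) * (sgn (tdeg d g + 1) *
     dapp g (val_arrow M P (pdeg d P + 2)))).

Lemma dual_part_block x z (w : word x z) (b : arrow A) : dual_part (pblock w) b = 0.
Proof. by rewrite /dual_part /dual_arrow [j_dual _ _ _]/= /dapp /dual_fun mulr0. Qed.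

Lemma val_partE x z (P : pword x z) g : ~~ pempty P ->
  val_part P g = sgn (1 + (pdeg d P + 1) * tdeg d g + (tdeg d g + 1) +
    val_exp d (sdegs P) (tdegs P)) * full_pairing (rcons (pfuns P) g) (psectors P).
Proof.
move=> vp; rewrite /val_part dapp_val_arrow // !mulrA -mulNr -!sgnD; congr (_ * _).
by rewrite -mulN1r -[-1]/(sgn 1) -sgnD; congr sgn; ring.
Qed.

Section Exchange.
Variables (x z y : obj A) (P : pword x z).

Lemma pdeg_snoc_letter i (a : A z y i) : pdeg d (psnoc_letter P (hl a)) = pdeg d P + sdeg (hl a).
Proof.
rewrite /pdeg psectors_snoc_letter pfuns_snoc_letter /psectors !sectors_deg_cons.
by rewrite /sector_deg /= wdeg_cat /=; ring.
Qed.

Lemma pdeg_snoc_fun (f : dletter z y) :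
  pdeg d (psnoc_fun P f) = pdeg d P + tdeg d (mk_arrow f).
Proof.
rewrite /pdeg psectors_snoc_fun pfuns_snoc_fun !sectors_deg_cons /= isum_cons.
by rewrite /sector_deg /=; ring.
Qed.

Lemma pempty_snoc_letter i (a : A z y i) : pempty (psnoc_letter P (hl a)) = false.
Proof. by rewrite /psnoc_letter; case: P a => //= *; rewrite wempty_cat_cons. Qed.

Lemma pempty_snoc_fun (f : dletter z y) : pempty (psnoc_fun P f) = false.
Proof. by rewrite /psnoc_fun; case: P f. Qed.

End Exchange.

Lemma pdeg_first x z (P : pword x z) : pdeg d P =
  wdeg (projT2 (pfirst P)) + isum (map (@sector_deg k A) (prest P)) + isum (tdegs P).
Proof. by rewrite /pdeg sectors_degE isum_cons. Qed.

Lemma pdeg_last x z (P : pword x z) : pdeg d P =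
  isum (map (@sector_deg k A) (pinit P)) + wdeg (projT2 (plast P)) + isum (tdegs P).
Proof. by rewrite /pdeg psectors_last sectors_deg_rcons sectors_degE. Qed.

Section ExchangeParts.
Variables (x z y : obj A).

(** In each case, both sides are, up to sign, one complete pairing of a disc.
    Here, and in [exchange_af], the labellings of the disc agree; in the other
    two, [f] is the first functional on the left and the last one on the right,
    and [full_pairing_rot] matches the labellings. *)
Lemma exchange_aa (P : pword x z) i (a : A z y i) j (b : A y x j) :
  let sa := sdeg (hl a) in let sb := sdeg (hl b) in
  dual_part (psnoc_letter P (hl a)) (mk_arrow (hl b)) =
  sgn (sb * (pdeg d P + sa)) * dual_part (pcons_letter (hl b) P) (mk_arrow (hl a)).
Proof.
case: P a b => [x' z' w|x' u v z' w f p'] a b sa sb.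
  by rewrite !dual_part_block mulr0.
pose Q := psnoc_letter p' (hl a).
have fE : pfirst Q = existT _ (projT1 (pfirst p'))
    (wcat (projT2 (pfirst p')) (wcons (hl a) (@wnil k A y))) := pfirst_snoc_letter _ _.
have rE : prest Q = prest p' := prest_snoc_letter _ _.
have qE : pfuns Q = pfuns p' by rewrite /Q pfuns_snoc_letter.
have -> : psnoc_letter (pcons w f p') (hl a) = pcons w f Q by [].
have -> : pcons_letter (hl b) (pcons w f p') = pcons (wcons (hl b) w) f p' by [].
rewrite /dual_part !dapp_dual_arrow !plugE !pdeg_pcons rE fE /=.
rewrite rE fE qE -wcatA [wcat (wcons _ _) _]/= -[tlift _ _]/(full_pairing _ _).
set K := full_pairing _ _; have [->|nz] := pselect (K = 0); first by rewrite !mulr0.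
have := full_pairing_supp (valid_closed _ _ _ _) nz; rewrite {nz}/K.
rewrite sectors_deg_cons sectors_degE /sector_deg [sword _]/= !wdeg_cat.
rewrite [wdeg (wcons _ (wcons _ _))]/=.
rewrite !mulrA -!sgnD -/sa -/sb => e; congr (_ * _); apply: sgn_par.
have := @cyclic_parity_aa d (rcons (tdegs p') (tdeg d (mk_arrow f)))
  (map (@sector_deg k A) (prest p')) (wdeg (projT2 (pfirst p'))) (wdeg w) sb sa
  (wdeg w + tdeg d (mk_arrow f) + pdeg d p').
rewrite size_rcons !size_map size_prest isum_rcons => E.
refine (etrans _ (etrans (E erefl _ _) _)) => {E}.
- rewrite pdeg_snoc_letter !map_rcons !cats1 /=.
  by congr (par (_ + dual_exp _ (_ :: _) _ _ _)); rewrite ?addr0 // -/sa; ring.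
- by rewrite pdeg_first; ring.
- move: e; rewrite map_rcons isum_rcons pdeg_first /= -/sa -/sb /sector_deg; lia.
by rewrite !map_rcons !cats1 /=; congr par; rewrite -!addrA; congr (_ + _); ring.
Qed.

Lemma exchange_af (P : pword x z) i (a : A z y i) (g : dletter y x) :
  let sg := tdeg d (mk_arrow g) in let sa := sdeg (hl a) in
  val_part (psnoc_letter P (hl a)) (mk_arrow g) =
  sgn (sg * (pdeg d P + sa)) * dual_part (pcons (wnil y) g P) (mk_arrow (hl a)).
Proof.
move=> sg sa; rewrite val_partE ?pempty_snoc_letter // /dual_part dapp_dual_arrow plugE.
rewrite psectors_snoc_letter pfuns_snoc_letter pdeg_snoc_letter pdeg_pcons -/sa -/sg.
rewrite -[tlift _ _]/(full_pairing _ _) /=.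
set K := full_pairing _ _; have [->|nz] := pselect (K = 0); first by rewrite !mulr0.
have := full_pairing_supp (valid_closed _ _ _ _) nz; rewrite {nz}/K map_rcons isum_rcons.
rewrite sectors_deg_cons sectors_degE /sector_deg /= wdeg_cat [wdeg (wcons _ _)]/= -/sa -/sg.
rewrite !mulrA -!sgnD => e; congr (_ * _); apply: sgn_par.
have := @cyclic_parity_af d (tdegs P) (map (@sector_deg k A) (prest P))
  (wdeg (projT2 (pfirst P))) sg sa (pdeg d P).
rewrite !size_map size_prest => E.
refine (etrans _ (etrans (E erefl (pdeg_first _) _) _)) => {E}.
- by rewrite addr0.
- move: e; rewrite pdeg_first /sector_deg; lia.
by rewrite map_rcons !cats1 add0r [sg + _]addrC -!addrA.
Qed.

Lemma exchange_fa (P : pword x z) (f : dletter z y) j (b : A y x j) :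
  let sf := tdeg d (mk_arrow f) in let sb := sdeg (hl b) in
  dual_part (psnoc_fun P f) (mk_arrow (hl b)) =
  sgn (sb * (pdeg d P + sf)) * val_part (pcons_letter (hl b) P) (mk_arrow f).
Proof.
move=> sf sb; rewrite val_partE ?pempty_letter // /dual_part dapp_dual_snoc.
rewrite full_pairing_rot; last by case: (pinit P).
rewrite psectors_snoc_fun pfuns_snoc_fun pdeg_snoc_fun pdeg_letter pfuns_letter.
rewrite psectors_pcons_letter -/sf -/sb.
set K := full_pairing _ _; have [->|nz] := pselect (K = 0); first by rewrite !mulr0.
have vz : valid_type (rcons (pinit P) (Sector (wcons (hl b) (projT2 (plast P))))).
  by rewrite valid_rcons; case: (pinit P).
have := full_pairing_supp vz nz; rewrite {nz vz}/K map_rcons isum_rcons.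
rewrite sectors_deg_rcons sectors_degE psectors_last !map_rcons !mulrA -!sgnD => e.
congr (_ * _); apply: sgn_par.
have := @cyclic_parity_fa d (tdegs P) (map (@sector_deg k A) (pinit P))
  (wdeg (projT2 (plast P))) sb sf (pdeg d P).
rewrite !size_map size_pinit => E.
refine (etrans _ (etrans (E erefl (pdeg_last _) _) _)) => {E}.
- rewrite /= map_rcons -cats1 -[LHS]/(par (_ + _ + _)) -[in LHS]addrA.
  congr (par (_ + (_ + (_ * _ + _)))).
  by rewrite /sector_deg /= -/sb addrC.
- move: e; rewrite pdeg_last [sector_deg (Sector (wcons _ _))]/sector_deg /= -/sf -/sb; lia.
have <- : sector_deg (Sector (wcons (hl b) (projT2 (plast P)))) = wdeg (projT2 (plast P)) + sb.
  by rewrite addrC.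
by rewrite -cats1 [sb + pdeg _ _]addrC !addrA.
Qed.

Lemma exchange_ff (P : pword x z) (f : dletter z y) (g : dletter y x) :
  let sf := tdeg d (mk_arrow f) in let sg := tdeg d (mk_arrow g) in
  val_part (psnoc_fun P f) (mk_arrow g) =
  sgn (sg * (pdeg d P + sf)) * val_part (pcons (wnil y) g P) (mk_arrow f).
Proof.
move=> sf sg; rewrite !val_partE ?pempty_snoc_fun //.
rewrite psectors_snoc_fun pfuns_snoc_fun rcons_cons full_pairing_rot; last first.
  by rewrite psectors_last; case: (pinit P).
rewrite psectors_pcons pdeg_pcons pdeg_snoc_fun -/sf -/sg.
set K := full_pairing _ _; have [->|nz] := pselect (K = 0); first by rewrite !mulr0.
have vz : valid_type (rcons (psectors P) (Sector (@wnil k A y))) by rewrite valid_rcons.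
have := full_pairing_supp vz nz; rewrite {nz vz}/K !map_rcons !isum_rcons.
rewrite sectors_deg_rcons !sectors_degE psectors_last !map_rcons !mulrA -!sgnD => e.
congr (_ * _); apply: sgn_par.
have := @cyclic_parity_ff d (tdegs P) (map (@sector_deg k A) (pinit P))
  (wdeg (projT2 (plast P))) sg sf (pdeg d P).
rewrite !size_map size_pinit => E.
refine (etrans _ (etrans (E erefl (pdeg_last _) _) _)) => {E}.
- rewrite /= map_rcons -!cats1 [isum (tdegs P ++ _)]isum_cat isum_cons isum_nil addr0.
  have -> : sector_deg (Sector (@wnil k A y)) = 0 by [].
  by rewrite mul0r add0r -!addrA.
- move: e; rewrite pdeg_last isum_rcons /sector_deg /= -/sf -/sg; lia.
by rewrite -!cats1 [wdeg (wnil _)]/= add0r [sg + pdeg _ _]addrC -!addrA.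
Qed.

End ExchangeParts.
End Cyclic.

(** * Cyclicity of the relation *)

Section Rotation.
Variables (k : fieldType) (Q : quiver k).
Variable psi : forall x y, @word k Q x y -> forall j, Q y x j -> k.
Hypothesis psi_rot : forall x y z (w : word x y) i (q : Q y z i) j (p : Q z x j),
  psi (wcat w (wcons (hl q) (wnil z))) p =
  sgn (sdeg (hl p) * (wdeg w + sdeg (hl q))) * psi (wcons (hl p) w) q.

(** Rotating the letters of [w1] one at a time brings [c] to the last place. *)
Lemma rotate x u v y (w1 : word x u) i (c : Q u v i) (w2 : word v y) j (b : Q y x j) :
  psi (wcat w1 (wcons (hl c) w2)) b =
  sgn ((wdeg w1 + sdeg (hl c)) * (wdeg w2 + sdeg (hl b))) *
  psi (wcat w2 (wcons (hl b) w1)) c.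
Proof.
elim: w1 v c y w2 j b => {x u} [x|x t u [l p] w1 IH] v c y w2 j b /=.
  by rewrite psi_rot mulrA -sgnD add0r sgnD sgnK mul1r.
have := psi_rot (wcat w1 (wcons (hl c) w2)) b p.
rewrite -wcatA [wcat (wcons _ _) _]/= IH => E.
have -> : psi (wcons (existT _ l p) (wcat w1 (wcons (hl c) w2))) b =
  sgn (sdeg (hl p) * (wdeg (wcat w1 (wcons (hl c) w2)) + sdeg (hl b))) *
  (sgn (sdeg (hl p) * (wdeg (wcat w1 (wcons (hl c) w2)) + sdeg (hl b))) *
   psi (wcons (hl p) (wcat w1 (wcons (hl c) w2))) b).
  by rewrite mulrA sgnK mul1r.
rewrite -E -wcatA /= mulrA -sgnD; congr (_ * _); apply: sgn_par.
rewrite ?wdeg_cat /= ?wdeg_cat /=.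
rewrite -[sdeg (existT _ l p)]/(sdeg (hl p)).
move: (sdeg (hl p)) (sdeg (hl c)) (sdeg (hl b)) (wdeg w1) (wdeg w2) => *.
rewrite !parE; btauto.
Qed.

End Rotation.

Section CyclicRelation.
Variables (k : fieldType) (Q : quiver k) (m : operations Q).
Variable G : forall x y i j, Q x y i -> Q y x j -> k^o.
Hypothesis G_linear : forall x y i j (q : Q y x j), linear (fun p : Q x y i => G p q).
Hypothesis G_sym : forall x y i j (p : Q x y i) (q : Q y x j),
  G p q = - (sgn (sdeg (hl p) * sdeg (hl q)) * G q p).
Hypothesis G_cyclic : forall x y z (w : word x y) i (q : Q y z i) j (p : Q z x j),
  G (tagged (op_letter m (wcat w (wcons (hl q) (wnil z))))) p =
  sgn (sdeg (hl p) * (wdeg w + sdeg (hl q))) *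
  G (tagged (op_letter m (wcons (hl p) w))) q.

Local Notation psi w p := (G (tagged (op_letter m w)) p).

Lemma Ainf_sum_form x y (w : word x y) j (p : Q y x j) :
  G (Ainf_sum m w (wdeg w + 3)) p =
  \sum_(s <- wsplits w) \sum_(t <- wsplits (projT2 s).2 | ~~ wempty (projT2 t).1)
    sgn (wdeg (projT2 s).1) *
    psi (wcat (projT2 s).1 (wcons (op_letter m (projT2 t).1) (projT2 t).2)) p.
Proof.
rewrite /Ainf_sum (linS _ _ _ (@G_linear _ _ _ _ p)).
rewrite -(wsplits_sum w (fun w s => G (\sum_(t <- wsplits (projT2 s).2 | ~~ wempty (projT2 t).1)
    sgn (wdeg (projT2 s).1) *: m (wcat (projT2 s).1
      (wcons (op_letter m (projT2 t).1) (projT2 t).2)) (wdeg w + 3)) p)).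
apply: eq_bigr => s _; rewrite (linS _ _ _ (@G_linear _ _ _ _ p)).
rewrite big_mkcond [RHS]big_mkcond.
rewrite -(wsplits_sum (projT2 s).2 (fun w t => if ~~ wempty (projT2 t).1 then
  G (sgn (wdeg (projT2 s).1) *: m (wcat (projT2 s).1
      (wcons (op_letter m (projT2 t).1) (projT2 t).2)) (wdeg (wcat (projT2 s).1 w) + 3)) p
  else 0)).
apply: eq_bigr => t _; case: ifP => // _; rewrite (linZ _ _ (@G_linear _ _ _ _ p)).
congr (_ * _); set W := wcat (projT2 s).1 (wcons _ _).
rewrite (_ : wdeg _ + 3 = wdeg W + 2) // /W !wdeg_cat /= /sdeg /=; ring.
Qed.

(** If the inner operation involves none of the letters [p] and [q] that
    exchange their roles, this is cyclicity of the outer one. If it involves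
    [q] on one side, it is a suffix of the word, and the composite with [p] is
    [G] evaluated on two values of the operation; by symmetry of [G] they
    can be exchanged, so that the inner one is now the one involving [p]. *)
Lemma Ainf_sum_cyclic x y z (w : word x y) i (q : Q y z i) j (p : Q z x j) :
  let wq := wcat w (wcons (hl q) (wnil z)) in let pw := wcons (hl p) w in
  G (Ainf_sum m wq (wdeg wq + 3)) p =
  sgn (sdeg (hl p) * (wdeg w + sdeg (hl q))) * G (Ainf_sum m pw (wdeg pw + 3)) q.
Proof.
move=> wq pw; rewrite !Ainf_sum_form.
rewrite (wsplits_snoc w (hl q) (fun u s1 s2 =>
  \sum_(t <- wsplits s2 | ~~ wempty (projT2 t).1)
    sgn (wdeg s1) * psi (wcat s1 (wcons (op_letter m (projT2 t).1) (projT2 t).2)) p)).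
rewrite [X in _ + X]big_mkcond [wsplits (wnil z)]/= big_seq1 /= addr0.
pose c (w : word x y) := sgn (sdeg (hl p) * (wdeg w + sdeg (hl q))) : k.
pose inner (s : {v : obj Q & word x v * word v y}%type) :=
  psi (wcons (op_letter m (wcons (hl p) (projT2 s).1)) (projT2 s).2) q +
  \sum_(t <- wsplits (projT2 s).2 | ~~ wempty (projT2 t).1)
    sgn (wdeg (wcons (hl p) (projT2 s).1)) * psi (wcons (hl p) (wcat (projT2 s).1
      (wcons (op_letter m (projT2 t).1) (projT2 t).2))) q.
transitivity (\sum_(s <- wsplits w) c w * inner s); last first.
  rewrite -mulr_sumr /c; congr (_ * _); rewrite big_split /= big_cons; congr (_ + _).
    rewrite [RHS]big_mkcond big_cons /= add0r big_map; apply: eq_bigr => s _ /=.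
    by rewrite sgn0 mul1r.
  by rewrite big_map.
rewrite -(wsplits_sum w (fun w s => c w * inner s)); apply: eq_bigr => -[v [w1 w2]] _ /=.
rewrite big_mkcond (wsplits_snoc w2 (hl q) (fun u t1 t2 => if ~~ wempty t1 then
  sgn (wdeg w1) * psi (wcat w1 (wcons (op_letter m t1) t2)) p else 0)).
rewrite wempty_cat_cons /= mulrDr addrC; congr (_ + _).
  (* The inner operation involves [q] on the left, [p] on the right. *)
  have -> : psi (wcat w1 (wcons (op_letter m (wcat w2 (wcons (hl q) (wnil z)))) (wnil z))) p =
     sgn (sdeg (hl p) * (wdeg w1 + sdeg (op_letter m (wcat w2 (wcons (hl q) (wnil z)))))) *
     G (tagged (op_letter m (wcons (hl p) w1)))
       (tagged (op_letter m (wcat w2 (wcons (hl q) (wnil z))))).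
    exact: G_cyclic.
  rewrite G_sym.
  have -> : psi (wcat w2 (wcons (hl q) (wnil z))) (tagged (op_letter m (wcons (hl p) w1))) =
     sgn (sdeg (op_letter m (wcons (hl p) w1)) * (wdeg w2 + sdeg (hl q))) *
     psi (wcons (op_letter m (wcons (hl p) w1)) w2) q.
    exact: G_cyclic.
  rewrite -mulN1r -[-1]/(sgn 1) !mulrA -!sgnD; congr (_ * _); apply: sgn_par.
  rewrite /sdeg /= !wdeg_cat /= /sdeg /=.
  move: (wdeg w1) (wdeg w2) => *; rewrite !parE; btauto.
(* The inner operation involves neither letter. *)
rewrite mulr_sumr [RHS]big_mkcond.
rewrite -[RHS](wsplits_sum w2 (fun w' t => if ~~ wempty (projT2 t).1 then
  c (wcat w1 w') * (sgn (wdeg (wcons (hl p) w1)) * psi (wcons (hl p) (wcat w1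
      (wcons (op_letter m (projT2 t).1) (projT2 t).2))) q) else 0)).
apply: eq_bigr => -[u [t1 t2]] _ /=; case: ifP => // _.
have -> : psi (wcat w1 (wcons (op_letter m t1) (wcat t2 (wcons (hl q) (wnil z))))) p =
  psi (wcat (wcat w1 (wcons (op_letter m t1) t2)) (wcons (hl q) (wnil z))) p.
  by rewrite -wcatA.
rewrite G_cyclic !mulrA /c -!sgnD; congr (_ * _); apply: sgn_par.
rewrite !wdeg_cat /= /sdeg /=.
move: (wdeg w1) (wdeg t1) (wdeg t2) => *; rewrite !parE; btauto.
Qed.

End CyclicRelation.

(** * The natural form and the cyclicity of the operation *)

Section SelfForm.
Variables (k : fieldType) (A : quiver k) (d : int).
Local Notation AA := (mixed_quiver d (A := A) (B := A) id).

Definition farrow (x y : obj A) i (p : AA x y i) : arrow (dual_quiver A) :=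
  @mk_arrow k (dual_quiver A) x y (@hl k (dual_quiver A) x y (d - 1 + i) p.2).
Definition aarrow (x y : obj A) i (p : AA x y i) : arrow A :=
  @mk_arrow k A x y (@hl k A x y i p.1).

(** The form [Gamma] of the identity morphism, written with [dapp] so that it
    applies directly to the summands of the operation. *)
Definition self_form (x y : obj AA) i j (p : AA x y i) (q : AA y x j) : k^o :=
  sgn ((i - 1) + 1) * dapp (farrow p) (aarrow q)
  - sgn ((i - 1) * (j - 1)) * (sgn ((j - 1) + 1) * dapp (farrow q) (aarrow p)).

Lemma dapp_aarrow_linear g x y i : linear (fun p : AA x y i => dapp g (aarrow p)).
Proof. by move=> c p q; rewrite /aarrow /= dapp_linear. Qed.

Lemma dapp_farrow_linear x y i b : linear (fun p : AA x y i => dapp (farrow p) b : k^o).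
Proof. by []. Qed.

Lemma self_form_linear x y i j (q : AA y x j) :
  linear (fun p : AA x y i => self_form p q).
Proof.
move=> c p p'; rewrite /self_form dapp_aarrow_linear dapp_farrow_linear.
exact: mixed_form_aux.
Qed.

Lemma self_form_linearr x y i j (p : AA x y i) :
  linear (fun q : AA y x j => self_form p q).
Proof.
move=> c q q'; rewrite /self_form dapp_aarrow_linear dapp_farrow_linear.
exact: mixed_form_aux.
Qed.

Lemma self_form_sym x y i j (p : AA x y i) (q : AA y x j) :
  self_form p q = - (sgn (sdeg (hl p) * sdeg (hl q)) * self_form q p).
Proof.
rewrite /self_form /sdeg /= [(j - 1) * (i - 1)]mulrC.
set s := sgn ((i - 1) * (j - 1)); set X := dapp _ _; set Y := dapp _ _.
have ss : s * s = 1 :> k by exact: sgnK.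
transitivity (s * s * (sgn (i - 1 + 1) * X) - s * (sgn (j - 1 + 1) * Y) : k).
  by rewrite ss mul1r.
by rewrite mulrBr opprB !mulrA.
Qed.

(** Lets the dual-valued parts of the operation and of the relation be studied
    through the form, hence by rotation. *)
Lemma dual_of_form x y i (p : AA x y i) (b : A y x (- (d - 1 + i))) :
  dual_fun p.2 b = sgn i * self_form p ((b, 0) : AA y x (- (d - 1 + i))).
Proof.
rewrite /self_form [X in _ - _ * (_ * X)](lin0 (@dapp_farrow_linear _ _ _ _)) ?mulr0 ?subr0.
rewrite mulrA -sgnD (_ : sgn _ = 1) ?mul1r; last first.
  by apply: (@sgn_par k _ 0); rewrite !parE; btauto.
by rewrite /dapp /aarrow /= arrow_compK.
Qed.

Lemma dual_eq0 x y i (p : AA x y i) :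
  (forall b : A y x (- (d - 1 + i)), self_form p ((b, 0) : AA y x _) = 0) -> p.2 = 0.
Proof. by move=> p0; apply: dual_ext => b; rewrite dual_of_form p0 mulr0. Qed.

Section Sm.
Variable M : precy A d.
Local Notation m := (j_map M).
Local Notation pword := (@pword k A).

Lemma self_form_sm x z (w : word x z) j (q : AA z x j) :
  self_form (tagged (op_letter m w)) q =
  \sum_(P <- expand w) (dual_part M P (aarrow q) + val_part M P (farrow q)).
Proof.
have tq : tdeg d (farrow q) = j - 1 by rewrite /tdeg /=; ring.
have dL : linear (fun u : dual_quiver A x z (d - 1 + (wdeg w + 2)) =>
  dapp (@mk_arrow k (dual_quiver A) x z (@hl k (dual_quiver A) x z _ u)) (aarrow q) : k^o) by [].
have vL : linear (fun a : A x z (wdeg w + 2) => dapp (farrow q) (mk_arrow (hl a))).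
  exact: dapp_linear.
rewrite /self_form {1}/farrow {2}/aarrow /=.
rewrite (linS _ _ _ dL) (linS _ _ _ vL) !mulr_sumr -sumrB.
rewrite -(expand_inv w (fun n _ P => sgn (n + 2) * dapp (dual_arrow M P (n + 2)) (aarrow q) -
  (sgn ((n + 1) * tdeg d (farrow q)) * (sgn (tdeg d (farrow q) + 1) *
     dapp (farrow q) (val_arrow M P (n + 2)))) : k)).
apply: eq_bigr => P _; rewrite tq.
have -> : wdeg w + 2 - 1 + 1 = wdeg w + 2 by ring.
by have -> : wdeg w + 2 - 1 = wdeg w + 1 by ring.
Qed.

Lemma j_map_cyclic x y z (w : word x y) i (q : AA y z i) j (p : AA z x j) :
  self_form (tagged (op_letter m (wcat w (wcons (hl q) (wnil z))))) p =
  sgn (sdeg (hl p) * (wdeg w + sdeg (hl q))) *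
  self_form (tagged (op_letter m (wcons (hl p) w))) q.
Proof.
rewrite !self_form_sm expand_cat expand_cons mulr_sumr.
have tp : tdeg d (farrow p) = sdeg (hl p) by rewrite /tdeg /sdeg /=; ring.
have tq : tdeg d (farrow q) = sdeg (hl q) by rewrite /tdeg /sdeg /=; ring.
rewrite [RHS](expand_inv w (fun n _ P => sgn (sdeg (hl p) * (n + sdeg (hl q))) *
  (dual_part M (pcons_letter (@hl k A z x j p.1) P) (aarrow q) +
   val_part M (pcons_letter (@hl k A z x j p.1) P) (farrow q) +
  (dual_part M (pcons (@wnil k A z) (@hl k (dual_quiver A) z x (d - 1 + j) p.2) P) (aarrow q) +
   val_part M (pcons (@wnil k A z) (@hl k (dual_quiver A) z x (d - 1 + j) p.2) P) (farrow q))))).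
apply: eq_bigr => P _; rewrite expand_cons [expand (wnil _)]/= big_seq1.
rewrite -/(psnoc_letter P _) -/(psnoc_fun P _).
have := @exchange_aa _ _ _ M _ _ _ P i q.1 j p.1; rewrite /= => ->.
have := @exchange_af _ _ _ M _ _ _ P i q.1 (@hl k (dual_quiver A) z x (d - 1 + j) p.2).
rewrite -/(farrow p) tp /= => ->.
have := @exchange_fa _ _ _ M _ _ _ P (@hl k (dual_quiver A) y z (d - 1 + i) q.2) j p.1.
rewrite -/(farrow q) tq /= => ->.
have := @exchange_ff _ _ _ M _ _ _ P (@hl k (dual_quiver A) y z (d - 1 + i) q.2)
  (@hl k (dual_quiver A) z x (d - 1 + j) p.2).
rewrite -/(farrow q) -/(farrow p) tp tq /= => ->.
rewrite /sdeg /= -!mulrDr; congr (_ * _).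
by rewrite addrACA [X in _ + X]addrC addrACA.
Qed.

End Sm.
End SelfForm.

(** * The A-infinity structure of a pre-Calabi-Yau category *)

Section AinfJ.
Variables (k : fieldType) (A : quiver k) (d : int) (M : precy A d).
Local Notation AA := (mixed_quiver d (A := A) (B := A) id).
Local Notation m := (j_map M).

Lemma pair_ext (S T : Type) (p q : S * T) : p.1 = q.1 -> p.2 = q.2 -> p = q.
Proof. by case: p q => [a b] [c e] /= -> ->. Qed.

Lemma j_map_deg x y (w : @word k AA x y) e :
  ~~ wempty w -> e <> wdeg w + 2 -> m w e = 0.
Proof.
move=> w0 /eqP we; apply: pair_ext => /=.
  transitivity (\sum_(p <- expand w)
      if ~~ wempty w && (e != wdeg w + 2) then j_val M p e else 0).
    by rewrite w0 we.
  rewrite (expand_inv w (fun n b p => if ~~ b && (e != n + 2) then j_val M p e else 0)).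
  rewrite big1 // => p _; case: ifP => // /andP [p0 /eqP pe].
  exact: j_val_deg.
transitivity (\sum_(p <- expand w) if e != wdeg w + 2 then j_dual M p e else 0).
  by rewrite we.
rewrite (expand_inv w (fun n _ p => if e != n + 2 then j_dual M p e else 0)).
rewrite big1 // => p _; case: ifP => // /eqP.
by case: p => // *; apply: j_dual_deg.
Qed.

Lemma op_letterE x y (w : @word k AA x y) e j (p : AA y x j) : e = wdeg w + 2 ->
  self_form (m w e) p = self_form (tagged (op_letter m w)) p.
Proof. by move=> ->. Qed.

(** The [A]-valued part is linear in each letter by inspection. For the other
    part, the letter is rotated out of the word, and the form is linear. *)
Lemma j_map_linear x y e : word_multilinear (fun w : @word k AA x y => m w e).
Proof.
move=> u v i l r c a b; apply: pair_ext => /=.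
  rewrite !expand_cat.
  transitivity (\sum_(p1 <- expand l) \sum_(p3 <- expand r)
     (j_val M (pcat p1 (pcons_letter (@hl k A u v i (c *: a + b).1) p3)) e +
      j_val M (pcat p1 (pcons (@wnil k A u)
        (@hl k (dual_quiver A) u v (d - 1 + i) (c *: a + b).2) p3)) e)).
    by apply: eq_bigr => p1 _; rewrite expand_cons.
  rewrite scaler_sumr -big_split; apply: eq_bigr => p1 _.
  rewrite !expand_cons scaler_sumr -big_split; apply: eq_bigr => p3 _.
  rewrite [(_ + _).1]/= [(_ + _).2]/= j_val_letter_linear j_val_fun_linear.
  by rewrite scalerDr addrACA.
set W := fun q : AA u v i => wcat l (wcons (hl q) r).
have dW q : wdeg (W q) = wdeg (W 0) by rewrite /W !wdeg_cat /= /sdeg.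
have [eW|/eqP eW] := eqVneq e (wdeg (W 0) + 2); last first.
  have z q : \sum_(p <- expand (W q)) j_dual M p e = 0.
    have := @j_map_deg _ _ (W q) e; rewrite dW /W wempty_cat_cons => /(_ isT eW).
    by case.
  by rewrite !z scaler0 addr0.
apply: dual_ext => b'.
have E q : dual_fun (m (W q) e).2 b' = sgn e * (sgn ((wdeg l + sdeg (hl q)) *
    (wdeg r + sdeg (@hl k AA _ _ _ ((b', 0) : AA y x (- (d - 1 + e)))))) *
    self_form (tagged (op_letter m
      (wcat r (wcons (@hl k AA _ _ _ ((b', 0) : AA y x (- (d - 1 + e)))) l)))) q).
  rewrite dual_of_form op_letterE ?dW //; congr (_ * _).
  exact: (@rotate k AA (fun x y w j p => self_form (tagged (op_letter m w)) p)
            (@j_map_cyclic k A d M)).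
transitivity (dual_fun (m (W (c *: a + b)) e).2 b'); first by [].
rewrite E self_form_linearr.
transitivity (c * dual_fun (m (W a) e).2 b' + dual_fun (m (W b) e).2 b'); last by [].
have aux (s t X Y : k) : s * (t * (c * X + Y)) = c * (s * (t * X)) + s * (t * Y) by ring.
by rewrite !E; exact: aux.
Qed.

Local Notation psiR w p := (self_form (Ainf_sum m w (wdeg w + 3)) p).

Lemma psiR_rotate x u v y (w1 : word x u) i (c : AA u v i) (w2 : word v y) j (b : AA y x j) :
  psiR (wcat w1 (wcons (hl c) w2)) b =
  sgn ((wdeg w1 + sdeg (hl c)) * (wdeg w2 + sdeg (hl b))) *
  psiR (wcat w2 (wcons (hl b) w1)) c.
Proof.
apply: (@rotate k AA (fun x y w j p => psiR w p)) => *.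
apply: (@Ainf_sum_cyclic k AA m (@self_form k A d)).
- exact: self_form_linear.
- exact: self_form_sym.
exact: j_map_cyclic.
Qed.

Definition drop_fun x y i (q : AA x y i) : AA x y i := (q.1, 0).

(** A functional rotated to the last place is paired with the [A]-valued part
    of a relation, which is zero, so it may be removed from the word. *)
Lemma psiR_drop x y (w : word x y) j (b : AA y x j) :
  psiR w b = psiR (@map_word k AA AA id drop_fun x y w) b.
Proof.
suff H v (l : word x v) (r : word v y) :
    psiR (wcat l r) b = psiR (wcat l (@map_word k AA AA id drop_fun v y r)) b.
  exact: (H x (wnil x) w).
clear w; elim: r l b => {v y} // v u y [i q] r IH l b.
rewrite -[existT _ i q]/(@hl k AA v u i q).
have -> : psiR (wcat l (wcons (hl q) r)) b = psiR (wcat l (wcons (hl (drop_fun q)) r)) b.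
  rewrite [LHS]psiR_rotate [RHS]psiR_rotate; congr (_ * _); set R := Ainf_sum _ _ _.
  have -> : q = drop_fun q + (0, q.2).
    by apply: pair_ext; rewrite /= ?addr0 ?add0r.
  rewrite (linD _ _ (@self_form_linearr _ _ _ _ _ _ _ R)) -[RHS]addr0; congr (_ + _).
    by congr (self_form _ _); apply: pair_ext; rewrite /= ?addr0.
  rewrite /self_form /aarrow Ainf_sum_val !(lin0 (@dapp_linear _ _ _ _ _ _)).
  by rewrite !mulr0 subr0.
have := IH (wcat l (wcons (hl (drop_fun q)) (wnil u))) b.
by rewrite -!wcatA.
Qed.

(** Each term of the expansion is a single block, or contains a functional that
    is zero. *)
Lemma expand_drop (V : zmodType) x y (w : @word k AA x y)
    (h : @pword k A x y -> V) :
  (forall w0, h (pblock w0) = 0) ->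
  (forall p, (forall o, dapps (pfuns p) o = 0) -> h p = 0) ->
  \sum_(p <- expand (@map_word k AA AA id drop_fun x y w)) h p = 0.
Proof.
elim: w h => {x y} [x|x y z [i q] w IH] h h0 hz; first by rewrite /= big_seq1.
rewrite expand_cons big_split /= IH ?add0r => [|w0|p pz].
- rewrite big1 // => p _; apply: hz => o /=.
  elim: (pfuns p) o => [|f fs IHf] [|b o] //=; last by rewrite IHf mulr0.
  by case: o => [|? ?]; rewrite ?mulr1 ?mulr0.
- exact: h0.
by apply: hz => o; rewrite pfuns_letter.
Qed.

Lemma j_map_drop x y (w : @word k AA x y) e :
  (m (@map_word k AA AA id drop_fun x y w) e).2 = 0.
Proof.
apply: expand_drop => // p pz; case: p pz => // {x y w} x u v y w f p pz.
apply: dual_ext => b; transitivity (j_dual_fun M w f p b); first by [].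
rewrite /j_dual_fun [X in _ * X](_ : _ = 0) ?mulr0 //; set T := M _.
rewrite -[RHS](tlift0 k^o T); apply: (@eq_tlift k A k^o) => o.
by have /= -> := pz o; rewrite mulr0.
Qed.

Lemma Ainf_sum_drop x y (w : @word k AA x y) e :
  (Ainf_sum m (@map_word k AA AA id drop_fun x y w) e).2 = 0.
Proof.
have sndL : linear (snd : AA x y e -> dual_quiver A x y (d - 1 + e)) by [].
rewrite /Ainf_sum (linS _ _ _ sndL) wsplits_map big_map big1 // => s _ /=.
rewrite (linS _ _ _ sndL) wsplits_map big_map big1 // => t _ /=.
set a := map_word _ _; set b := map_word _ _; set c := map_word _ _.
have -> : op_letter m b = map_letter drop_fun (op_letter m b).
  congr (existT _ _ _); apply: pair_ext => //; exact: j_map_drop.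
rewrite [X in _ *: X](_ : _ = 0) ?scaler0 //.
have := j_map_drop (wcat (projT2 s).1 (wcons (op_letter m b) (projT2 t).2)) e.
by rewrite map_word_cat.
Qed.

Lemma Ainf_sum_deg x y (w : @word k AA x y) e :
  e <> wdeg w + 3 -> Ainf_sum m w e = 0.
Proof.
move=> /eqP we; pose T u v (w1 : @word k AA x u) (w2 : word u v) (w3 : word v y) :=
  sgn (wdeg w1) *: m (wcat w1 (wcons (op_letter m w2) w3)) e.
transitivity (\sum_(s <- wsplits w) if e != wdeg w + 3 then
    \sum_(t <- wsplits (projT2 s).2 | ~~ wempty (projT2 t).1)
      T _ _ (projT2 s).1 (projT2 t).1 (projT2 t).2 else 0); first by rewrite we.
rewrite -(wsplits_sum w (fun w s => if e != wdeg w + 3 then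
    \sum_(t <- wsplits (projT2 s).2 | ~~ wempty (projT2 t).1)
      T _ _ (projT2 s).1 (projT2 t).1 (projT2 t).2 else 0)).
rewrite big1 // => s _; case: ifP => // es; rewrite big_mkcond.
transitivity (\sum_(t <- wsplits (projT2 s).2)
    if ~~ wempty (projT2 t).1 && (e != wdeg (wcat (projT2 s).1 (projT2 s).2) + 3) then
      T _ _ (projT2 s).1 (projT2 t).1 (projT2 t).2 else 0).
  by apply: eq_bigr => t _; rewrite es andbT.
rewrite -(wsplits_sum (projT2 s).2 (fun w t =>
    if ~~ wempty (projT2 t).1 && (e != wdeg (wcat (projT2 s).1 w) + 3) then
      T _ _ (projT2 s).1 (projT2 t).1 (projT2 t).2 else 0)).
rewrite big1 // => t _; case: ifP => // /andP [_ /eqP et].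
rewrite /T j_map_deg ?scaler0 ?wempty_cat_cons // => ee.
by apply: et; rewrite ee !wdeg_cat /= /sdeg /=; ring.
Qed.

Lemma j_map_Ainf : Ainf_structure m.
Proof.
split.
- exact: j_map_linear.
- by move=> x y w e w0 we; apply: j_map_deg => // ee; apply: we; rewrite ee; ring.
move=> x y w e; apply: pair_ext; first exact: Ainf_sum_val.
have [ee|/eqP ee] := eqVneq e (wdeg w + 3).
  rewrite {}ee; apply: (@dual_eq0 k A d x y _ (Ainf_sum m w _)) => b.
  rewrite psiR_drop /self_form.
  rewrite [X in _ - _ * (_ * X)](lin0 (@dapp_farrow_linear _ _ _ _ _ _ _)).
  rewrite !mulr0 subr0 /farrow Ainf_sum_drop.
  by rewrite /dapp /dual_fun mulr0.
by rewrite -/(Ainf_sum m w e) Ainf_sum_deg.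
Qed.

End AinfJ.

(** * Strict morphisms *)

Section OperationMorphism.
Variables (k : fieldType) (Q R : quiver k) (f : obj Q -> obj R).
Variable phi : forall x y i, Q x y i -> R (f x) (f y) i.
Hypothesis phi_linear : forall x y i, linear (@phi x y i).
Variables (m : operations Q) (n : operations R).
Hypothesis phi_m : forall x y (w : @word k Q x y) e, ~~ wempty w ->
  phi (m w e) = n (map_word phi w) e.

Lemma map_op_letter x y (w : @word k Q x y) : ~~ wempty w ->
  map_letter phi (op_letter m w) = op_letter n (map_word phi w).
Proof. by move=> w0; rewrite /op_letter wdeg_map -phi_m. Qed.

Lemma map_Ainf_sum x y (w : @word k Q x y) e :
  phi (Ainf_sum m w e) = Ainf_sum n (map_word phi w) e.
Proof.
rewrite /Ainf_sum wsplits_map big_map (linS _ _ _ (@phi_linear _ _ _)).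
apply: eq_bigr => s _; rewrite wsplits_map big_map (linS _ _ _ (@phi_linear _ _ _)).
apply: eq_big => t; rewrite ?wempty_map // => t0.
rewrite (linZ _ _ (@phi_linear _ _ _)) phi_m ?wempty_cat_cons // map_word_cat /=.
by rewrite map_op_letter // wdeg_map.
Qed.

End OperationMorphism.

Section StrictMorphism.
Variables (k : fieldType) (d : int) (A B : quiver k).
Variables (MA : precy A d) (MB : precy B d) (Phi : strict_morphism MA MB).
Local Notation f := (smor_obj Phi).
Local Notation AB := (mixed_quiver d f).
Local Notation AA := (mixed_quiver d (A := A) (B := A) id).
Local Notation BB := (mixed_quiver d (A := B) (B := B) id).

Local Notation Phi_word := (@map_word k A B f (smor Phi) _ _).
Local Notation Phi_arrow := (@map_arrow k A B f (smor Phi)).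
Local Notation Phi_sector := (@map_sector k A B f (smor Phi)).
Local Notation Phi_tensor := (@map_tensor k A B f (smor Phi)).

Let Phi_linear x y i : linear (Phi x y i).
Proof. exact: linearP. Qed.

Lemma map_arrow_multilinear (W : lmodType k) (g : seq (arrow B) -> W) :
  multilinear g -> multilinear (fun o => g (map Phi_arrow o)).
Proof. by move=> gL l x y i r c a b; rewrite !map_cat /= -gL -linearP. Qed.

Lemma tlift_map_tensor (W : lmodType k) (g : seq (arrow B) -> W) t :
  multilinear g -> tlift g (Phi_tensor t) = tlift (fun o => g (map Phi_arrow o)) t.
Proof.
move=> gL; rewrite /map_tensor (tlift_map _ _ (tlift_linear gL)).
by apply: eq_tlift => o; rewrite /= tlift_pure.
Qed.

Lemma degs_map o : degs d (map Phi_arrow o) = degs d o.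
Proof. by rewrite /degs -map_comp. Qed.

Lemma shift_multilinear (C : quiver k) (W : lmodType k) (g : seq (arrow C) -> W) :
  multilinear g ->
  multilinear (fun o => sgn ((d + 1) * outs_deg d (take (size o).-1 o)) *: g o).
Proof.
move=> gL l x y i r c a b.
have := multilinear_sgn d (fun s => (d + 1) * isum (take (size s).-1 s)) gL.
have E o : isum (take (size (degs d o)).-1 (degs d o)) = outs_deg d (take (size o).-1 o).
  by rewrite outs_degE /isum /degs map_take size_map.
by move=> /(_ l x y i r c a b); rewrite !E.
Qed.

(** The compatibility of a strict morphism with the unshifted discs: the shift
    of the last output is a sign in the degrees, which [Phi] preserves. *)
Lemma map_tensor_precy zs : valid_type zs ->
  Phi_tensor (MA zs) = MB (map Phi_sector zs).
Proof.
move=> vz; apply: tensor_ext => W g gL.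
have gL' := shift_multilinear gL.
pose g' o := sgn ((d + 1) * outs_deg d (take (size o).-1 o)) *: g o.
have : tlift g' (Phi_tensor (shift_last d (MA zs))) =
       tlift g' (shift_last d (MB (map Phi_sector zs))).
  by rewrite smor_compat.
rewrite tlift_map_tensor // !tlift_shift_last //; last exact: map_arrow_multilinear.
rewrite tlift_map_tensor // => E.
transitivity (tlift (fun o => sgn ((d + 1) * outs_deg d (take (size o).-1 o)) *:
    g' (map Phi_arrow o)) (MA zs)); last first.
  by rewrite E; apply: eq_tlift => o; rewrite /g' scalerA sgnK scale1r.
apply: eq_tlift => o; rewrite /g' outs_degE [outs_deg d (take _ (map _ _))]outs_degE.
rewrite size_map -map_take degs_map scalerA sgnK scale1r //.
Qed.

(** The terms of the expansions of the two images of a word of [A + B^*[d-1]].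
    This is a relation because elements are pushed forward from [A] to [B],
    whereas functionals are pulled back. *)
Inductive prel : forall x y, @pword k A x y -> @pword k B (f x) (f y) -> Prop :=
| prel_block x y (w : @word k A x y) : prel (pblock w) (pblock (Phi_word w))
| prel_cons x u v y (w : @word k A x u) i (g : dual_quiver B (f u) (f v) i)
    (p : @pword k A v y) (p' : @pword k B (f v) (f y)) : prel p p' ->
  prel (pcons w (@hl k (dual_quiver A) u v i (@dual_comp k d A B MA MB Phi v u (- i) g)) p)
       (pcons (Phi_word w) (@hl k (dual_quiver B) (f u) (f v) i g) p').

Lemma prel_letter x y z i (a : A x y i) (p : @pword k A y z) p' : prel p p' ->
  prel (pcons_letter (hl a) p) (pcons_letter (hl (Phi _ _ _ a)) p').
Proof.
move=> pp; case: pp x a => {y z p p'} [y z w|y u v z w j g p p' pp] x a /=.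
  exact: (prel_block (wcons (hl a) w)).
exact: (prel_cons (wcons (hl a) w) g pp).
Qed.

Lemma prel_first x y (p : @pword k A x y) p' : prel p p' ->
  pfirst p' = existT _ (f (projT1 (pfirst p))) (Phi_word (projT2 (pfirst p))).
Proof. by elim. Qed.

Lemma prel_rest x y (p : @pword k A x y) p' : prel p p' ->
  prest p' = map Phi_sector (prest p).
Proof. by elim=> // {}x u v {}y w i g {}p {}p' _ /= ->; rewrite map_rcons. Qed.

Lemma prel_sectors x y (p : @pword k A x y) p' : prel p p' ->
  psectors p' = map Phi_sector (psectors p).
Proof. by move=> pp; rewrite /psectors (prel_first pp) (prel_rest pp). Qed.

Lemma prel_tdegs x y (p : @pword k A x y) p' : prel p p' ->
  map (tdeg d) (pfuns p') = map (tdeg d) (pfuns p).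
Proof. by elim=> // {}x u v {}y w i g {}p {}p' _ /= E; rewrite !map_rcons E. Qed.

Lemma sector_deg_map z : sector_deg (Phi_sector z) = sector_deg z.
Proof. exact: wdeg_map. Qed.

Lemma sdegs_map zs : map (@sector_deg k B) (map Phi_sector zs) =
  map (@sector_deg k A) zs.
Proof. by rewrite -map_comp; apply: eq_map => z; exact: sector_deg_map. Qed.

Lemma prel_pdeg x y (p : @pword k A x y) p' : prel p p' -> pdeg d p' = pdeg d p.
Proof.
by move=> pp; rewrite /pdeg (prel_tdegs pp) (prel_sectors pp) !sectors_degE sdegs_map.
Qed.

Lemma prel_empty x y (p : @pword k A x y) p' : prel p p' -> pempty p' = pempty p.
Proof. by case=> // *; exact: wempty_map. Qed.

Lemma dapp_comp u v i (g : dual_quiver B (f u) (f v) i) (b : arrow A) :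
  tag b = (v, u) ->
  dapp (@mk_arrow k (dual_quiver A) u v
    (@hl k (dual_quiver A) u v i (@dual_comp k d A B MA MB Phi v u (- i) g))) b =
  dapp (@mk_arrow k (dual_quiver B) _ _ (@hl k (dual_quiver B) (f u) (f v) i g))
    (Phi_arrow b).
Proof.
case/arrow_of_obj => j [a ->]; rewrite /dapp /=.
have [e|e] := pselect (j = - i).
  by subst j; rewrite !arrow_compK.
by rewrite !arrow_comp_deg // /dual_fun !linear0.
Qed.

(** The condition on the objects of [o] cannot be dropped: [Phi] may identify
    objects, and then a functional of [B] can be nonzero on the image of an
    arrow of [A] whose objects do not match those of its pull-back. *)
Lemma prel_dapps x y (p : @pword k A x y) p' : prel p p' -> forall o,
  map tag o = map (fun g : arrow (dual_quiver A) => ((tag g).2, (tag g).1)) (pfuns p) ->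
  dapps (pfuns p') (map Phi_arrow o) = dapps (pfuns p) o.
Proof.
elim=> {x y p p'} [x y w|x u v y w i g p p' pp IH] o /=; first by case: o.
case/lastP: o => [|o b]; first by case: (pfuns p).
rewrite !map_rcons => /rcons_inj [/[dup] oE /IH E bE].
have so : size o = size (pfuns p) by move/(congr1 size): oE; rewrite !size_map.
have sp : size (pfuns p') = size (pfuns p).
  by move/(congr1 size): (prel_tdegs pp); rewrite !size_map.
rewrite -!cats1 !dapps_cat ?size_map ?so ?sp //= E !mulr1.
by rewrite (dapp_comp _ bE).
Qed.

(** Evaluating the disc of [A] on functionals composed with [Phi], and applying
    [Phi] to the last output, is pairing the image of the disc, which is the
    disc of [B]. *)
Lemma prel_val x y (p : @pword k A x y) p' e : prel p p' -> ~~ pempty p ->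
  Phi x y e (j_val MA p e) = j_val MB p' e.
Proof.
move=> pp p0; have vp := pvalid p0.
rewrite !j_valE.
rewrite (linZ _ _ (@Phi_linear x y e)) (prel_tdegs pp) (prel_sectors pp) sdegs_map.
congr (_ *: _); rewrite -map_tensor_precy // tlift_map_tensor; last exact: pair_last_multilinear.
rewrite (tlift_map _ _ (@Phi_linear x y e)).
apply: (multi_tlift MA vp) => [||o oO _].
- exact/multilinear_comp/pair_last_multilinear.
- exact/map_arrow_multilinear/pair_last_multilinear.
case/lastP: o oO => [|o b] oO.
  by move/(congr1 size): oO; rewrite size_out_objs size_psectors.
move: oO; rewrite out_objs_psectors (map_rcons tag) => /rcons_inj [oE bE].
rewrite /= map_rcons /pair_last !pair_with_last (linZ _ _ (@Phi_linear x y e)).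
rewrite (prel_dapps pp oE); congr (_ *: _).
have [j [a ->]] := arrow_of_obj bE.
have [je|je] := pselect (j = e).
  by subst j; rewrite !arrow_compK.
by rewrite !arrow_comp_deg // (lin0 (@Phi_linear x y e)).
Qed.

Lemma prel_dual x y (p : @pword k A x y) p' e : prel p p' ->
  @dual_comp k d A B MA MB Phi y x (- (d - 1 + e)) (j_dual MB p' e) = j_dual MA p e.
Proof.
move=> pp; apply: dual_ext => b.
transitivity (dual_fun (j_dual MB p' e) (Phi _ _ _ b)); first by [].
case: pp b => {x y p p'} [x y w|x u v y w i g p p' pp] b; first by [].
set q' := pcons _ _ p'; set q := pcons _ _ p.
have qq : prel q q' by exact: prel_cons.
have jE (C : quiver k) (M : precy C d) x' u' v' y' (w' : @word k C x' u') f'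
    (r : @pword k C v' y') (b' : C y' x' (- (d - 1 + e))) :
    e = pdeg d (@pcons k C x' u' v' y' w' f' r) + 2 ->
  dual_fun (j_dual M (pcons w' f' r) e) b' =
  sgn (dual_exp d (map (@sector_deg k C) (psectors (pcons w' f' r)))
    (map (tdeg d) (pfuns (pcons w' f' r))) (wdeg w') (sectors_deg (prest r))) *
  full_pairing M (pfuns (pcons w' f' r))
    (Sector (wcat (projT2 (pfirst r)) (wcons (hl b') w')) :: prest r).
  by move=> eE; subst e; rewrite j_dualE.
have [ee|ne] := pselect (e = pdeg d q + 2); last first.
  by rewrite !j_dual_deg // (prel_pdeg qq).
have E' : e = pdeg d q' + 2 by rewrite (prel_pdeg qq).
rewrite !jE // -/q -/q' (prel_tdegs qq) (prel_sectors qq) sdegs_map wdeg_map.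
rewrite (prel_rest pp) !sectors_degE sdegs_map; congr (_ * _).
rewrite (prel_first pp) /=.
set zs := Sector (wcat (projT2 (pfirst p)) (wcons (hl b) w)) :: prest p.
have vz : valid_type zs by exact: valid_closed.
have -> : Sector (wcat (Phi_word (projT2 (pfirst p))) (wcons (hl (Phi y x _ b)) (Phi_word w)))
    :: map Phi_sector (prest p) = map Phi_sector zs.
  by rewrite /zs /= /map_sector /= map_word_cat.
rewrite /full_pairing -map_tensor_precy // (tlift_map_tensor (W := k^o)); last first.
  exact: dapps_multilinear.
apply: (multi_tlift MA vz) => [||o oO _].
- exact/(map_arrow_multilinear (W := k^o))/dapps_multilinear.
- exact: dapps_multilinear.
apply: (prel_dapps qq); rewrite oO /zs.
exact: (out_objs_closed w (@hl k (dual_quiver A) u v i (@dual_comp k d A B MA MB Phi v u (- i) g))).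
Qed.

(** The expansions of the two images of a word correspond term by term. *)
Lemma expand_prel (V : zmodType) x y (w : @word k AB x y)
    (H : @pword k A x y -> V) (H' : @pword k B (f x) (f y) -> V) :
  (forall p p', prel p p' -> H p = H' p') ->
  \sum_(p <- expand (@map_word k AB AA id (@to_AA k d A B MA MB Phi) x y w)) H p =
  \sum_(p <- expand (@map_word k AB BB f (@to_BB k d A B MA MB Phi) x y w)) H' p.
Proof.
elim: w H H' => {x y} [x|x y z [i q] w IH] H H' HH.
  by rewrite /= !big_seq1; apply: HH; exact: (prel_block (@wnil k A x)).
rewrite [map_word _ (wcons _ _)]/= [in RHS](_ : map_word _ (wcons _ _) = wcons
  (@hl k BB (f x) (f y) i (to_BB q)) (map_word (@to_BB k d A B MA MB Phi) w)) //.
rewrite !expand_cons; apply: IH => p p' pp; congr (_ + _); apply: HH.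
  exact: prel_letter.
exact: (prel_cons (@wnil k A x) _ pp).
Qed.

Lemma to_AA_sm x y (w : @word k AB x y) e : ~~ wempty w ->
  to_AA (sm_mixed Phi x y w e) =
  j_map MA (@map_word k AB AA id (@to_AA k d A B MA MB Phi) x y w) e.
Proof.
move=> w0; apply: pair_ext => //=.
have dL : linear (fun u : dual_quiver B (f x) (f y) (d - 1 + e) =>
  @dual_comp k d A B MA MB Phi y x (- (d - 1 + e)) u).
  by move=> c u v; apply: dual_ext.
rewrite (linS _ _ _ dL); symmetry; apply: expand_prel => p p' pp.
by rewrite (prel_dual e pp).
Qed.

Lemma to_BB_sm x y (w : @word k AB x y) e : ~~ wempty w ->
  to_BB (sm_mixed Phi x y w e) =
  j_map MB (@map_word k AB BB f (@to_BB k d A B MA MB Phi) x y w) e.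
Proof.
move=> w0; apply: pair_ext => //=; rewrite (linS _ _ _ (@Phi_linear x y e)).
set wA := map_word _ _; set wB := map_word _ _.
transitivity (\sum_(p <- expand wA) if ~~ wempty wA then Phi x y e (j_val MA p e) else 0).
  by rewrite wempty_map w0.
transitivity (\sum_(p <- expand wB) if ~~ wempty wB then j_val MB p e else 0); last first.
  by rewrite wempty_map w0.
rewrite (expand_inv wA (fun _ b p => if ~~ b then Phi x y e (j_val MA p e) else 0)).
rewrite (expand_inv wB (fun _ b p => if ~~ b then j_val MB p e else 0)).
apply: expand_prel => p p' pp; rewrite (prel_empty pp); case: ifP => // p0.
exact: prel_val.
Qed.

Lemma to_AA_linear x y i : linear (@to_AA k d A B MA MB Phi x y i).
Proof. by move=> c a b; apply: pair_ext => //=; apply: dual_ext. Qed.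

Lemma to_BB_linear x y i : linear (@to_BB k d A B MA MB Phi x y i).
Proof. by move=> c a b; apply: pair_ext => //=; exact: linearP. Qed.

Local Notation wAA := (@map_word k AB AA id (@to_AA k d A B MA MB Phi) _ _).
Local Notation wBB := (@map_word k AB BB f (@to_BB k d A B MA MB Phi) _ _).

Lemma sm_mixed_linear x y e : word_multilinear (fun w : @word k AB x y => sm_mixed Phi x y w e).
Proof.
move=> u v i l r c a b; apply: pair_ext.
  have := @j_map_linear _ _ _ MA x y e _ _ _ (wAA l) (wAA r) c (to_AA a) (to_AA b).
  by move/(congr1 fst); rewrite -to_AA_linear /sm_mixed /= !map_word_cat.
have := @j_map_linear _ _ _ MB _ _ e _ _ _ (wBB l) (wBB r) c (to_BB a) (to_BB b).
by move/(congr1 snd); rewrite -to_BB_linear /sm_mixed /= !map_word_cat.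
Qed.

Lemma sm_mixed_Ainf : Ainf_structure (sm_mixed Phi).
Proof.
split; first exact: sm_mixed_linear.
- move=> x y w e w0 we; have ne : e <> wdeg w + 2 by move=> ee; apply: we; rewrite ee; ring.
  have zA : j_map MA (wAA w) e = 0 by apply: j_map_deg; rewrite ?wempty_map ?wdeg_map.
  have zB : j_map MB (wBB w) e = 0 by apply: j_map_deg; rewrite ?wempty_map ?wdeg_map.
  by apply: pair_ext; [exact: (congr1 fst zA) | exact: (congr1 snd zB)].
move=> x y w e; rewrite -/(Ainf_sum (sm_mixed Phi) w e); apply: pair_ext.
  have := map_Ainf_sum to_AA_linear to_AA_sm w e.
  by move/(congr1 fst) => /= ->; rewrite Ainf_sum_val.
have := map_Ainf_sum to_BB_linear to_BB_sm w e.
move/(congr1 snd) => /= ->.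
by have -> : Ainf_sum (j_map MB) (wBB w) e = 0 := Ainf_relation (j_map_Ainf MB) _ _.
Qed.

(** By definition the mixed form is the pull-back along [to_BB] of the natural
    form of [B + B^*[d-1]], and [to_BB] commutes with the operations. *)
Lemma sm_mixed_cyclic : almost_cyclic (sm_mixed Phi) (mixed_form Phi).
Proof.
move=> x y z w i q j p.
have formE u v a b (P : AB u v a) (Q : AB v u b) :
  mixed_form Phi u v a b P Q = self_form (to_BB P) (to_BB Q) by [].
have opE u v (W : @word k AB u v) : ~~ wempty W -> forall c (P : AB v u c),
    mixed_form Phi u v _ _ (tagged (op_letter (sm_mixed Phi) W)) P =
    self_form (tagged (op_letter (j_map MB) (wBB W))) (to_BB P).
  by move=> W0 c P; rewrite formE /op_letter wdeg_map /= to_BB_sm.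
rewrite !opE ?wempty_cat_cons // map_word_cat.
have := j_map_cyclic MB (wBB w) (to_BB q) (to_BB p).
by rewrite wdeg_map.
Qed.

End StrictMorphism.

Theorem proposition5p11 (k : fieldType)
    (char_not2 : 2%N \notin [pchar k]) (char_not3 : 3%N \notin [pchar k])
    (d : int) (A B : quiver k) (MA : precy A d) (MB : precy B d)
    (Phi : strict_morphism MA MB) :
  Ainf_structure (sm_mixed Phi) /\ almost_cyclic (sm_mixed Phi) (mixed_form Phi).
Proof. by split; [exact: sm_mixed_Ainf | exact: sm_mixed_cyclic]. Qed.
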